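(* The $\imath$Hall algebra ${}^{\imath}\widetilde{\mathcal H}(\Bbbk Q_J)$ of the Jordan quiver is isomorphic to (1) the polynomial $\mathbb Q$-algebra in the infinitely many generators $[K_S]$, $[S^{(1^r)}]$ for $r\ge1$; (2) the polynomial $\mathbb Q$-algebra in the infinitely many generators $[K_S]$, $[S^{(r)}]$ for $r\ge1$. (That is, in each case the listed elements are algebraically independent over $\mathbb Q$ and generate the algebra.)
   Context: Let $\Bbbk=\mathbb F_q$ be the field with $q$ elements. Let $\mathcal A$ be the category of finite-dimensional nilpotent representations of the Jordan quiver $Q_J$ over $\Bbbk$ (finite-dimensional $\Bbbk[x]$-modules on which $x$ is nilpotent). Its indecomposables are $S^{(n)}=\Bbbk[x]/(x^n)$, $n\ge1$; $S=S^{(1)}$; for a partition $\lambda=(\lambda_1,\ldots,\lambda_r)$ put $S^{(\lambda)}=S^{(\lambda_1)}\oplus\cdots\oplus S^{(\lambda_r)}$. Let $\mathcal C_1(\mathcal A)$ be the abelian category of 1-periodic complexes: pairs $(M,d)$, $M\in\mathcal A$, $d:M\to M$ a morphism with $d^2=0$, morphisms being morphisms in $\mathcal A$ commuting with the differentials. Objects $M\in\mathcal A$ are identified with $(M,0)$; $H(M,d)=\ker d/\operatorname{Im}d$; $K_X=(X\oplus X,\begin{pmatrix}0&\mathrm{Id}\\0&0\end{pmatrix})$. The Hall algebra $\mathcal H(\mathcal C_1(\mathcal A))$ is the $\mathbb Q$-vector space with basis the isoclasses $[M]$ of objects and product $[M]\diamond[N]=\sum_{[L]}\frac{|\mathrm{Ext}^1(M,N)_L|}{|\mathrm{Hom}(M,N)|}[L]$,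 where $\mathrm{Ext}^1(M,N)_L$ is the set of extension classes $0\to N\to L'\to M\to0$ with $L'\cong L$. The $\imath$Hall algebra ${}^{\imath}\widetilde{\mathcal H}(\Bbbk Q_J)$ is the quotient of $\mathcal H(\mathcal C_1(\mathcal A))$ by the two-sided ideal generated by all $[M^\bullet]-[N^\bullet]$ with $H(M^\bullet)\cong H(N^\bullet)$ and $\operatorname{Im}d_{M^\bullet},\operatorname{Im}d_{N^\bullet}$ having the same class in $K_0(\mathcal A)\cong\mathbb Z$ (i.e. the same dimension). *)

(* Defs.v *)
From HB Require Import structures.
From mathcomp Require Import all_boot all_order all_algebra.
From mathcomp Require Import finmap boolp classical_sets functions.
From mathcomp Require Import cardinality fsbigop.
From mathcomp Require Import monalg.
Set Implicit Arguments.
Unset Strict Implicit.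
Unset Printing Implicit Defensive.
Import GRing.Theory.
Local Open Scope ring_scope.
Local Open Scope quotient_scope.

(* Vectors are row vectors and endomorphisms act by right multiplication, so
   a linear map M -> N is a matrix with dim M rows and dim N columns, and the
   composite "f, then g" is f *m g. *)

Section NilpotentRepresentations.
Variable F : finFieldType.

Record nilrep := NilRep {
  rdim : nat;
  xact : 'M[F]_rdim;
  xact_nil : exists k, xact ^+ k = 0 }.

Definition is_rhom (M N : nilrep) (f : 'M[F]_(rdim M, rdim N)) : bool :=
  xact M *m f == f *m xact N.

Definition rep_iso (M N : nilrep) : bool :=
  [exists f : 'M[F]_(rdim M, rdim N), [&& is_rhom f, row_free f & row_full f]].

Lemma zero_nil : exists k, (0 : 'M[F]_0) ^+ k = 0.
Proof. by exists 1%N; rewrite expr1. Qed.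

Definition rep0 : nilrep := NilRep zero_nil.

Lemma expr_block_diag m n (A : 'M[F]_m) (B : 'M[F]_n) k :
  block_mx A 0 0 B ^+ k = block_mx (A ^+ k) 0 0 (B ^+ k).
Proof.
elim: k => [|k IHk]; first by rewrite !expr0 -scalar_mx_block.
rewrite !exprS IHk -!mulmxE mulmx_block.
by rewrite !mulmx0 !mul0mx !addr0 !add0r.
Qed.

Lemma dsum_nil (M N : nilrep) :
  exists k, block_mx (xact M) 0 0 (xact N) ^+ k = 0.
Proof.
have [[a ha] [b hb]] := (xact_nil M, xact_nil N).
exists (a + b)%N; rewrite expr_block_diag [in X in block_mx X]exprD ha mul0r.
by rewrite exprD hb mulr0 block_mx0.
Qed.

Definition dsum (M N : nilrep) : nilrep := NilRep (dsum_nil M N).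

(* Multiplication by x on k[x]/(x^n) in the basis 1, x, ..., x^(n-1). *)
Definition jordan_mx n : 'M[F]_n :=
  \matrix_(i < n, j < n) (j == i.+1 :> nat)%:R.

Lemma jordan_mx_exp n k (i j : 'I_n) :
  (jordan_mx n ^+ k) i j = (j == (i + k)%N :> nat)%:R.
Proof.
elim: k i j => [|k IHk] i j.
  by rewrite expr0 mxE addn0 eq_sym.
rewrite exprS mxE; case: (ltnP i.+1 n) => [lt_in | le_ni].
  rewrite (bigD1 (Ordinal lt_in)) //= big1 => [|l ne_l].
    by rewrite IHk mxE /= eqxx mul1r addr0 addSnnS.
  rewrite mxE; case: eqP => [e|]; last by rewrite mul0r.
  by case/eqP: ne_l; apply: val_inj.
rewrite big1 => [|l _]; last first.
  rewrite mxE; case: eqP => [e|]; last by rewrite mul0r.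
  by have := ltn_ord l; rewrite e ltnNge le_ni.
case: eqP => // e; have := ltn_ord j.
by rewrite e -addSnnS ltnNge (leq_trans le_ni) ?leq_addr.
Qed.

Lemma jordan_nil n : exists k, jordan_mx n ^+ k = 0.
Proof.
exists n; apply/matrixP=> i j; rewrite jordan_mx_exp mxE.
case: eqP => // e; have := ltn_ord j.
by rewrite e ltnNge leq_addl.
Qed.

(* S^(n); it is the zero representation for n = 0. *)
Definition Sn (n : nat) : nilrep := NilRep (jordan_nil n).

(* S^(la), for a partition la given by its list of (positive) parts. *)
Definition Spart (la : seq nat) : nilrep :=
  foldr (fun n M => dsum (Sn n) M) rep0 la.

End NilpotentRepresentations.

Section Complexes.
Variable F : finFieldType.

Record cplx := Cplx {
  und :> nilrep F;
  diff : 'M[F]_(rdim und);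
  diff_hom : is_rhom diff;
  diff_sq0 : diff *m diff = 0 }.

Definition is_hom (M N : cplx) (f : 'M[F]_(rdim M, rdim N)) : bool :=
  is_rhom f && (diff M *m f == f *m diff N).

Definition is_iso (M N : cplx) (f : 'M[F]_(rdim M, rdim N)) : bool :=
  [&& is_hom f, row_free f & row_full f].

Definition cplx_iso (M N : cplx) : bool :=
  [exists f : 'M[F]_(rdim M, rdim N), is_iso f].

Lemma stalk_hom (M : nilrep F) : @is_rhom F M M 0.
Proof. by rewrite /is_rhom mulmx0 mul0mx. Qed.

(* The object M of A viewed as the complex (M, 0). *)
Definition stalk (M : nilrep F) : cplx := Cplx (stalk_hom M) (mulmx0 _ _).

(* The block matrix (0 Id; 0 0) acting on columns, transposed. *)
Definition Kdiff (X : nilrep F) : 'M[F]_(rdim (dsum X X)) :=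
  block_mx 0 0 1%:M 0.

Lemma Kdiff_hom X : @is_rhom F (dsum X X) (dsum X X) (Kdiff X).
Proof.
rewrite /is_rhom /= !mulmx_block.
by rewrite !(mulmx0, mul0mx, mulmx1, mul1mx, addr0, add0r).
Qed.

Lemma Kdiff_sq0 X : Kdiff X *m Kdiff X = 0.
Proof.
rewrite /Kdiff mulmx_block !(mulmx0, mul0mx, addr0).
exact: block_mx0.
Qed.

Definition Kcplx (X : nilrep F) : cplx := Cplx (Kdiff_hom X) (Kdiff_sq0 X).

Section Homology.
Variable M : cplx.

(* The rows of ker_incl form a basis of ker d, and ker_x is the matrix of x in
   that basis; the rows of im_in_ker are the coordinates of the rows of d, so
   they span Im d inside ker d; hom_proj is a surjection with kernel Im d. *)
Definition ker_incl : 'M[F]_(\rank (kermx (diff M)), rdim M) :=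
  row_base (kermx (diff M)).
Definition ker_x := ker_incl *m xact M *m pinvmx ker_incl.
Definition im_in_ker := diff M *m pinvmx ker_incl.
Definition hom_proj :
    'M[F]_(\rank (kermx (diff M)), \rank (cokermx im_in_ker)) :=
  col_base (cokermx im_in_ker).
Definition homology_x := pinvmx hom_proj *m ker_x *m hom_proj.

Lemma ker_incl_free : row_free ker_incl.
Proof. exact: row_base_free. Qed.

Lemma sub_ker_incl k (A : 'M[F]_(k, rdim M)) :
  (A <= ker_incl)%MS = (A *m diff M == 0).
Proof. by rewrite eq_row_base; apply/sub_kermxP/eqP. Qed.

Lemma ker_xE : ker_x *m ker_incl = ker_incl *m xact M.
Proof.
apply: mulmxKpV; rewrite sub_ker_incl -mulmxA (eqP (diff_hom M)) mulmxA.
by have /eqP-> : ker_incl *m diff M == 0; rewrite ?mul0mx // -sub_ker_incl.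
Qed.

Lemma im_in_kerE : im_in_ker *m ker_incl = diff M.
Proof. by apply: mulmxKpV; rewrite sub_ker_incl diff_sq0. Qed.

Lemma hom_proj_full : row_full hom_proj.
Proof. exact: col_base_full. Qed.

Lemma hom_proj_ker k (A : 'M[F]_(k, _)) :
  (A <= im_in_ker)%MS = (A *m hom_proj == 0).
Proof.
rewrite submxE -{1}(mulmx_base (cokermx im_in_ker)) mulmxA.
apply/eqP/eqP=> [e|->]; last by rewrite mul0mx.
by apply: (row_free_inj (row_base_free (cokermx im_in_ker))); rewrite /= e mul0mx.
Qed.

Lemma homology_xE : hom_proj *m homology_x = ker_x *m hom_proj.
Proof.
have h : (im_in_ker *m ker_x <= im_in_ker)%MS.
  suff -> : im_in_ker *m ker_x = xact M *m im_in_ker by apply: submxMl.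
  apply: (row_free_inj ker_incl_free).
  rewrite /= -(mulmxA im_in_ker) ker_xE -(mulmxA (xact M)) im_in_kerE mulmxA.
  rewrite im_in_kerE.
  exact/esym/eqP/diff_hom.
have h2 : ((1%:M - hom_proj *m pinvmx hom_proj) <= im_in_ker)%MS.
  by rewrite hom_proj_ker mulmxBl mul1mx -mulmxA (mulVpmx hom_proj_full) mulmx1 subrr.
have h3 : ((1%:M - hom_proj *m pinvmx hom_proj) *m ker_x <= im_in_ker)%MS.
  exact: submx_trans (submxMr _ h2) h.
move: h3; rewrite hom_proj_ker mulmxBl mul1mx mulmxBl subr_eq0 => /eqP->.
by rewrite /homology_x !mulmxA.
Qed.

Lemma homology_nil : exists k, homology_x ^+ k = 0.
Proof.
have [k hk] := xact_nil M; exists k.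
have kx : ker_x ^+ k *m ker_incl = ker_incl *m xact M ^+ k.
  elim: (k) => [|l IHl]; first by rewrite !expr0 mulmx1 mul1mx.
  by rewrite exprSr exprS -!mulmxE -mulmxA ker_xE mulmxA IHl -mulmxA !mulmxE -exprS -exprSr.
have px : hom_proj *m homology_x ^+ k = ker_x ^+ k *m hom_proj.
  elim: (k) => [|l IHl]; first by rewrite !expr0 mulmx1 mul1mx.
  by rewrite exprSr exprSr -!mulmxE mulmxA IHl -mulmxA homology_xE mulmxA.
have kx0 : ker_x ^+ k = 0.
  by apply: (row_free_inj ker_incl_free); rewrite /= kx hk mulmx0 mul0mx.
rewrite -[LHS]mul1mx -(mulVpmx hom_proj_full) -mulmxA px kx0.
by rewrite mul0mx mulmx0.
Qed.

Definition homology : nilrep F := NilRep homology_nil.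

End Homology.

Lemma inv_mx m n (f : 'M[F]_(m, n)) : row_free f -> row_full f ->
  (f *m pinvmx f = 1%:M) * (pinvmx f *m f = 1%:M).
Proof. by move=> fr fu; rewrite mulmxVp ?mulVpmx. Qed.

Lemma inv_intertwine m n (f : 'M[F]_(m, n)) A B : row_free f -> row_full f ->
  A *m f = f *m B -> B *m pinvmx f = pinvmx f *m A.
Proof.
move=> fr fu e; have [k1 k2] := inv_mx fr fu.
by rewrite -[LHS]mul1mx -k2 -!mulmxA (mulmxA f B) -e -!mulmxA k1 mulmx1.
Qed.

Lemma cplx_iso_equiv : equiv_class_of cplx_iso.
Proof.
have mxr (M N P : cplx) (f : 'M[F]_(rdim M, rdim N)) (g : 'M[F]_(rdim N, rdim P)) :
    is_iso f -> is_iso g -> is_iso (f *m g).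
  case/and3P=> /andP[/eqP f1 /eqP f2] f3 f4.
  case/and3P=> /andP[/eqP g1 /eqP g2] g3 g4.
  rewrite /is_iso /is_hom /is_rhom !mulmxA f1 f2 -!mulmxA g1 g2 !eqxx /=.
  rewrite /row_free /row_full mxrankMfree // (eqP f3) eqxx /=.
  by apply/eqP; rewrite -(eqP g4) (eqP g3) -(eqP f4) (eqP f3).
have sym (M N : cplx) : cplx_iso M N -> cplx_iso N M.
  case/existsP=> f /and3P[/andP[/eqP f1 /eqP f2] f3 f4].
  have [k1 k2] := inv_mx f3 f4.
  apply/existsP; exists (pinvmx f); rewrite /is_iso /is_hom /is_rhom.
  rewrite (inv_intertwine f3 f4 f1) (inv_intertwine f3 f4 f2) !eqxx /=.
  by apply/andP; split; [apply/row_freeP; exists f|apply/row_fullP; exists f].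
split=> [M | M N | M N P /= ].
- apply/existsP; exists 1%:M; rewrite /is_iso /is_hom /is_rhom.
  by rewrite !mulmx1 !mul1mx !eqxx row_free_unit row_full_unit unitmx1.
- by apply/idP/idP; apply: sym.
by case/existsP=> f hf /existsP[g hg]; apply/existsP; exists (f *m g); apply: mxr.
Qed.

HB.instance Definition _ := gen_eqMixin cplx.
HB.instance Definition _ := gen_choiceMixin cplx.

Canonical cplx_iso_rel := EquivRelPack cplx_iso_equiv.

Definition isoclass : choiceType := {eq_quot cplx_iso_rel}.
Definition icls (M : cplx) : isoclass := \pi_{eq_quot cplx_iso_rel} M.

Lemma iclsP (M N : cplx) : reflect (icls M = icls N) (cplx_iso M N).
Proof. by apply: (iffP idP) => [h|/eqmodP//]; apply/eqmodP. Qed.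

End Complexes.

Section HallAlgebra.
Variable F : finFieldType.
Implicit Types M N L : cplx F.

Definition hom_set M N : {set 'M[F]_(rdim M, rdim N)} :=
  [set f | is_hom f].

(* The short exact sequences 0 -> N -i-> L -p-> M -> 0, as pairs (i, p). *)
Definition ses M N L : {set 'M[F]_(rdim N, rdim L) * 'M[F]_(rdim L, rdim M)} :=
  [set e | [&& is_hom e.1, is_hom e.2, row_free e.1, row_full e.2
             & (e.1 == kermx e.2)%MS]].

Definition ses_equiv M N L :
    rel ('M[F]_(rdim N, rdim L) * 'M[F]_(rdim L, rdim M)) :=
  fun e e' => [exists h : 'M[F]_(rdim L, rdim L),
    [&& @is_iso F L L h, e.1 *m h == e'.1 & h *m e'.2 == e.2]].

(* Ext^1(M, N)_L as a set of equivalence classes of extensions. An extension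
   with middle term L' isomorphic to L is equivalent, by transport, to one with
   middle term L, so only the latter are taken as representatives. *)
Definition ext_set M N L := equivalence_partition (@ses_equiv M N L) (ses M N L).

Definition hall_coef M N L : rat := #|ext_set M N L|%:R / #|hom_set M N|%:R.

Definition hall := {malg rat[isoclass F]}.

HB.instance Definition _ := GRing.Lmodule.on hall.

Definition hcls M : hall := << icls M >>.

(* The sum has finite support (hall_coef_finite). *)
Definition hall_mul_basis (a b : isoclass F) : hall :=
  \sum_(c \in [set: isoclass F])
     (hall_coef (repr a) (repr b) (repr c) *: (<< c >> : hall)).

Definition hall_mul (u v : hall) : hall :=
  \sum_(a <- msupp u) \sum_(b <- msupp v)
     (u@_a * v@_b) *: hall_mul_basis a b.

Definition hall_one : hall := hcls (stalk (rep0 F)).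

Lemma ses_dim M N L e : e \in ses M N L -> rdim L = (rdim N + rdim M)%N.
Proof.
rewrite inE => /and5P[_ _ /eqP fr fu /eqmxP ke].
have := mxrank_ker e.2; rewrite -ke fr (eqP fu) => ->.
by rewrite subnK // -(eqP fu) rank_leq_row.
Qed.

Lemma hall_coef_dim M N L :
  hall_coef M N L != 0 -> rdim L = (rdim N + rdim M)%N.
Proof.
have [e he _|h0] := pickP [in ses M N L]; first exact: ses_dim he.
rewrite /hall_coef /ext_set (_ : ses M N L = finset.set0).
  rewrite /equivalence_partition (_ : [set _ | _ in _]%SET = finset.set0).
    by rewrite cards0 mul0r eqxx.
  exact: imset0.
by apply/setP=> e; rewrite finset.in_set0; apply: h0.
Qed.

Lemma cplx_iso_cast M N (e : rdim M = rdim N) :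
  castmx (e, e) (xact M) = xact N -> castmx (e, e) (diff M) = diff N ->
  cplx_iso M N.
Proof.
case: M N e => [[m x hx] d hd hd2] [[n y hy] c hc hc2] /= e; subst n.
rewrite !castmx_id => xy dc; apply/existsP; exists 1%:M.
rewrite /is_iso /is_hom /is_rhom /= !mulmx1 !mul1mx xy dc !eqxx.
by rewrite row_free_unit row_full_unit unitmx1.
Qed.

Lemma isoclass_finite n :
  finite_set [set c : isoclass F | rdim (repr c) = n]%classic.
Proof.
pose P (p : 'M[F]_n * 'M[F]_n) (M : cplx F) :=
  exists e : rdim M = n, (castmx (e, e) (xact M) = p.1) /\
                         (castmx (e, e) (diff M) = p.2).
pose g p := icls (xget (stalk (rep0 F)) [set M | P p M]%classic).
apply: (@sub_finite_set _ _ (g @` [set: 'M[F]_n * 'M[F]_n])%classic); last first.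
  by apply: finite_image; apply: finite_finset.
move=> c /= ec; pose M := repr c; have eM : rdim M = n by [].
exists (castmx (eM, eM) (xact M), castmx (eM, eM) (diff M)) => //.
have /= := @xgetI _ (stalk (rep0 F))
  [set N | P (castmx (eM, eM) (xact M), castmx (eM, eM) (diff M)) N]%classic M.
case; first by exists eM.
move=> e' /= [h1 h2]; rewrite -[RHS]reprK; apply/iclsP.
have cc A : castmx (etrans e' (esym eM), etrans e' (esym eM)) A =
    castmx (esym eM, esym eM) (castmx (e', e') A) by rewrite castmx_comp.
by apply: (@cplx_iso_cast _ _ (etrans e' (esym eM)));
  rewrite cc ?h1 ?h2 castmx_comp castmx_id.
Qed.

Lemma hall_coef_finite M N :
  finite_set [set c : isoclass F | hall_coef M N (repr c) != 0]%classic.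
Proof.
apply: sub_finite_set (isoclass_finite (rdim N + rdim M)) => c /=.
exact: hall_coef_dim.
Qed.

Lemma hall_mulw (d1 d2 : {fset isoclass F}) u v :
  (msupp u `<=` d1)%fset -> (msupp v `<=` d2)%fset ->
  hall_mul u v =
    \sum_(a <- d1) \sum_(b <- d2) (u@_a * v@_b) *: hall_mul_basis a b.
Proof.
move=> s1 s2; rewrite /hall_mul (big_fset_incl _ s1) /=; last first.
  move=> a _ /mcoeff_outdom ua; rewrite big1 // => b _.
  by rewrite ua mul0r scale0r.
apply: eq_bigr => a _; apply: big_fset_incl => // b _ /mcoeff_outdom vb.
by rewrite vb mulr0 scale0r.
Qed.

Lemma hall_mul_basisE a b : hall_mul << a >> << b >> = hall_mul_basis a b.
Proof.
rewrite (hall_mulw (msuppU_le (k := a)) (msuppU_le (k := b))).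
by rewrite !big_seq_fset1 !mcoeffUU mulr1 scale1r.
Qed.

Lemma hall_mulDl u1 u2 v : hall_mul (u1 + u2) v = hall_mul u1 v + hall_mul u2 v.
Proof.
pose d := (msupp u1 `|` msupp u2)%fset.
rewrite (@hall_mulw d (msupp v) (u1 + u2)) ?msuppD_le //.
rewrite (@hall_mulw d (msupp v) u1) ?fsubsetUl //.
rewrite (@hall_mulw d (msupp v) u2) ?fsubsetUr // -big_split /=.
apply: eq_bigr => a _; rewrite -big_split /=; apply: eq_bigr => b _.
by rewrite mcoeffD mulrDl scalerDl.
Qed.

Lemma hall_mulDr u v1 v2 : hall_mul u (v1 + v2) = hall_mul u v1 + hall_mul u v2.
Proof.
pose d := (msupp v1 `|` msupp v2)%fset.
rewrite (@hall_mulw (msupp u) d _ (v1 + v2)) ?msuppD_le //.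
rewrite (@hall_mulw (msupp u) d _ v1) ?fsubsetUl //.
rewrite (@hall_mulw (msupp u) d _ v2) ?fsubsetUr // -big_split /=.
apply: eq_bigr => a _; rewrite -big_split /=; apply: eq_bigr => b _.
by rewrite mcoeffD mulrDr scalerDl.
Qed.

Lemma hall_mulZl c u v : hall_mul (c *: u) v = c *: hall_mul u v.
Proof.
rewrite (@hall_mulw (msupp u) (msupp v) (c *: u)) ?msuppZ_le //.
rewrite /hall_mul scaler_sumr; apply: eq_bigr => a _.
rewrite scaler_sumr; apply: eq_bigr => b _.
by rewrite mcoeffZ scalerA mulrA.
Qed.

Lemma hall_mulZr c u v : hall_mul u (c *: v) = c *: hall_mul u v.
Proof.
rewrite (@hall_mulw (msupp u) (msupp v) u (c *: v)) ?msuppZ_le //.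
rewrite /hall_mul scaler_sumr; apply: eq_bigr => a _.
rewrite scaler_sumr; apply: eq_bigr => b _.
by rewrite mcoeffZ scalerA mulrCA.
Qed.

End HallAlgebra.

Section IHallAlgebra.
Variable F : finFieldType.
Local Notation hall := (hall F).

(* Classes in K_0(A) = Z are dimensions, and dim Im d is the rank of d. *)
Definition ihall_rel (M N : cplx F) : Prop :=
  rep_iso (homology M) (homology N) /\ \rank (diff M) = \rank (diff N).

(* hall_mul is not packaged as a ring structure here: a two-sided ideal is a
   subspace stable under multiplication by any element on either side, which is
   all that is needed for hall_mul to descend to the quotient (ihall_piM). *)
Definition two_sided_ideal (I : hall -> Prop) : Prop :=
  [/\ I 0, forall u v, I u -> I v -> I (u + v),
      forall c u, I u -> I (c *: u)
    & forall u v, I u -> I (hall_mul u v) /\ I (hall_mul v u)].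

Definition ihall_ideal (u : hall) : Prop :=
  forall I : hall -> Prop, two_sided_ideal I ->
    (forall M N, ihall_rel M N -> I (hcls M - hcls N)) -> I u.

Lemma ihall_idealP : two_sided_ideal ihall_ideal.
Proof.
split.
- by move=> I [].
- move=> u v hu hv I hI g; case: (hI) => _ + _ _; apply; [exact: hu|exact: hv].
- by move=> c u hu I hI g; case: (hI) => _ _ + _; apply; exact: hu.
move=> u v hu; split=> I hI g; case: (hI) => _ _ _ /(_ u v); case=> //;
  exact: hu.
Qed.

Definition ihall_ideal_pred : {pred hall} := fun u => `[< ihall_ideal u >].

Fact ihall_ideal_zmod_closed : zmod_closed ihall_ideal_pred.
Proof.
have [h0 hD hZ _] := ihall_idealP; split=> [|u v]; first exact/asboolP.
move=> /asboolP hu /asboolP hv; apply/asboolP; apply: (hD _ _ hu).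
by rewrite -scaleN1r; apply: hZ.
Qed.

HB.instance Definition _ :=
  GRing.isZmodClosed.Build hall ihall_ideal_pred ihall_ideal_zmod_closed.

Definition ihall := {ideal_quot ihall_ideal_pred}.
HB.instance Definition _ := GRing.Zmodule.on ihall.

Definition ihall_pi (u : hall) : ihall := \pi_ihall u.

Lemma ihall_piP u v : ihall_pi u = ihall_pi v <-> ihall_ideal (u - v).
Proof.
split=> [/eqP|h].
  by rewrite /ihall_pi -Quotient.idealrBE => /asboolP.
by apply/eqP; rewrite /ihall_pi -Quotient.idealrBE; apply/asboolP.
Qed.

Lemma ihall_piK (x : ihall) : ihall_pi (repr x) = x.
Proof. exact: reprK. Qed.

Lemma ihall_piD u v : ihall_pi (u + v) = ihall_pi u + ihall_pi v.
Proof. exact: Quotient.pi_add. Qed.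

Lemma repr_ihall_pi u : ihall_ideal (repr (ihall_pi u) - u).
Proof. by apply/ihall_piP; rewrite ihall_piK. Qed.

Definition ihall_scale (c : rat) (x : ihall) : ihall := ihall_pi (c *: repr x).

Lemma ihall_piZ c u : ihall_pi (c *: u) = ihall_scale c (ihall_pi u).
Proof.
have [_ _ hZ _] := ihall_idealP.
apply/esym/ihall_piP; rewrite -scalerBr; apply: hZ; exact: repr_ihall_pi.
Qed.

Fact ihall_scaleA a b x :
  ihall_scale a (ihall_scale b x) = ihall_scale (a * b) x.
Proof. by rewrite -(ihall_piK x) -!ihall_piZ scalerA. Qed.

Fact ihall_scale1 : left_id 1 ihall_scale.
Proof. by move=> x; rewrite -(ihall_piK x) -!ihall_piZ scale1r. Qed.

Fact ihall_scaleDr : right_distributive ihall_scale +%R.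
Proof.
move=> c x y; rewrite -(ihall_piK x) -(ihall_piK y).
by rewrite -!(ihall_piZ, ihall_piD) scalerDr.
Qed.

Fact ihall_scaleDl x : {morph ihall_scale^~ x : a b / a + b}.
Proof.
by move=> a b; rewrite -(ihall_piK x) -!(ihall_piZ, ihall_piD) scalerDl.
Qed.

HB.instance Definition _ := GRing.Zmodule_isLmodule.Build rat ihall
  ihall_scaleA ihall_scale1 ihall_scaleDr ihall_scaleDl.

Definition ihall_mul (x y : ihall) : ihall :=
  ihall_pi (hall_mul (repr x) (repr y)).

Definition ihall_one : ihall := ihall_pi (hall_one F).

Lemma ihall_piM u v :
  ihall_pi (hall_mul u v) = ihall_mul (ihall_pi u) (ihall_pi v).
Proof.
have [_ hD _ hM] := ihall_idealP.
apply/esym/ihall_piP; set u' := repr _; set v' := repr _.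
have -> : hall_mul u' v' - hall_mul u v =
    hall_mul (u' - u) v' + hall_mul u (v' - v).
  rewrite hall_mulDl -(scaleN1r u) hall_mulZl hall_mulDr.
  rewrite -(scaleN1r v) hall_mulZr !scaleN1r.
  by rewrite addrA subrK.
by apply: hD; [apply: (hM _ _ _).1|apply: (hM _ _ _).2]; apply: repr_ihall_pi.
Qed.

Definition ihall_cls (M : cplx F) : ihall := ihall_pi (hcls M).

(* The polynomial Q-algebra in the variables T_0, T_1, ..., with basis the
   monomials in the free commutative monoid on nat. *)
Definition polyQ := {malg rat[{cmonom nat}]}.
HB.instance Definition _ := GRing.ComNzRing.on polyQ.
HB.instance Definition _ := GRing.Lmodule.on polyQ.

Definition polyQ_var (i : nat) : polyQ := << ucm i >>.

(* The Q-algebra ihall is polynomial in the family g. *)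
Definition polynomial_on (g : nat -> ihall) : Prop :=
  exists f : {linear polyQ -> ihall},
    [/\ bijective f, f 1 = ihall_one,
        {morph f : p q / p * q >-> ihall_mul p q}
      & forall i, f (polyQ_var i) = g i].

(* In both families index 0 stands for [K_S] and index r >= 1 for the r-th
   remaining generator, [S^(1^r)] or [S^(r)] respectively. *)
Definition gens_col (i : nat) : ihall :=
  if i is 0 then ihall_cls (Kcplx (Sn F 1))
  else ihall_cls (stalk (Spart F (nseq i 1%N))).

Definition gens_row (i : nat) : ihall :=
  if i is 0 then ihall_cls (Kcplx (Sn F 1)) else ihall_cls (stalk (Sn F i)).

End IHallAlgebra.

(* Main.v *)
(* For M, N with dimensions m, n over a field with q elements, the Hall product
   [M][N] is the average q^(-mn) sum [L(a,b)] over the cocycles (a, b), that is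
   the blocks for which x = (x_N 0; a x_M), d = (d_N 0; b d_M) is a complex
   (hall_mulE).  From this description associativity is a rearrangement of
   triangular 3 x 3 block matrices.

   The homology of (x, d) and dim Im d are encoded by the ranks of the matrices
   (x^k d; d 0), which do not change under homotopies x + du + ud nor under
   transposition.  Every complex is homotopic to H(M) + K_S^r with r = rank d,
   and splitting off K_S^r shows that the class of [M][N] in the span of the
   profiles depends on M only through (H(M), r).  Transposition reverses
   products, so the product on profiles is also commutative, the relations
   generate exactly the kernel of the profile map, and the iHall algebra has the
   classes [S^(la)][K_S]^r as a basis.

   In this basis the monomials are triangular.  A product of the [S^(r)] and of
   [K_S] is a multiple of the direct sum plus terms with larger ranks.  In a
   product of the [S^(1^c)], taken with decreasing c, the leading term is the
   module whose Young diagram has columns c: in the other terms either rank d is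
   larger or the ranks of the powers of x are smaller. *)

From HB Require Import structures.
From mathcomp Require Import all_boot all_order all_algebra.
From mathcomp Require Import finmap boolp classical_sets functions.
From mathcomp Require Import cardinality fsbigop.
From mathcomp Require Import monalg.
From mathcomp Require Import zify.
Require Import Defs.
Set Implicit Arguments.
Unset Strict Implicit.
Unset Printing Implicit Defensive.
Import GRing.Theory.
Local Open Scope ring_scope.

(** * Profiles of complexes *)

Section Profile.
Variable F : fieldType.

(** The quotient is defined by generators of an ideal, so the difficulty is to bound this ideal from
    above: linear maps out of the Hall algebra must be shown to kill it. The maps used are [ev phi],
    for an arbitrary function [phi] of profiles with values in an arbitrary rational vector space.
    Values in [rat] give the coordinate functionals, values in the quotient itself give the
    projection ([ihall_pi_ev]). Identities between Hall numbers thereby become maps between sets of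
    cocycles with controlled profiles, and no homology of a middle term is ever computed.

    A homotopy [u] is an arbitrary matrix: it need not commute with [x], so the module structure
    itself is deformed. This freedom is essential, since a complex is in general not isomorphic to
    its homology plus copies of K_S: on k[x]/(x^2) with d = x the homology vanishes, yet [x] is not
    zero as it is on K_S. *)

Definition cx n (x d : 'M[F]_n) : bool := (x *m d == d *m x) && (d *m d == 0).

(* For a complex (x, d) this is 2 rank d + rank (x^k on homology)
   (rho_homology): the whole sequence determines the dimension of Im d and,
   by the Jordan normal form, the isoclass of the homology. *)
Definition rho n (x d : 'M[F]_n) (k : nat) : nat :=
  \rank (block_mx (x ^+ k) d d 0).

Lemma mulmx_expr m n (x : 'M[F]_m) (y : 'M_n) (g : 'M_(m, n)) k :
  x *m g = g *m y -> x ^+ k *m g = g *m y ^+ k.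
Proof.
move=> xg; elim: k => [|k IHk]; first by rewrite !expr0 mul1mx mulmx1.
by rewrite !exprS -!mulmxE -mulmxA IHk !mulmxA xg.
Qed.

Lemma trmx_expr n (x : 'M[F]_n) k : (x ^+ k)^T = x^T ^+ k.
Proof.
elim: k => [|k IHk]; first by rewrite !expr0 trmx1.
by rewrite exprSr exprS -!mulmxE trmx_mul IHk.
Qed.

Lemma rank_conj m n (A : 'M[F]_m) (B : 'M_n) (g : 'M_(m, n)) :
  row_free g -> row_full g -> A *m g = g *m B -> \rank A = \rank B.
Proof.
move=> fr fu e; rewrite -(mxrankMfree A fr) e.
by rewrite (eqmxMfull _ fu).
Qed.

Lemma rho_conj m n (x d : 'M[F]_m) (y c : 'M_n) (g : 'M_(m, n)) :
  row_free g -> row_full g -> x *m g = g *m y -> d *m g = g *m c ->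
  rho x d =1 rho y c.
Proof.
move=> fr fu xg dg k; apply: (@rank_conj _ _ _ _ (block_mx g 0 0 g)).
- by rewrite /row_free rank_diag_block_mx !(eqP fr).
- by rewrite /row_full rank_diag_block_mx !(eqP fu).
by rewrite !mulmx_block !(mulmx0, mul0mx, addr0, add0r) (mulmx_expr k xg) dg.
Qed.

Lemma rho_tr n (x d : 'M[F]_n) : rho x^T d^T =1 rho x d.
Proof.
by move=> k; rewrite /rho -mxrank_tr tr_block_mx trmx0 trmxK -trmx_expr trmxK.
Qed.

Definition htpy n (d u : 'M[F]_n) : 'M_n := d *m u + u *m d.

Lemma htpyD n (d u v : 'M[F]_n) : htpy d (u + v) = htpy d u + htpy d v.
Proof. by rewrite /htpy mulmxDr mulmxDl addrACA. Qed.

Lemma htpyN n (d u : 'M[F]_n) : htpy d (- u) = - htpy d u.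
Proof. by rewrite /htpy mulmxN mulNmx opprD. Qed.

Lemma mul_htpyl n (d u y : 'M[F]_n) :
  y *m d = d *m y -> y *m htpy d u = htpy d (y *m u).
Proof. by move=> yd; rewrite /htpy mulmxDr !mulmxA yd. Qed.

Lemma mul_htpyr n (d u y : 'M[F]_n) :
  y *m d = d *m y -> htpy d u *m y = htpy d (u *m y).
Proof. by move=> yd; rewrite /htpy mulmxDl -!mulmxA yd. Qed.

Lemma htpy_comm n (d u : 'M[F]_n) :
  d *m d = 0 -> htpy d u *m d = d *m htpy d u.
Proof.
move=> dd; rewrite /htpy mulmxDr mulmxDl -[u *m d *m d]mulmxA dd mulmx0 addr0.
by rewrite (mulmxA d d) dd mul0mx add0r mulmxA.
Qed.

Lemma cx_htpy n (x d u : 'M[F]_n) : cx x d -> cx (x + htpy d u) d.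
Proof.
case/andP=> /eqP xd /eqP dd.
by rewrite /cx dd eqxx andbT mulmxDl mulmxDr xd htpy_comm.
Qed.

(** The matrices commuting with [d] form a ring in which the homotopies are a two-sided ideal, so
    congruence modulo homotopies passes to powers. *)
Lemma htpy_expr n (x d u : 'M[F]_n) k : cx x d ->
  exists v, (x + htpy d u) ^+ k = x ^+ k + htpy d v.
Proof.
move=> cxd; have /andP[/eqP yd _] := cx_htpy u cxd.
case/andP: cxd => /eqP xd /eqP dd; set y : 'M_n := x + _ in yd *.
have ykd l : y ^+ l *m d = d *m y ^+ l by apply: mulmx_expr.
elim: k => [|k [v IHk]]; first by exists 0; rewrite /htpy mulmx0 mul0mx !addr0.
exists (v *m x + y ^+ k *m u).
rewrite exprSr {2}/y mulrDr {1}IHk mulrDl -exprSr -!mulmxE mul_htpyr //.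
by rewrite (mul_htpyl _ (ykd k)) htpyD -addrA.
Qed.

(** Adding [d *m u] to the corner is a column operation and adding [u *m d] a row operation. *)
Lemma rank_htpy n (x d u : 'M[F]_n) :
  \rank (block_mx (x + htpy d u) d d 0) = \rank (block_mx x d d 0).
Proof.
have fr : block_mx 1%:M 0 u 1%:M \in unitmx.
  by rewrite unitmxE det_lblock !det1 mulr1 unitr1.
have fu : block_mx 1%:M u 0 1%:M \in unitmx.
  by rewrite unitmxE det_ublock !det1 mulr1 unitr1.
rewrite -(mxrankMfree (block_mx x d d 0) (B := block_mx 1%:M 0 u 1%:M));
  last by rewrite row_free_unit.
rewrite -[RHS](eqmxMfull _ (A := block_mx 1%:M u 0 1%:M));
  last by rewrite row_full_unit.
rewrite !mulmx_block !(mulmx0, mul0mx, mulmx1, mul1mx, addr0, add0r).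
by rewrite /htpy addrA.
Qed.

Lemma rho_htpy n (x d u : 'M[F]_n) : cx x d -> rho (x + htpy d u) d =1 rho x d.
Proof.
by move=> cxd k; rewrite /rho; have [v ->] := htpy_expr u k cxd; apply: rank_htpy.
Qed.

(** Compressing each diagonal block to an identity matrix of its rank leaves a unitriangular matrix,
    whatever the corner [C] is. *)
Lemma rank_lblock_ge m n p q (A : 'M[F]_(m, n)) (B : 'M_(p, q)) C :
  (\rank A + \rank B <= \rank (block_mx A 0 C B))%N.
Proof.
pose L := block_mx (pinvmx (col_base A)) 0 0 (pinvmx (col_base B)).
pose R := block_mx (pinvmx (row_base A)) 0 0 (pinvmx (row_base B)).
have core k l (E : 'M[F]_(k, l)) :
    pinvmx (col_base E) *m E *m pinvmx (row_base E) = 1%:M.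
  rewrite (_ : _ *m E = row_base E) ?mulmxVp ?row_base_free //.
  by rewrite -[X in _ *m X](mulmx_base E) mulmxA mulVpmx ?col_base_full ?mul1mx.
have e : L *m block_mx A 0 C B *m R = block_mx 1%:M 0
    (pinvmx (col_base B) *m C *m pinvmx (row_base A)) 1%:M.
  by rewrite !mulmx_block !(mulmx0, mul0mx, addr0, add0r) !core.
have : \rank (L *m block_mx A 0 C B *m R) = (\rank A + \rank B)%N.
  rewrite e; apply/eqP; rewrite -[_ == _]/(row_free _) row_free_unit unitmxE.
  by rewrite det_lblock !det1 mulr1 unitr1.
move=> <-; apply: leq_trans (mxrankM_maxl _ _) (mxrankM_maxr _ _).
Qed.

(** A permutation matrix: it regroups coordinates of sizes m, n, m, n as m, m, n, n, which makes the
    matrix defining [rho] of an extension block triangular. *)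
Definition swap_mid m n : 'M[F]_(m + m + (n + n), (m + n) + (m + n)) :=
  col_mx (block_mx (row_mx 1%:M 0) 0 0 (row_mx 1%:M 0))
         (block_mx (row_mx 0 1%:M) 0 0 (row_mx 0 1%:M)).

Lemma swap_midK m n : swap_mid m n *m (swap_mid m n)^T = 1%:M.
Proof.
rewrite /swap_mid tr_col_mx !tr_block_mx !tr_row_mx !trmx0 !trmx1.
rewrite mul_col_row !mulmx_block !mul_row_col.
rewrite !(mulmx0, mul0mx, mulmx1, addr0, add0r).
by rewrite !block_mx0 (scalar_mx_block (m + m)) !(@scalar_mx_block _ _ _ 1).
Qed.

Lemma swap_mid_block m n (a b : 'M[F]_m) c e (a' b' : 'M_n) :
  swap_mid m n *m block_mx (block_mx a 0 c a') (block_mx b 0 e b')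
                           (block_mx b 0 e b') 0 =
  block_mx (block_mx a b b 0) 0 (block_mx c e e 0) (block_mx a' b' b' 0)
    *m swap_mid m n.
Proof.
rewrite /swap_mid mul_col_mx !mulmx_block !mul_row_block mul_block_col.
rewrite !mulmx_block !mul_mx_row add_block_mx.
rewrite !(mulmx0, mul0mx, mulmx1, mul1mx, addr0, add0r, add_row_mx, row_mx0).
by [].
Qed.

Lemma rank_swap_mid m n (a b : 'M[F]_m) c e (a' b' : 'M_n) :
  \rank (block_mx (block_mx a 0 c a') (block_mx b 0 e b')
                  (block_mx b 0 e b') 0) =
  \rank (block_mx (block_mx a b b 0) 0 (block_mx c e e 0) (block_mx a' b' b' 0)).
Proof.
have fr : row_free (swap_mid m n).
  by apply/row_freeP; exists (swap_mid m n)^T; apply: swap_midK.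
have fu : row_full (swap_mid m n).
  by rewrite /row_full (eqP fr); apply/eqP; lia.
by apply/esym/(rank_conj fr fu); rewrite swap_mid_block.
Qed.

Lemma lblock_expr m n (a : 'M[F]_m) c (b : 'M_n) k :
  exists2 e, block_mx a 0 c b ^+ k = block_mx (a ^+ k) 0 e (b ^+ k)
           & c = 0 -> e = 0.
Proof.
elim: k => [|k [e IHk e0]]; first by exists 0; rewrite ?expr0 -?scalar_mx_block.
exists (c *m a ^+ k + b *m e).
  rewrite !exprS IHk -!mulmxE mulmx_block.
  by rewrite !(mulmx0, mul0mx, addr0, add0r).
by move=> c0; rewrite e0 // c0 mulmx0 mul0mx addr0.
Qed.

Lemma rho_ext_ge m n (x d : 'M[F]_m) a b (y c : 'M_n) k :
  (rho x d k + rho y c k <= rho (block_mx x 0 a y) (block_mx d 0 b c) k)%N.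
Proof.
rewrite /rho; have [e ->] := lblock_expr x a y k.
by rewrite rank_swap_mid rank_lblock_ge.
Qed.

Lemma rho_dsum m n (x d : 'M[F]_m) (y c : 'M_n) k :
  rho (block_mx x 0 0 y) (block_mx d 0 0 c) k = (rho x d k + rho y c k)%N.
Proof.
rewrite /rho; have [e -> ->//] := lblock_expr x 0 y k.
by rewrite rank_swap_mid block_mx0 rank_diag_block_mx.
Qed.

(** Subtracting [d] times the first block row from the second leaves [- (d *m d) = 0] in the last
    corner. Thus index 0 of a profile records the dimension. *)
Lemma rho0 n (x d : 'M[F]_n) : d *m d = 0 -> rho x d 0 = n.
Proof.
move=> dd; rewrite /rho expr0.
have fr : block_mx 1%:M 0 (- d) 1%:M \in unitmx.
  by rewrite unitmxE det_lblock !det1 mulr1 unitr1.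
rewrite -(eqmxMfull _ (A := block_mx 1%:M 0 (- d) 1%:M)) ?row_full_unit //.
rewrite mulmx_block !(mulmx0, mul0mx, mulmx1, mul1mx, addr0, add0r) mulNmx dd.
rewrite addNr oppr0 block_mxEv row_mx0 rank_col_mx0.
apply/eqP/row_freeP; exists (col_mx 1%:M 0).
by rewrite mul_row_col mulmx1 mulmx0 addr0.
Qed.

End Profile.

(** * Homology and the normal form *)

Section NormalForm.
Variable F : fieldType.

Definition Jmx r : 'M[F]_(r + r) := block_mx 0 0 1%:M 0.

Lemma Jmx_sq0 r : Jmx r *m Jmx r = 0.
Proof.
by rewrite /Jmx mulmx_block !(mulmx0, mul0mx, addr0, add0r) block_mx0.
Qed.

Lemma htpy_Jmx r : htpy (Jmx r) (Jmx r)^T = 1%:M.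
Proof.
rewrite /htpy /Jmx tr_block_mx !trmx0 trmx1 !mulmx_block add_block_mx.
by rewrite !(mulmx0, mul0mx, mulmx1, addr0, add0r) -scalar_mx_block.
Qed.

(** By [htpy_Jmx] the identity is homotopic to 0, so the positive powers of 0 give the same rank as
    the power 0. *)
Lemma rho_Jmx r k : rho 0 (Jmx r) k = (r + r)%N.
Proof.
apply: etrans (rho0 0 (Jmx_sq0 r)); rewrite /rho expr0.
case: k => [|k]; first by rewrite expr0.
by rewrite exprS mul0r -(rank_htpy 0 (Jmx r) (Jmx r)^T) htpy_Jmx add0r.
Qed.

Lemma rho_stalk n (x : 'M[F]_n) k : rho x 0 k = \rank (x ^+ k).
Proof. by rewrite /rho rank_diag_block_mx mxrank0 addn0. Qed.

(** Homotopy transfer: [p *m i] is homotopic to the identity, hence [x] is homotopic to its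
    compression [i *m x *m p] extended by zero on a contractible complement. *)
Lemma htpy_split n (x d : 'M[F]_n) h (i : 'M_(h, n)) (p : 'M_(n, h)) (r : nat) :
  cx x d -> i *m p = 1%:M -> i *m d = 0 -> d *m p = 0 -> \rank d = r ->
  n = (h + (r + r))%N ->
  exists2 g : 'M_(h + (r + r), n), row_free g && row_full g & exists u,
    block_mx 0 0 0 (Jmx r) *m g = g *m d /\
    block_mx (i *m x *m p) 0 0 0 *m g = g *m (x + htpy d u).
Proof.
move=> /andP[/eqP xd /eqP dd] ip id dp rd nE.
have [C [R [dE [C' CC] [s Rs]]]] : exists (C : 'M_(n, r)) (R : 'M_(r, n)),
    [/\ C *m R = d, exists C', C' *m C = 1%:M & exists s, R *m s = 1%:M].
  case: _ / rd; exists (col_base d), (row_base d); split.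
  - exact: mulmx_base.
  - exact/row_fullP/col_base_full.
  exact/row_freeP/row_base_free.
have Cl (m : nat) (A : 'M_(_, m)) : C *m A = 0 -> A = 0.
  by move=> CA; rewrite -[A]mul1mx -CC -mulmxA CA mulmx0.
have Rr (m : nat) (A : 'M_(m, _)) : A *m R = 0 -> A = 0.
  by move=> AR; rewrite -[A]mulmx1 -Rs mulmxA AR mul0mx.
have RC : R *m C = 0 by apply: Cl; apply: Rr; rewrite mulmxA dE -mulmxA dE.
have Rp : R *m p = 0 by apply: Cl; rewrite mulmxA dE.
have iC : i *m C = 0 by apply: Rr; rewrite -mulmxA dE.
(* [v] and [q] are one-sided inverses of [C] and [R], corrected so that [v *m p], [i *m q] and
   [v *m q] vanish. The rows of [g] (homology, a basis of the image, preimages of that basis under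
   [d]) and the columns of [g'] are then dual bases. *)
pose v : 'M_(r, n) := C' - C' *m p *m i.
have vC : v *m C = 1%:M.
  by rewrite mulmxBl -!mulmxA iC !mulmx0 subr0 CC.
have vp : v *m p = 0 by rewrite mulmxBl -!mulmxA ip mulmx1 subrr.
have vd : v *m d = R by rewrite -dE mulmxA vC mul1mx.
pose q : 'M_(n, r) := s - p *m (i *m s) - C *m (v *m s).
have iq : i *m q = 0.
  by rewrite !mulmxBr !(mulmxA i) ip iC mul1mx mul0mx subr0 subrr.
have Rq : R *m q = 1%:M by rewrite !mulmxBr !(mulmxA R) Rp RC !mul0mx !subr0.
have vq : v *m q = 0.
  by rewrite !mulmxBr !(mulmxA v) vp vC mul1mx mul0mx subr0 subrr.
pose g := col_mx i (col_mx R v); pose g' := row_mx p (row_mx q C).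
have gg' : g *m g' = 1%:M.
  rewrite /g /g' mul_col_row mul_mx_row mul_col_mx mul_col_row.
  rewrite ip iq iC Rp Rq RC vp vq vC row_mx0 col_mx0.
  by rewrite -(@scalar_mx_block _ r r 1) -scalar_mx_block.
have fr : row_free g by apply/row_freeP; exists g'.
have fu : row_full g by rewrite /row_full (eqP fr) -nE.
have g'g : g' *m g = 1%:M.
  by rewrite -[LHS]mul1mx -(mulVpmx fu) -!mulmxA (mulmxA g g') gg' mul1mx.
exists g; first by rewrite fr.
have gd : block_mx 0 0 0 (Jmx r) *m g = g *m d.
  rewrite /g mul_block_col !mul0mx !add0r mul_block_col !mul_col_mx id vd.
  by rewrite -dE mulmxA RC !mul0mx add0r mul1mx addr0.
pose pi := p *m i.
have gpi (Y : 'M_h) : block_mx Y 0 0 0 *m g = g *m (p *m Y *m i).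
  rewrite /g mul_block_col !mul0mx !addr0 !mul_col_mx !mulmxA.
  by rewrite ip Rp vp !mul0mx mul1mx col_mx0.
have ginj (A B : 'M_n) : g *m A = g *m B -> A = B.
  by move=> e; rewrite -[A]mul1mx -g'g -mulmxA e mulmxA g'g mul1mx.
(* The contracting homotopy of [Jmx r], written in the basis [g]; it exhibits the projection
   [1 - pi] onto the contractible part as a homotopy. *)
pose w := g' *m block_mx 0 0 0 (Jmx r)^T *m g.
have gw : g *m w = block_mx 0 0 0 (Jmx r)^T *m g.
  by rewrite /w !mulmxA gg' mul1mx.
have wE : 1%:M - pi = htpy d w.
  apply: ginj; rewrite mulmxBr mulmx1 -[pi]/(p *m i) -[p]mulmx1 -gpi.
  have -> : g *m htpy d w =
      htpy (block_mx 0 0 0 (Jmx r)) (block_mx 0 0 0 (Jmx r)^T) *m g.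
    rewrite /htpy mulmxDr (mulmxA g d) -gd -mulmxA gw (mulmxA g w) gw.
    by rewrite -(mulmxA _ g d) -gd !mulmxA -mulmxDl.
  rewrite /htpy !mulmx_block !(mulmx0, mul0mx, addr0, add0r) add_block_mx.
  rewrite -[Jmx _ *m _ + _]/(htpy _ _) htpy_Jmx !addr0.
  rewrite -{1}[g]mul1mx -mulmxBl (scalar_mx_block h) opp_block_mx add_block_mx.
  by rewrite subrr !oppr0 !addr0.
have pid : pi *m d = 0 by rewrite -mulmxA id mulmx0.
have dpi : d *m pi = 0 by rewrite mulmxA dp mul0mx.
(* Multiplying [1 - pi = htpy d w] by [x] on the right replaces [x] by [pi *m x]; multiplying it by
   [pi *m x] on the left replaces that by [pi *m x *m pi]. The witness collects both homotopies. *)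
exists (- (w *m x + pi *m x *m w)); split=> //.
rewrite gpi; congr (_ *m _).
have e1 : x = htpy d (w *m x) + pi *m x.
  by rewrite -mul_htpyr // -wE mulmxBl mul1mx subrK.
have e2 : pi *m x = htpy d (pi *m x *m w) + pi *m x *m pi.
  rewrite -mul_htpyl; last by rewrite -mulmxA xd (mulmxA pi d) pid (mulmxA d pi) dpi !mul0mx.
  by rewrite -wE mulmxBr mulmx1 subrK.
have -> : p *m (i *m x *m p) *m i = pi *m x *m pi by rewrite /pi !mulmxA.
apply/eqP; rewrite htpyN htpyD eq_sym subr_eq; apply/eqP.
by rewrite [LHS]e1 [X in _ + X = _]e2 addrA addrC.
Qed.

End NormalForm.

Section HomologyProfile.
Variable F : finFieldType.
Implicit Types M N : cplx F.

Lemma cplx_cx M : cx (xact M) (diff M).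
Proof. by rewrite /cx diff_sq0 eqxx andbT; apply: diff_hom. Qed.

Lemma rank_homology M :
  rdim M = (rdim (homology M) + (\rank (diff M) + \rank (diff M)))%N.
Proof.
have h1 := rank_leq_col (im_in_ker M); have h2 := rank_leq_row (diff M).
have h3 : \rank (im_in_ker M) = \rank (diff M).
  by rewrite -(mxrankMfree _ (ker_incl_free M)) im_in_kerE.
have h4 := mxrank_ker (diff M); rewrite /= mxrank_coker h3.
by move: h1 h2; rewrite h3 h4; lia.
Qed.

Lemma homology_split M (r := \rank (diff M)) :
  exists2 g : 'M_(rdim (homology M) + (r + r), rdim M),
    row_free g && row_full g & exists u,
    block_mx 0 0 0 (Jmx F r) *m g = g *m diff M /\
    block_mx (xact (homology M)) 0 0 0 *m g = g *m (xact M + htpy (diff M) u).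
Proof.
pose i := pinvmx (hom_proj M) *m ker_incl M.
pose p := pinvmx (ker_incl M) *m hom_proj M.
have sP : pinvmx (hom_proj M) *m hom_proj M = 1%:M := mulVpmx (hom_proj_full M).
have Ip : ker_incl M *m p = hom_proj M.
  by rewrite mulmxA mulmxVp ?ker_incl_free // mul1mx.
have Id : ker_incl M *m diff M = 0 by apply/eqP; rewrite -sub_ker_incl.
have dp : diff M *m p = 0.
  by rewrite mulmxA; apply/eqP; rewrite -hom_proj_ker.
have ip : i *m p = 1%:M by rewrite -mulmxA Ip.
have id : i *m diff M = 0 by rewrite -mulmxA Id mulmx0.
have -> : xact (homology M) = i *m xact M *m p.
  rewrite /i -(mulmxA (pinvmx _) _ (xact M)) -ker_xE -(mulmxA _ _ p).
  by rewrite -(mulmxA (ker_x M)) Ip mulmxA.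
exact: (htpy_split (cplx_cx M) ip id dp erefl (rank_homology M)).
Qed.

Lemma rho_homology M k :
  rho (xact M) (diff M) k =
    (\rank (xact (homology M) ^+ k) + (\rank (diff M) + \rank (diff M)))%N.
Proof.
have [g /andP[fr fu] [u [gd gx]]] := homology_split M.
rewrite -(rho_htpy u (cplx_cx M)) -(rho_conj fr fu gx gd) rho_dsum.
by rewrite rho_Jmx rho_stalk.
Qed.

End HomologyProfile.

(** * Jordan normal form *)

Section Jordan.
Variable F : finFieldType.
Implicit Types A B : nilrep F.

(** [k] is the nilpotency order of [x]. A cyclic submodule of this maximal dimension admits an
    [x]-equivariant retraction, whose kernel is a stable complement. *)
Lemma jordan_split n (x : 'M[F]_n) : (0 < n)%N -> (exists k, x ^+ k = 0) ->
  exists k n' (x' : 'M_n') (g : 'M_(k + n', n)),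
    [/\ (0 < k)%N, x ^+ k = 0, row_free g && row_full g
      & block_mx (jordan_mx F k) 0 0 x' *m g = g *m x].
Proof.
move=> n_gt0 nilx.
have [k0 /eqP xk0 mink] : exists2 k, x ^+ k == 0 &
    forall l, x ^+ l == 0 -> (k <= l)%N.
  have ex : exists k, x ^+ k == 0 by case: nilx => k /eqP; exists k.
  by case: (ex_minnP ex) => k hk mk; exists k.
case: k0 => [|k] in xk0 mink.
  have /matrixP/(_ (Ordinal n_gt0) (Ordinal n_gt0))/eqP := xk0.
  by rewrite expr0 !mxE eqxx oner_eq0.
have x0 l : (k < l)%N -> x ^+ l = 0.
  by move=> /subnK<-; rewrite exprD xk0 mulr0.
have [i [j cN0]] : exists i j, (x ^+ k) i j != 0.
  by apply/matrix0Pn/negP=> /mink; rewrite ltnn.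
(* The rows of [I] are the orbit of a row vector, the columns of [Q] the reversed orbit of a column
   vector, chosen with [(x ^+ k) i j] nonzero. The product [T] is triangular with this entry along
   its diagonal, so [Q *m invmx T] is the retraction. *)
pose I : 'M[F]_(k.+1, n) := \matrix_(a, b) (x ^+ a) i b.
pose Q : 'M[F]_(n, k.+1) := \matrix_(b, a) (x ^+ (k - a)) b j.
have JI : jordan_mx F k.+1 *m I = I *m x.
  apply/matrixP=> a b; have -> : (I *m x) a b = (x ^+ a.+1) i b.
    by rewrite exprSr !mxE; apply: eq_bigr => l _; rewrite mxE.
  rewrite mxE; case: (ltnP a.+1 k.+1) => [lt|ge].
    rewrite (bigD1 (Ordinal lt)) //= !mxE eqxx mul1r big1 ?addr0 // => l nl.
    rewrite !mxE; case: eqP => [e|_]; last by rewrite mul0r.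
    by case/eqP: nl; apply: val_inj.
  rewrite x0 // mxE big1 // => l _; rewrite !mxE.
  by rewrite (ltn_eqF (leq_trans (ltn_ord l) ge)) mul0r.
have xQ : x *m Q = Q *m jordan_mx F k.+1.
  apply/matrixP=> b a; have -> : (x *m Q) b a = (x ^+ (k - a).+1) b j.
    by rewrite exprS !mxE; apply: eq_bigr => l _; rewrite mxE.
  rewrite mxE; case: a => [[|a] lta] /=.
    rewrite subn0 xk0 mxE big1 // => l _; rewrite !mxE /=.
    by rewrite mulr0.
  have lta' := ltnW lta.
  rewrite (bigD1 (Ordinal lta')) //= !mxE /= eqxx mulr1 big1 ?addr0 => [|l nl].
    by rewrite -subSn ?subSS.
  rewrite !mxE /=; case: eqP => [[e]|_]; last by rewrite mulr0.
  by case/eqP: nl; apply: val_inj.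
pose T := I *m Q.
have TE a a' : T a a' = (x ^+ (a + (k - a'))) i j.
  by rewrite exprD !mxE; apply: eq_bigr => l _; rewrite !mxE.
have Tu : T \in unitmx.
  rewrite unitmxE -det_tr det_trig; last first.
    apply/is_trig_mxP=> a a' lt; rewrite mxE TE x0 ?mxE //.
    by have := ltn_ord a'; lia.
  rewrite unitfE prodf_seq_neq0; apply/allP=> a _ /=.
  by rewrite mxE TE subnKC // -ltnS.
have JT : jordan_mx F k.+1 *m T = T *m jordan_mx F k.+1.
  by rewrite /T mulmxA JI -mulmxA xQ mulmxA.
have T'J : invmx T *m jordan_mx F k.+1 = jordan_mx F k.+1 *m invmx T.
  by apply: (canRL (mulmxK Tu)); rewrite -mulmxA JT mulmxA mulVmx ?mul1mx.
pose p := Q *m invmx T.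
have Ip : I *m p = 1%:M by rewrite mulmxA mulmxV.
have xp : x *m p = p *m jordan_mx F k.+1.
  by rewrite mulmxA xQ -!mulmxA T'J.
pose B := row_base (kermx p).
have Bp : B *m p = 0 by apply/sub_kermxP; rewrite eq_row_base.
have [x' Bx] : exists x', B *m x = x' *m B.
  by apply/submxP; rewrite eq_row_base; apply/sub_kermxP; rewrite -mulmxA xp mulmxA Bp mul0mx.
have Bf : row_free B := row_base_free _.
have rp : \rank p = k.+1.
  apply/eqP; rewrite eqn_leq rank_leq_col /=.
  by have := mxrankM_maxr I p; rewrite Ip mxrank1.
clearbody B p.
have gf : row_free (col_mx I B).
  apply: inj_row_free => v; rewrite -[v]hsubmxK mul_row_col => e.
  have u0 : lsubmx v = 0.
    have := congr1 (mulmx^~ p) e; rewrite /= mulmxDl -!mulmxA Ip Bp mulmx0.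
    by rewrite mulmx1 addr0 mul0mx.
  move: e; rewrite u0 mul0mx add0r => e.
  by rewrite (row_free_inj Bf (etrans e (esym (mul0mx _ B)))) row_mx0.
exists k.+1, _, x', (col_mx I B); split=> //.
  rewrite gf /row_full (eqP gf) mxrank_ker rp.
  by rewrite subnKC ?eqxx // -[k.+1]rp rank_leq_row.
by rewrite mul_block_col !mul0mx addr0 add0r mul_col_mx JI Bx.
Qed.

Lemma rank_jordan n k : \rank (jordan_mx F n ^+ k) = (n - k)%N.
Proof.
set X := jordan_mx F n ^+ k; have r1 := leq_subr k n.
apply/eqP; rewrite eqn_leq; apply/andP; split.
  have -> : X = pid_mx (n - k) *m X.
    apply/matrixP=> i j; rewrite mxE (bigD1 i) //= big1 => [|l nl].
      rewrite addr0 mxE eqxx /=; case: ltnP => h; first by rewrite mul1r.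
      rewrite mul0r jordan_mx_exp; case: eqP => // e.
      by have := ltn_ord j; rewrite e; lia.
    rewrite mxE; case: eqP => [e|_]; last by rewrite mul0r.
    by case/eqP: nl; apply: val_inj.
  by apply: leq_trans (mxrankM_maxl _ _) _; rewrite rank_pid_mx.
have <- : \rank (X *m X^T) = (n - k)%N; last exact: mxrankM_maxl.
rewrite -[RHS](@rank_pid_mx F n n) //; congr (\rank _).
apply/matrixP=> i j; rewrite !mxE.
under eq_bigr => l _ do rewrite !mxE !jordan_mx_exp.
case: (ltnP i (n - k)) => h; last first.
  rewrite andbF big1 // => l _; case: eqP => [e|]; last by rewrite mul0r.
  by have := ltn_ord l; rewrite e; lia.
have lt : (i + k < n)%N by lia.
rewrite (bigD1 (Ordinal lt)) //= eqxx mul1r eqn_add2r andbT.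
rewrite big1 ?addr0 // => l nl; case: eqP => [e|]; last by rewrite mul0r.
by case/eqP: nl; apply: val_inj.
Qed.

Lemma rank_Spart la k :
  \rank (xact (Spart F la) ^+ k) = (\sum_(i <- la) (i - k))%N.
Proof.
elim: la => [|i la IHla] /=.
  by rewrite big_nil; apply/eqP; rewrite -leqn0 rank_leq_row.
by rewrite expr_block_diag rank_diag_block_mx IHla rank_jordan big_cons.
Qed.

Lemma rep_iso_stalk A B : rep_iso A B = cplx_iso (stalk A) (stalk B).
Proof.
apply/existsP/existsP=> -[f h]; exists f; move: h; rewrite /is_iso /is_hom /=.
  by rewrite mul0mx mulmx0 eqxx andbT.
by rewrite mul0mx mulmx0 eqxx andbT.
Qed.

Lemma rep_isoP A B :
  reflect (icls (stalk A) = icls (stalk B)) (rep_iso A B).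
Proof. by rewrite rep_iso_stalk; apply: iclsP. Qed.

Lemma rep_iso_rank A B k :
  rep_iso A B -> \rank (xact A ^+ k) = \rank (xact B ^+ k).
Proof.
case/existsP=> f /and3P[/eqP hf fr fu]; apply: (rank_conj fr fu).
exact: mulmx_expr.
Qed.

Lemma rep_iso_dsumr A B C : rep_iso B C -> rep_iso (dsum A B) (dsum A C).
Proof.
case/existsP=> f /and3P[/eqP hf fr fu]; apply/existsP; exists (block_mx 1%:M 0 0 f).
rewrite /is_rhom /= !mulmx_block !(mulmx0, mul0mx, mulmx1, mul1mx, addr0, add0r).
rewrite hf eqxx /row_free /row_full rank_diag_block_mx mxrank1.
by rewrite (eqP fr) -{3}(eqP fr) (eqP fu) !eqxx.
Qed.

Lemma jordan_form A :
  exists la, [/\ sorted geq la, 0 \notin la & rep_iso A (Spart F la)].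
Proof.
have [m] := ubnP (rdim A); elim: m A => // m IHm A ltA.
case: (posnP (rdim A)) => [A0|A0].
  exists [::]; split=> //; case: A A0 ltA => n x nx /= n0 _; subst n.
  apply/existsP; exists 0; rewrite /is_rhom mulmx0 mul0mx eqxx.
  by rewrite /row_free /row_full mxrank0.
have [k [n' [x' [g [k0 xk /andP[fr fu] gx]]]]] := jordan_split A0 (xact_nil A).
have e : rdim A = (k + n')%N by rewrite -(eqP fu) (eqP fr).
have xk' : x' ^+ k = 0.
  have := mulmx_expr k gx; rewrite xk mulmx0 expr_block_diag.
  move/(canRL (mulmxKp fr)); rewrite mul0mx.
  by rewrite -(block_mx0 F k n' k n') => /eq_block_mx[].
have nx' : exists l, x' ^+ l = 0 by exists k.
have [|la [sla zla isola]] := IHm (NilRep nx'); first by rewrite /=; lia.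
exists (k :: la); split; last 2 first.
- by rewrite inE negb_or zla andbT eq_sym -lt0n.
- apply/rep_isoP; transitivity (icls (stalk (dsum (Sn F k) (NilRep nx')))).
    apply/esym/rep_isoP/existsP; exists g; rewrite /is_rhom /= gx eqxx.
    by rewrite fr fu.
  exact/rep_isoP/rep_iso_dsumr.
(* The complement is still killed by the [k]-th power, so none of its parts exceeds [k], and putting
   [k] in front keeps the list decreasing. *)
rewrite /= path_min_sorted //; apply/allP=> i ila /=.
have := rep_iso_rank k isola; rewrite /= xk' mxrank0 rank_Spart => /esym/eqP.
by rewrite sum_nat_seq_eq0 => /allP/(_ i ila); rewrite /= subn_eq0.
Qed.

(** The second difference in [k] of the truncated [i - k] is the indicator of [i = k.+1]: the ranks
    of the powers determine the multiplicity of each positive part. *)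
Lemma sum_sub_count (s : seq nat) k :
  (\sum_(i <- s) (i - k) + \sum_(i <- s) (i - k.+2) =
     \sum_(i <- s) (i - k.+1) + \sum_(i <- s) (i - k.+1) + count_mem k.+1 s)%N.
Proof.
elim: s => [|i s IHs]; rewrite ?big_nil // !big_cons /=.
move: IHs; move: (\sum_(j <- s) (j - k))%N (\sum_(j <- s) (j - k.+2))%N.
by move: (\sum_(j <- s) (j - k.+1))%N (count_mem k.+1 s) => a b c e; lia.
Qed.

Lemma sorted_geq_count (s t : seq nat) : sorted geq s -> sorted geq t ->
  (forall k, count_mem k s = count_mem k t) -> s = t.
Proof.
move=> ss st e; apply: (sorted_eq (leT := geq)) ss st _.
- by move=> y x z /= yx zy; apply: leq_trans zy yx.
- by move=> x y /=; rewrite andbC -eqn_leq => /eqP.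
by apply/allP=> k _ /=; rewrite e.
Qed.

Lemma rank_rep_iso A B :
  (forall k, \rank (xact A ^+ k) = \rank (xact B ^+ k)) -> rep_iso A B.
Proof.
move=> rAB; have [la [sla zla ila]] := jordan_form A.
have [mu [smu zmu imu]] := jordan_form B.
have e k : (\sum_(i <- la) (i - k) = \sum_(i <- mu) (i - k))%N.
  by rewrite -!rank_Spart -(rep_iso_rank k ila) -(rep_iso_rank k imu).
suff lamu : la = mu.
  by apply/rep_isoP; rewrite ((rep_isoP _ _) ila) ((rep_isoP _ _) imu) lamu.
apply: sorted_geq_count => // -[|k]; first by rewrite !(count_memPn _).
by have := sum_sub_count la k; rewrite !e sum_sub_count => /addnI/esym.
Qed.

End Jordan.

(** * Hall numbers *)

Lemma card_fibers (T U : finType) (A : {set T}) (B : {set U}) (f : T -> U) k :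
  {in A, forall x, f x \in B} ->
  {in B, forall y, #|[set x in A | f x == y]| = k} -> #|A| = (#|B| * k)%N.
Proof.
move=> fAB fib; rewrite -sum1_card (partition_big f (mem B)) //=.
rewrite -sum_nat_const; apply: eq_bigr => y /fib <-.
by rewrite -sum1_card; apply: eq_bigl => x; rewrite inE.
Qed.

Section HallNumbers.
Variable F : finFieldType.
Implicit Types M N L : cplx F.

Definition ext_x M N (p : 'M[F]_(rdim M, rdim N)) :=
  block_mx (xact N) 0 p (xact M).
Definition ext_d M N (p : 'M[F]_(rdim M, rdim N)) :=
  block_mx (diff N) 0 p (diff M).

Definition cocycle M N (p : 'M[F]_(rdim M, rdim N) * 'M[F]_(rdim M, rdim N)) :=
  cx (ext_x p.1) (ext_d p.2).

Lemma ext_x_nil M N p : exists k, @ext_x M N p ^+ k = 0.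
Proof.
have [[a ha] [b hb]] := (xact_nil M, xact_nil N); exists (a + b + (a + b))%N.
have [e he _] := lblock_expr (xact N) p (xact M) (a + b); rewrite exprD /ext_x he.
rewrite ![_ ^+ (a + b)]exprD ha hb mul0r mulr0 -mulmxE mulmx_block.
by rewrite !(mulmx0, mul0mx, addr0) block_mx0.
Qed.

Definition ext_rep M N p := NilRep (@ext_x_nil M N p).

Definition ext_cplx M N p (h : @cocycle M N p) : cplx F :=
  @Cplx F (ext_rep p.1) (ext_d p.2) (proj1 (andP h)) (eqP (proj2 (andP h))).

(* The middle term of the extension with cocycle p (a junk value when p is not
   a cocycle). *)
Definition ext_obj M N (p : 'M[F]_(rdim M, rdim N) * 'M[F]_(rdim M, rdim N)) : cplx F :=
  oapp (fun u : {p | cocycle p} => ext_cplx (valP u)) (stalk (rep0 F)) (insub p).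

(** An isomorphism onto [L] from the block triangular complex with corners [p]. Frames are counted
    in two ways: over cocycles their fibres are torsors under the automorphisms of [L], over exact
    sequences torsors under the linear maps from [M] to [N]. *)
Definition is_frame M N L p (g : 'M[F]_(rdim N + rdim M, rdim L)) :=
  [&& row_free g, row_full g, @ext_x M N p.1 *m g == g *m xact L
    & @ext_d M N p.2 *m g == g *m diff L].

Lemma frame_cocycle M N L p g : @is_frame M N L p g -> cocycle p.
Proof.
case/and4P=> fr fu /eqP xg /eqP dg; have /andP[/eqP xd /eqP dd] := cplx_cx L.
apply/andP; split; apply/eqP; apply: (row_free_inj fr) => /=.
  by rewrite -!mulmxA dg xg !mulmxA xg dg -!mulmxA xd.
by rewrite -mulmxA dg mulmxA dg -mulmxA dd mulmx0 mul0mx.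
Qed.

Lemma ext_obj_iso M N L p : cocycle p ->
  cplx_iso (@ext_obj M N p) L = [exists g, @is_frame M N L p g].
Proof.
move=> cp; rewrite /ext_obj insubT /=.
by apply/existsP/existsP=> -[g hg]; exists g; move: hg;
  rewrite /is_iso /is_frame /is_hom /is_rhom /=;
  [case/and3P=> /andP[-> ->] -> -> | case/and4P=> -> -> -> ->].
Qed.

Definition iso_set L : {set 'M[F]_(rdim L)} := [set h | @is_iso F L L h].

Definition frames M N L : {set 'M[F]_(rdim N + rdim M, rdim L)} :=
  [set g | [exists p, is_frame p g]].

Lemma frame_uniq M N L p p' g :
  @is_frame M N L p g -> is_frame p' g -> p = p'.
Proof.
case/and4P=> fr _ /eqP xg /eqP dg /and4P[_ _ /eqP xg' /eqP dg'].
have := row_free_inj fr (etrans xg (esym xg')).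
have := row_free_inj fr (etrans dg (esym dg')).
move=> {xg dg xg' dg'} /eq_block_mx[_ _ e2 _] /eq_block_mx[_ _ e1 _].
by case: p p' e1 e2 => p1 p2 [p1' p2'] /= -> ->.
Qed.

Lemma card_frames_cocycle M N L :
  #|frames M N L| =
    (#|[set p | cocycle p && cplx_iso (@ext_obj M N p) L]| * #|iso_set L|)%N.
Proof.
pose f g : 'M[F]_(rdim M, rdim N) * 'M[F]_(rdim M, rdim N) :=
  if [pick p | @is_frame M N L p g] is Some p then p else 0.
have fE p g : is_frame p g -> f g = p.
  rewrite /f => h; case: pickP => [p' h'|/(_ p)]; last by rewrite h.
  exact: frame_uniq h' h.
apply: (card_fibers (f := f)) => [g|p].
  rewrite !inE => /existsP[p h]; rewrite (fE p g h) (frame_cocycle h) /=.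
  by rewrite ext_obj_iso ?(frame_cocycle h) //; apply/existsP; exists g.
rewrite inE => /andP[cp]; rewrite ext_obj_iso // => /existsP[g0 h0].
have /and4P[fr fu /eqP xg /eqP dg] := h0.
have [k1 k2] := inv_mx fr fu; set g' := pinvmx g0 in k1 k2.
have inj : injective (mulmx g0 : 'M[F]_(rdim L) -> _).
  by move=> h h' e; rewrite -[h]mul1mx -k2 -mulmxA e mulmxA k2 mul1mx.
rewrite -(card_imset (mem (iso_set L)) inj).
apply: eq_card => g; rewrite inE; apply/andP/imsetP=> [[gG /eqP fg]|[h]].
  have {gG} /and4P[gr gu /eqP xg1 /eqP dg1] : is_frame p g.
    by move: gG; rewrite inE => /existsP[p' h']; rewrite -fg (fE _ _ h').
  have [l1 l2] := inv_mx gr gu; clearbody g'.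
  exists (g' *m g); last by rewrite mulmxA k1 mul1mx.
  have xg' : xact L *m g' = g' *m ext_x p.1.
    by rewrite -[LHS]mul1mx -k2 -!mulmxA (mulmxA g0) -xg -!mulmxA k1 mulmx1.
  have dg' : diff L *m g' = g' *m ext_d p.2.
    by rewrite -[LHS]mul1mx -k2 -!mulmxA (mulmxA g0) -dg -!mulmxA k1 mulmx1.
  rewrite inE /is_iso /is_hom /is_rhom !mulmxA xg' dg' -!mulmxA xg1 dg1 !eqxx /=.
  apply/andP; split.
    apply/row_freeP; exists (pinvmx g *m g0).
    by rewrite -mulmxA (mulmxA g) l1 mul1mx.
  apply/row_fullP; exists (pinvmx g *m g0).
  by rewrite -mulmxA (mulmxA g0) k1 mul1mx.
rewrite inE => /and3P[/andP[/eqP hx /eqP hd] hr hu] ->.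
have fg : is_frame p (g0 *m h).
  apply/and4P; split; last 2 first.
  - by rewrite mulmxA xg -!mulmxA hx.
  - by rewrite mulmxA dg -!mulmxA hd.
  - by rewrite /row_free mxrankMfree.
  by rewrite /row_full mxrankMfree // (eqP fr) -(eqP fu) (eqP fr).
by rewrite inE (fE _ _ fg) eqxx; split=> //; apply/existsP; exists p.
Qed.

Lemma frame_sub_quot M N L p g (g' := pinvmx g) :
  @is_frame M N L p g -> (usubmx g, rsubmx g') \in ses M N L.
Proof.
case/and4P=> fr fu /eqP xg /eqP dg.
have [k1 k2] := inv_mx fr fu; rewrite -/g' in k1 k2 *; clearbody g'.
have xg' : xact L *m g' = g' *m ext_x p.1.
  by rewrite -[LHS]mul1mx -k2 -!mulmxA (mulmxA g) -xg -!mulmxA k1 mulmx1.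
have dg' : diff L *m g' = g' *m ext_d p.2.
  by rewrite -[LHS]mul1mx -k2 -!mulmxA (mulmxA g) -dg -!mulmxA k1 mulmx1.
move: xg dg xg' dg' k1 k2 {fr fu}; rewrite -[g]vsubmxK -[g']hsubmxK.
rewrite col_mxKu row_mxKr.
move: (usubmx g) (dsubmx g) (lsubmx g') (rsubmx g') => i s r q.
rewrite /ext_x /ext_d !mul_block_col !mul_col_mx !mul_mx_row !mul_row_block.
rewrite !mul0mx !mulmx0 !addr0 !add0r mul_row_col.
move=> /eq_col_mx[xi _] /eq_col_mx[di _] /eq_row_mx[_ xq] /eq_row_mx[_ dq].
rewrite scalar_mx_block block_mxEv => /eq_col_mx[].
move=> /eq_row_mx[ir iq] /eq_row_mx[_ sq] ri.
rewrite inE /is_hom /is_rhom /= xi di xq dq !eqxx /=; apply/and3P; split.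
- by apply/row_freeP; exists r.
- by apply/row_fullP; exists s.
apply/andP; split; first exact/sub_kermxP.
apply/submxP; exists (kermx q *m r).
by rewrite -[LHS]mulmx1 -ri mulmxDr !mulmxA mulmx_ker mul0mx addr0.
Qed.

(** The section [s] is only linear. Its failures to commute with [x] and [d] are killed by [q], so
    they factor through [i] and provide the corners of the block matrices. *)
Lemma ses_framed M N L i q s :
  (i, q) \in ses M N L -> s *m q = 1%:M -> col_mx i s \in frames M N L.
Proof.
rewrite !inE /= => /and5P[/andP[/eqP xi /eqP di] /andP[/eqP xq /eqP dq] fi fq].
case/andP=> /sub_kermxP iq kq sq; have [r ri] := row_freeP fi.
have [a sa] : exists a, s *m xact L - xact M *m s = a *m i.
  apply/submxP; apply: submx_trans kq; apply/sub_kermxP.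
  by rewrite mulmxBl -!mulmxA xq sq mulmx1 mulmxA sq mul1mx subrr.
have [b sb] : exists b, s *m diff L - diff M *m s = b *m i.
  apply/submxP; apply: submx_trans kq; apply/sub_kermxP.
  by rewrite mulmxBl -!mulmxA dq sq mulmx1 mulmxA sq mul1mx subrr.
have fr : row_free (col_mx i s).
  apply/row_freeP; exists (row_mx (r - q *m (s *m r)) q).
  rewrite mul_col_row !mulmxBr !mulmxA iq sq ri !mul1mx !mul0mx subr0 subrr.
  by rewrite -scalar_mx_block.
apply/existsP; exists (a, b); apply/and4P; split=> //.
- rewrite /row_full (eqP fr); apply/eqP.
  have := mxrank_ker q; rewrite (eqP fq) => rk.
  have := mxrankS kq; have := mxrankS (introT sub_kermxP iq); rewrite rk (eqP fi).
  by have := rank_leq_row q; rewrite (eqP fq); lia.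
- by rewrite mul_block_col mul0mx addr0 mul_col_mx xi -sa subrK.
- by rewrite mul_block_col mul0mx addr0 mul_col_mx di -sb subrK.
Qed.

(** A frame is an exact sequence with a linear section of its quotient map. Two sections differ by
    an arbitrary matrix [c], not necessarily compatible with [x] or [d], whence the full power of
    [#|F|]. *)
Lemma card_frames_ses M N L :
  #|frames M N L| = (#|ses M N L| * #|F| ^ (rdim M * rdim N))%N.
Proof.
pose f g : 'M[F]_(rdim N, rdim L) * 'M[F]_(rdim L, rdim M) :=
  (usubmx g, rsubmx (pinvmx g)).
apply: (card_fibers (f := f)) => [g|[i q] iq_ses].
  by rewrite inE => /existsP[p /frame_sub_quot].
have := iq_ses; rewrite inE => /and5P[_ _ fi fq /andP[/sub_kermxP iq kq]].
rewrite /= in fi fq iq kq; have [s sq] := row_fullP fq.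
rewrite -card_mx -cardsT.
pose c0 (c : 'M[F]_(rdim M, rdim N)) := col_mx i (s + c *m i).
have inj : injective c0.
  by move=> c c' /eq_col_mx[_ /addrI]; apply: (row_free_inj fi).
rewrite -(card_imset _ inj); apply: eq_card => g.
rewrite inE; apply/andP/imsetP=> [[gG /eqP[gi gq]]|[c _ ->]].
  have gs : dsubmx g *m q = 1%:M.
    move: gG; rewrite inE => /existsP[p /and4P[fr fu _ _]].
    have [+ _] := inv_mx fr fu; rewrite -{1}[g]vsubmxK -[pinvmx g]hsubmxK gq.
    rewrite mul_col_row scalar_mx_block => /eq_block_mx[_ _ _ //].
  have /submxP[c e] : (dsubmx g - s <= i)%MS.
    by apply: submx_trans kq; apply/sub_kermxP; rewrite mulmxBl gs sq subrr.
  by exists c => //; rewrite /c0 -e -gi [s + _]addrC subrK vsubmxK.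
have sc : (s + c *m i) *m q = 1%:M by rewrite mulmxDl sq -mulmxA iq mulmx0 addr0.
have gG := ses_framed iq_ses sc; split=> //; apply/eqP; rewrite /f /c0 col_mxKu.
congr pair; move: gG; rewrite inE => /existsP[p /and4P[fr fu _ _]].
have [_ k2] := inv_mx fr fu; set g' := pinvmx _ in k2 *; clearbody g'.
rewrite -[RHS]mul1mx -k2 -mulmxA mul_col_mx iq sc -[g' in RHS]hsubmxK.
by rewrite mul_row_col mulmx0 mulmx1 add0r.
Qed.

Lemma is_iso_mul L1 L2 L3 (g : 'M_(rdim L1, rdim L2)) (h : 'M_(rdim L2, rdim L3)) :
  @is_iso F L1 L2 g -> @is_iso F L2 L3 h -> @is_iso F L1 L3 (g *m h).
Proof.
case/and3P=> /andP[/eqP gx /eqP gd] gr gu.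
case/and3P=> /andP[/eqP hx /eqP hd] hr hu.
rewrite /is_iso /is_hom /is_rhom !mulmxA gx gd -!mulmxA hx hd !eqxx /=.
rewrite /row_free /row_full mxrankMfree // (eqP gr) eqxx /=.
by apply/eqP; rewrite -(eqP hu) (eqP hr) -(eqP gu) (eqP gr).
Qed.

Lemma is_iso_inv L1 L2 (g : 'M_(rdim L1, rdim L2)) :
  @is_iso F L1 L2 g -> @is_iso F L2 L1 (pinvmx g).
Proof.
case/and3P=> /andP[/eqP gx /eqP gd] gr gu; have [k1 k2] := inv_mx gr gu.
rewrite /is_iso /is_hom /is_rhom (inv_intertwine gr gu gx).
rewrite (inv_intertwine gr gu gd) !eqxx /=.
by apply/andP; split; [apply/row_freeP; exists g|apply/row_fullP; exists g].
Qed.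

Lemma ses_equiv_equiv M N L :
  {in ses M N L & &, equivalence_rel (@ses_equiv F M N L)}.
Proof.
move=> e1 e2 e3 _ _ _; split.
  apply/existsP; exists 1%:M; rewrite mulmx1 mul1mx !eqxx /is_iso /is_hom /is_rhom.
  by rewrite !mulmx1 !mul1mx !eqxx row_free_unit row_full_unit unitmx1.
case/existsP=> h /and3P[hi /eqP h1 /eqP h2].
have [h'1 h'2] : pinvmx h *m h = 1%:M /\ h *m pinvmx h = 1%:M.
  by case/and3P: hi => _ hr hu; have [] := inv_mx hr hu.
have h'i := is_iso_inv hi; move: (pinvmx h) => h' in h'1 h'2 h'i.
apply/existsP/existsP=> -[k /and3P[ki /eqP k1 /eqP k2]].
  exists (h' *m k); rewrite (is_iso_mul h'i ki) /= -h1 -mulmxA (mulmxA h) h'2.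
  by rewrite mul1mx k1 -mulmxA k2 -h2 mulmxA h'1 mul1mx !eqxx.
exists (h *m k); rewrite (is_iso_mul hi ki) /= mulmxA h1 k1 -mulmxA k2 h2.
by rewrite !eqxx.
Qed.

Lemma ses_mul_iso M N L e h (h' := pinvmx h) : e \in ses M N L ->
  @is_iso F L L h -> (e.1 *m h, h' *m e.2) \in ses M N L.
Proof.
case: e => i q; rewrite !inE /= => /and5P[/andP[/eqP xi /eqP di]].
case/andP=> /eqP xq /eqP dq fi fq /andP[/sub_kermxP iq kq] hi.
have /and3P[/andP[/eqP hx' /eqP hd'] _ _] := is_iso_inv hi.
have /and3P[/andP[/eqP hx /eqP hd] hr hu] := hi.
have [h'1 h'2] := inv_mx hr hu; rewrite -/h' in h'1 h'2 hx' hd'; clearbody h'.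
rewrite /is_hom /is_rhom !mulmxA xi di hx' hd' -!mulmxA hx hd xq dq !eqxx /=.
rewrite /row_free mxrankMfree // (eqP fi) eqxx /=; apply/and3P; split.
- by have [s sq] := row_fullP fq; apply/row_fullP; exists (s *m h);
    rewrite -mulmxA (mulmxA h) h'1 mul1mx.
- by apply/sub_kermxP; rewrite -mulmxA (mulmxA h) h'1 mul1mx.
have /submxP[c e] : (kermx (h' *m q) *m h' <= i)%MS.
  by apply: submx_trans kq; apply/sub_kermxP; rewrite -mulmxA mulmx_ker.
by apply/submxP; exists c; rewrite mulmxA -e -mulmxA h'2 mulmx1.
Qed.

(** Orbit and stabilizer: an equivalence class is an orbit of the automorphisms of [L], and the
    automorphisms carrying one sequence to a given equivalent one are the translates of [h0] by
    [q *m c *m i'] with [c] a morphism from [M] to [N]. *)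
Lemma card_ses_class M N L e : e \in ses M N L ->
  (#|[set e' in ses M N L | ses_equiv e e']| * #|hom_set M N| = #|iso_set L|)%N.
Proof.
case: e => i q es; pose f (h : 'M_(rdim L)) := (i *m h, pinvmx h *m q).
apply/esym; apply: (card_fibers (f := f)) => [h|[i' q']].
  rewrite [h \in _]inE => hi; rewrite inE (ses_mul_iso es hi) /=.
  apply/existsP; exists h; rewrite hi eqxx /=.
  by case/and3P: hi => _ hr hu; have [k1 _] := inv_mx hr hu; rewrite mulmxA k1 mul1mx.
rewrite inE => /andP[e's /existsP[h0 /and3P[hi /eqP h1 /eqP h2]]].
rewrite /= in h1 h2.
have := es; have := e's; rewrite !inE /=.
case/and5P=> /andP[/eqP xi' /eqP di'] /andP[/eqP xq' /eqP dq'] fi' fq'.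
case/andP=> /sub_kermxP i'q' kq'.
case/and5P=> /andP[/eqP xi /eqP di] /andP[/eqP xq /eqP dq] fi fq.
case/andP=> /sub_kermxP iq kq.
have [h0' h'1 h'2] : exists2 h', h0 *m h' = 1%:M & h' *m h0 = 1%:M.
  by case/and3P: hi => _ hr hu; have [k1 k2] := inv_mx hr hu; exists (pinvmx h0).
pose c0 c := h0 + q *m c *m i'.
have qinj k (A B : 'M_(_, k)) : q *m A = q *m B -> A = B.
  have [s sq] := row_fullP fq.
  by move=> AB; rewrite -[A]mul1mx -sq -mulmxA AB mulmxA sq mul1mx.
have inj : injective c0.
  by move=> c c' /addrI/(row_free_inj fi')/qinj.
have i'h0 : i' *m h0' = i by rewrite -h1 -mulmxA h'1 mulmx1.
(* The relation [i' *m q' = 0] kills the second-order term, so a first-order correction of [h0'] is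
   already an inverse. *)
have invc c : c0 c *m (h0' - q' *m c *m i) = 1%:M.
  rewrite mulmxBr !mulmxDl h'1 -!mulmxA i'h0 (mulmxA i') i'q' mul0mx !mulmx0.
  by rewrite (mulmxA h0) h2 addr0 addrK.
rewrite -(card_imset _ inj); apply: eq_card => h.
have /and3P[/andP[/eqP h0x /eqP h0d] _ _] := hi.
rewrite !inE; apply/andP/imsetP=> [[hiso /eqP[hi' hq']]|[c]].
  have /and3P[/andP[/eqP hx /eqP hd] hr hu] := hiso.
  have hq : h *m q' = q.
    by have [k1 _] := inv_mx hr hu; rewrite -hq' mulmxA k1 mul1mx.
  have [s sq] := row_fullP fq.
  have /submxP[r re] : (1%:M - q *m s <= i)%MS.
    apply: submx_trans kq; apply/sub_kermxP.
    by rewrite mulmxBl -mulmxA sq mulmx1 mul1mx subrr.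
  have it : i *m (h - h0) = 0 by rewrite mulmxBr hi' h1 subrr.
  have tq : (h - h0) *m q' = 0 by rewrite mulmxBl hq h2 subrr.
  have tE : h - h0 = q *m (s *m (h - h0)).
    by rewrite -[LHS]mul1mx -[1%:M](subrK (q *m s)) re mulmxDl -!mulmxA it mulmx0 add0r.
  have /submxP[c ce] : (s *m (h - h0) <= i')%MS.
    by apply: submx_trans kq'; apply/sub_kermxP; rewrite -mulmxA tq mulmx0.
  exists c; last by rewrite /c0 -mulmxA -ce -tE addrC subrK.
  have tx : xact L *m (h - h0) = (h - h0) *m xact L.
    by rewrite mulmxBr mulmxBl hx h0x.
  have td : diff L *m (h - h0) = (h - h0) *m diff L.
    by rewrite mulmxBr mulmxBl hd h0d.
  have tE' : h - h0 = q *m (c *m i') by rewrite -ce.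
  rewrite inE /is_hom /is_rhom; apply/andP; split; apply/eqP.
    apply: qinj; apply: (row_free_inj fi'); rewrite /= !mulmxA -xq -!mulmxA.
    by rewrite -tE' tx tE' xi' !mulmxA.
  apply: qinj; apply: (row_free_inj fi'); rewrite /= !mulmxA -dq -!mulmxA.
  by rewrite -tE' td tE' di' !mulmxA.
rewrite inE => /andP[/eqP cx /eqP cd] hE.
have hu : h \in unitmx by rewrite hE; case/mulmx1_unit: (invc c).
have ih : i *m h = i' by rewrite hE mulmxDr h1 !mulmxA iq !mul0mx addr0.
have hq : h *m q' = q by rewrite hE mulmxDl h2 -!mulmxA i'q' !mulmx0 addr0.
split.
  rewrite /is_iso row_free_unit row_full_unit hu !andbT hE /is_hom /is_rhom.
  rewrite !(mulmxDr, mulmxDl) h0x h0d !mulmxA xq dq -!mulmxA -xi' -di'.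
  by rewrite !(mulmxA c) -cx -cd -!mulmxA !eqxx.
have hr : row_free h by rewrite row_free_unit.
have hl : row_full h by rewrite row_full_unit.
have [_ k2] := inv_mx hr hl; rewrite /f -ih; apply/eqP; congr pair.
by rewrite -hq mulmxA k2 mul1mx.
Qed.

(** The two counts of frames are compared after multiplication by [#|hom_set M N|]: [card_ses_class]
    then turns exact sequences into extension classes times automorphisms of [L], and the
    automorphisms cancel. *)
Lemma hall_coefE M N L :
  hall_coef M N L =
    #|[set p | cocycle p && cplx_iso (@ext_obj M N p) L]|%:R
      / (#|F| ^ (rdim M * rdim N))%:R.
Proof.
have homN0 : (0 < #|hom_set M N|)%N.
  by apply/card_gt0P; exists 0; rewrite inE /is_hom /is_rhom !mulmx0 !mul0mx !eqxx.
have isoN0 : (0 < #|iso_set L|)%N.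
  apply/card_gt0P; exists 1%:M; rewrite inE /is_iso /is_hom /is_rhom.
  by rewrite !mulmx1 !mul1mx !eqxx row_free_unit row_full_unit unitmx1.
have qN0 : (0 < #|F| ^ (rdim M * rdim N))%N by rewrite expn_gt0 (cardD1 0).
have := etrans (esym (card_frames_ses M N L)) (card_frames_cocycle M N L).
have -> : #|ses M N L| = (\sum_(B in ext_set M N L) #|B|)%N.
  apply: card_partition; apply: equivalence_partitionP.
  exact: ses_equiv_equiv.
set a := #|finset _|; set q := (_ ^ _)%N in qN0 *; rewrite /hall_coef.
move/(congr1 (muln^~ #|hom_set M N|)); rewrite /= mulnAC big_distrl /=.
rewrite (eq_bigr (fun _ => #|iso_set L|)) => [|B /imsetP[e es ->]]; last first.
  exact: card_ses_class.
rewrite sum_nat_const => e; have {}e : (#|ext_set M N L| * q = a * #|hom_set M N|)%N.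
  by apply/eqP; rewrite -(eqn_pmul2r isoN0) mulnAC e mulnAC.
have nz k : (0 < k)%N -> k%:R != 0 :> rat by rewrite lt0n Num.Theory.pnatr_eq0.
apply/eqP; rewrite eqr_div ?nz //.
by apply/eqP; rewrite -[LHS]natrM e natrM.
Qed.

End HallNumbers.

(** * The Hall product as an average over cocycles *)

Section HallProduct.
Variable F : finFieldType.
Implicit Types M N L : cplx F.
Local Notation hall := (hall F).

Lemma icls_repr (c : isoclass F) : icls (repr c) = c.
Proof. exact: reprK. Qed.

Lemma ext_transfer M N M' N' gM gN p p' :
  @is_iso F M M' gM -> @is_iso F N N' gN ->
  p.1 *m gN = gM *m p'.1 -> p.2 *m gN = gM *m p'.2 ->
  @cocycle F M' N' p' -> @cocycle F M N p /\ icls (ext_obj p) = icls (ext_obj p').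
Proof.
case/and3P=> /andP[/eqP xM /eqP dM] rM uM.
case/and3P=> /andP[/eqP xN /eqP dN] rN uN e1 e2 cp'.
have fr : @is_frame F M N (ext_cplx cp') p (block_mx gN 0 0 gM).
  rewrite /is_frame /row_free /row_full /= !rank_diag_block_mx (eqP rM) (eqP rN).
  rewrite eqxx -{1}(eqP rM) -{1}(eqP rN) (eqP uM) (eqP uN) eqxx /=.
  rewrite /ext_x /ext_d !mulmx_block !(mulmx0, mul0mx, addr0, add0r).
  by rewrite xM xN dM dN e1 e2 !eqxx.
have cp := frame_cocycle fr; split=> //.
rewrite [in RHS]/ext_obj insubT /=; apply/iclsP; rewrite ext_obj_iso //.
by apply/existsP; exists (block_mx gN 0 0 gM).
Qed.

Lemma hall_mul_basis_ext a b : hall_mul_basis a b =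
  (#|F| ^ (rdim (repr a) * rdim (repr b)))%:R^-1 *:
    \sum_(p | @cocycle F (repr a) (repr b) p) (hcls (ext_obj p) : hall).
Proof.
pose D := [fset icls (ext_obj p) | p in [set p | @cocycle F (repr a) (repr b) p]]%fset.
rewrite /hall_mul_basis (@fsbigTE _ _ _ _ D) => [|c cD]; last first.
  rewrite hall_coefE (_ : finset _ = finset.set0) ?cards0 ?mul0r ?scale0r //.
  apply/setP=> p; rewrite !inE; apply/negP=> /andP[cp /iclsP e].
  by case/imfsetP: cD; exists p; rewrite /= ?inE // e icls_repr.
under eq_bigr => c _ do rewrite hall_coefE mulrC -scalerA.
rewrite -scaler_sumr; congr (_ *: _).
have ext p : @cocycle F (repr a) (repr b) p ->
  hcls (ext_obj p) = \sum_(c <- D) (icls (ext_obj p) == c)%:R *: (<< c >> : hall).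
  move=> cp; rewrite (bigD1_seq (icls (ext_obj p))) ?fset_uniq //=; last first.
    by apply/imfsetP; exists p => //=; rewrite inE.
  rewrite eqxx scale1r big1 ?addr0 // => c' /negPf.
  by rewrite eq_sym => ->; rewrite scale0r.
under [RHS]eq_bigr => p cp do rewrite (ext p cp).
rewrite exchange_big /=; apply: eq_bigr => c _.
rewrite -scaler_suml -natr_sum; congr (_%:R *: _).
rewrite -sum1_card big_mkcond [RHS]big_mkcond; apply: eq_bigr => p _.
rewrite inE; case: (boolP (cocycle p)) => //= cp.
rewrite (_ : cplx_iso _ _ = (icls (ext_obj p) == c)); first by case: eqP.
by apply/iclsP/eqP; rewrite icls_repr.
Qed.

Lemma hall_mulE M N : hall_mul (hcls M) (hcls N) =
  (#|F| ^ (rdim M * rdim N))%:R^-1 *: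
    \sum_(p | @cocycle F M N p) (hcls (ext_obj p) : hall).
Proof.
rewrite hall_mul_basisE hall_mul_basis_ext.
set M' := repr (icls M); set N' := repr (icls N).
have /existsP[gM isoM] : cplx_iso M' M by apply/iclsP; rewrite icls_repr.
have /existsP[gN isoN] : cplx_iso N' N by apply/iclsP; rewrite icls_repr.
have := isoM; case/and3P=> _ rM uM; have := isoN; case/and3P=> _ rN uN.
have [M1 M2] := inv_mx rM uM; have [N1 N2] := inv_mx rN uN.
have isoM' := is_iso_inv isoM; have isoN' := is_iso_inv isoN.
have -> : (rdim M' * rdim N' = rdim M * rdim N)%N.
  by rewrite -(eqP rM) (eqP uM) -(eqP rN) (eqP uN).
move: (pinvmx gM) (pinvmx gN) => gM' gN' in M1 M2 N1 N2 isoM' isoN'.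
congr (_ *: _).
pose h (p : 'M[F]_(rdim M, rdim N) * 'M[F]_(rdim M, rdim N)) :=
  (gM *m p.1 *m gN', gM *m p.2 *m gN').
have hbij : bijective h.
  exists (fun p => (gM' *m p.1 *m gN, gM' *m p.2 *m gN)) => -[p1 p2] /=.
    by rewrite /h /= !mulmxA M2 !mul1mx -!mulmxA N2 !mulmx1.
  by rewrite /h /= !mulmxA M1 !mul1mx -!mulmxA N1 !mulmx1.
rewrite (reindex h) /=; last exact: onW_bij.
have tr p : cocycle p -> cocycle (h p) /\ icls (ext_obj (h p)) = icls (ext_obj p).
  by apply: (ext_transfer (p := h p) (p' := p) isoM isoN);
    rewrite /h /= -[LHS]mulmxA N2 mulmx1.
apply: eq_big => [p|p cp]; last first.
  rewrite /hcls; suff /tr[_ ->] : cocycle p by [].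
  apply: (ext_transfer (p' := h p) isoM' isoN' _ _ cp).1.
    by rewrite /h /= !mulmxA M2 mul1mx.
  by rewrite /h /= !mulmxA M2 mul1mx.
apply/idP/idP => [cp|/tr[]//].
apply: (ext_transfer (p' := h p) isoM' isoN' _ _ cp).1.
  by rewrite /h /= !mulmxA M2 mul1mx.
by rewrite /h /= !mulmxA M2 mul1mx.
Qed.

(* The isoclass of the homology together with dim Im d (ihall_relP). *)
Definition prof M : nat -> nat := rho (xact M) (diff M).

Lemma prof_ext_obj M N p : @cocycle F M N p ->
  prof (ext_obj p) = rho (ext_x p.1) (ext_d p.2).
Proof. by move=> cp; rewrite /ext_obj insubT. Qed.

Lemma prof_icls M N : icls M = icls N -> prof M = prof N.
Proof.
move/iclsP=> /existsP[g /and3P[/andP[/eqP gx /eqP gd] gr gu]].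
by apply/funext; apply: (rho_conj gr gu gx gd).
Qed.

Lemma prof_hom M k :
  prof M k = (\rank (xact (homology M) ^+ k) + (\rank (diff M) + \rank (diff M)))%N.
Proof. exact: rho_homology. Qed.

Lemma ihall_relP M N : ihall_rel M N <-> prof M = prof N.
Proof.
split=> [[hMN rMN]|pMN].
  by apply/funext=> k; rewrite !prof_hom (rep_iso_rank k hMN) rMN.
have [[k hk] [l hl]] := (xact_nil (homology M), xact_nil (homology N)).
have rMN : \rank (diff M) = \rank (diff N).
  (* At exponent [k + l] both homology actions vanish and only twice the rank of the differential is
     left. *)
  have := congr1 (fun f => f (k + l)%N) pMN; rewrite /= !prof_hom !exprD hk hl.
  by rewrite mul0r mulr0 !mxrank0; lia.
split=> //; apply: rank_rep_iso => j.
by have := congr1 (fun f => f j) pMN; rewrite /= !prof_hom rMN => /addIn.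
Qed.

End HallProduct.

(** * Descent to homology *)

Section RhoSplit.
Variable F : fieldType.

(** The lower parts of the corners, between the contractible summand and [xN], are coboundaries: the
    homotopy [U] cancels [J *m u + u *m dN], and the base change [g] by [c] removes the remaining
    [- (c *m xN)] and [J *m c - c *m dN]. What is left is a direct sum. *)
Lemma rho_ext_split n a r (xN dN : 'M[F]_n) (xA : 'M_a) a1 b1
    (c u : 'M_(r + r, n)) (J := Jmx F r)
    (X := block_mx xN 0 (col_mx a1 (- (c *m xN + J *m u + u *m dN)))
                   (block_mx xA 0 0 0))
    (D := block_mx dN 0 (col_mx b1 (J *m c - c *m dN)) (block_mx 0 0 0 J)) k :
  cx X D ->
  rho X D k = (rho (block_mx xN 0 a1 xA) (block_mx dN 0 b1 0) k + (r + r))%N.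
Proof.
move=> cxXD.
transitivity (rho (block_mx xN 0 a1 xA) (block_mx dN 0 b1 0) k + rho 0 J k)%N;
  last by rewrite rho_Jmx.
rewrite -rho_dsum.
pose U : 'M[F]_(n + (a + (r + r))) := block_mx 0 0 (col_mx 0 u) 0.
have XU : X + htpy D U = block_mx xN 0 (col_mx a1 (- (c *m xN))) (block_mx xA 0 0 0).
  rewrite /htpy !mulmx_block !(mulmx0, mul0mx, addr0, add0r) !add_block_mx.
  rewrite !(addr0, add0r) mul_block_col (mul_col_mx 0 u) !add_col_mx.
  by rewrite !(mul0mx, addr0, add0r) -addrA opprD subrK.
rewrite -(rho_htpy U cxXD) XU {XU U cxXD X}.
pose g : 'M[F]_(n + a + (r + r), n + (a + (r + r))) :=
  col_mx (block_mx 1%:M 0 0 (row_mx 1%:M 0)) (row_mx c (row_mx 0 1%:M)).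
pose g' : 'M[F]_(n + (a + (r + r)), n + a + (r + r)) :=
  row_mx (block_mx 1%:M 0 (col_mx 0 (- c)) (col_mx 1%:M 0))
         (col_mx 0 (col_mx 0 1%:M)).
have fr : row_free g.
  apply/row_freeP; exists g'; rewrite mul_col_row !mulmx_block mul_block_col.
  rewrite mul_row_block !mul_row_col !(mulmx0, mul0mx, mulmx1, mul1mx).
  by rewrite !(addr0, add0r) subrr row_mx0 col_mx0 -!scalar_mx_block.
have fu : row_full g by rewrite /row_full (eqP fr); apply/eqP; lia.
apply: esym; apply: (rho_conj fr fu).
  rewrite /g [LHS]mul_block_col [RHS]mul_col_mx [X in col_mx (X + _) _ = _]mulmx_block.
  rewrite [X in _ = col_mx X _]mulmx_block [X in _ = col_mx _ X]mul_row_block.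
  rewrite !(mulmx0, mul0mx, mul1mx, mulmx1, addr0, add0r).
  rewrite ![row_mx _ _ *m block_mx _ _ _ _]mul_row_block !mul_row_col !mul_mx_row.
  rewrite !(mulmx0, mul0mx, mul1mx, mulmx1, addr0, add0r) subrr.
  by rewrite !row_mx0.
rewrite /g [LHS]mul_block_col [RHS]mul_col_mx [X in col_mx (X + _) _ = _]mulmx_block.
  rewrite [X in _ = col_mx X _]mulmx_block [X in _ = col_mx _ X]mul_row_block.
  rewrite !(mulmx0, mul0mx, mul1mx, mulmx1, addr0, add0r).
rewrite ![row_mx _ _ *m block_mx _ _ _ _]mul_row_block !mul_row_col !mul_mx_row.
rewrite !(mulmx0, mul0mx, mul1mx, mulmx1, addr0, add0r) addrC subrK.
by rewrite row_mx0.
Qed.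

Lemma cx_block m n (x d : 'M[F]_m) a b (y c : 'M_n) :
  cx (block_mx x 0 a y) (block_mx d 0 b c) =
  [&& cx x d, cx y c, a *m d + y *m b == b *m x + c *m a & b *m d + c *m b == 0].
Proof.
rewrite /cx !mulmx_block !(mulmx0, mul0mx, addr0, add0r).
apply/andP/and4P=> [[/eqP/eq_block_mx[-> _ -> ->]] | ].
  rewrite -(block_mx0 F m n m n) => /eqP/eq_block_mx[-> _ -> ->].
  by rewrite !eqxx.
case=> /andP[/eqP-> /eqP->] /andP[/eqP-> /eqP->] /eqP-> /eqP->.
by rewrite block_mx0 !eqxx.
Qed.

End RhoSplit.

(** * Deforming the action of x by a homotopy *)

Section HomotopyChange.
Variable F : finFieldType.
Implicit Type M : cplx F.

Lemma htpy_is_rhom M u (h : exists k, (xact M + htpy (diff M) u) ^+ k = 0) :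
  @is_rhom F (NilRep h) (NilRep h) (diff M).
Proof. by have /andP[] := cx_htpy u (cplx_cx M). Qed.

(** Nilpotency is supplied as [h] because a homotopy can destroy it: by [htpy_Jmx] it may turn 0
    into the identity. *)
Definition htpy_cplx M u h : cplx F :=
  Cplx (@htpy_is_rhom M u h) (diff_sq0 M).

Lemma zero_nil_mx n : exists k, (0 : 'M[F]_n) ^+ k = 0.
Proof. by exists 1; rewrite expr1. Qed.

Definition trivial_rep n : nilrep F := NilRep (zero_nil_mx n).

Section Split.
Variables (A : nilrep F) (r : nat).

Let U := dsum A (trivial_rep (r + r)).
Let D : 'M[F]_(rdim U) := block_mx 0 0 0 (Jmx F r).

Lemma split_hom : is_rhom (M := U) (N := U) D.
Proof.
by rewrite /is_rhom /D /= !mulmx_block !(mulmx0, mul0mx, addr0, add0r).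
Qed.

Lemma split_sq0 : D *m D = 0.
Proof.
by rewrite /D mulmx_block !(mulmx0, mul0mx, addr0, add0r) Jmx_sq0 block_mx0.
Qed.

(* The complex A + K_S^r, with K_S^r in the basis (S^r, S^r). *)
Definition split_cplx : cplx F := Cplx split_hom split_sq0.

End Split.

End HomotopyChange.

(** * Linear functionals on the Hall algebra that depend on profiles only *)

Section Evaluation.
Variables (F : finFieldType) (W : lmodType rat).
Implicit Types (M N L : cplx F) (phi : (nat -> nat) -> W).
Local Notation hall := (hall F).

Definition ev phi (u : hall) : W :=
  \sum_(c <- msupp u) u@_c *: phi (prof (repr c)).

Lemma evw (d : {fset isoclass F}) phi u : (msupp u `<=` d)%fset ->
  ev phi u = \sum_(c <- d) u@_c *: phi (prof (repr c)).
Proof.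
move=> ud; apply: big_fset_incl => // c _ /mcoeff_outdom->.
by rewrite scale0r.
Qed.

Lemma ev_is_linear phi : linear (ev phi).
Proof.
move=> k u v; pose d := (msupp u `|` msupp v)%fset.
have ud : (msupp u `<=` d)%fset by rewrite fsubsetUl.
have vd : (msupp v `<=` d)%fset by rewrite fsubsetUr.
have kd : (msupp (k *: u + v) `<=` d)%fset.
  apply: fsubset_trans (msuppD_le _ _) _.
  by rewrite fsubUset vd (fsubset_trans (msuppZ_le _ _) ud).
rewrite (evw phi ud) (evw phi vd) (evw phi kd) scaler_sumr -big_split /=.
by apply: eq_bigr => c _; rewrite mcoeffD mcoeffZ scalerDl scalerA.
Qed.

HB.instance Definition _ phi :=
  GRing.isLinear.Build rat hall W *:%R (ev phi) (ev_is_linear phi).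

Lemma ev_hcls phi M : ev phi (hcls M) = phi (prof M).
Proof.
rewrite (evw phi (d := [fset icls M]%fset)) ?msuppU_le //.
by rewrite big_seq_fset1 mcoeffUU scale1r (prof_icls (icls_repr _)).
Qed.

Lemma ev_mul phi M N : ev phi (hall_mul (hcls M) (hcls N)) =
  (#|F| ^ (rdim M * rdim N))%:R^-1 *:
    \sum_(p | @cocycle F M N p) phi (rho (ext_x p.1) (ext_d p.2)).
Proof.
rewrite hall_mulE linearZ linear_sum /=; congr (_ *: _).
by apply: eq_bigr => p cp; rewrite ev_hcls prof_ext_obj.
Qed.

(* The shear (a, b) -> (a + u b, b) of cocycles changes the action of x on the
   middle term by a homotopy. *)
Lemma ev_mul_htpy phi M N u nilMu :
  ev phi (hall_mul (hcls M) (hcls N)) =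
  ev phi (hall_mul (hcls (@htpy_cplx F M u nilMu)) (hcls N)).
Proof.
rewrite !ev_mul /=; congr (_ *: _).
set x := xact M; set d := diff M.
pose h (p : 'M[F]_(rdim M, rdim N) * 'M[F]_(rdim M, rdim N)) := (p.1 + u *m p.2, p.2).
have hbij : bijective h.
  exists (fun p => (p.1 - u *m p.2, p.2)) => -[p1 p2] /=.
    by rewrite /h /= addrK.
  by rewrite /h /= subrK.
rewrite [RHS](reindex h) /=; last exact: onW_bij.
have hE p : block_mx (xact N) 0 (p.1 + u *m p.2) (x + htpy d u) =
    block_mx (xact N) 0 p.1 x +
    htpy (block_mx (diff N) 0 p.2 d) (block_mx 0 0 0 u).
  rewrite /htpy !mulmx_block !(mulmx0, mul0mx, addr0, add0r) !add_block_mx.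
  by rewrite !(addr0, add0r).
have cE p : cx (block_mx (xact N) 0 (p.1 + u *m p.2) (x + htpy d u))
               (block_mx (diff N) 0 p.2 d) =
            cx (block_mx (xact N) 0 p.1 x) (block_mx (diff N) 0 p.2 d).
  rewrite hE; apply/idP/idP; last exact: cx_htpy.
  by move/(cx_htpy (- block_mx 0 0 0 u)); rewrite htpyN addrK.
apply: eq_big => p; first by rewrite /cocycle /ext_x /ext_d /= cE.
rewrite /cocycle /ext_x /ext_d /= => cp; congr phi; apply/funext => k.
by rewrite hE rho_htpy.
Qed.

(* Since K is contractible, every cocycle (a2, b2) from K to N is, up to a base
   change c and a homotopy u of the middle term, zero; a cocycle is determined
   by the freely chosen lower halves of a2 and b2. *)
Lemma ev_mul_split phi (A : nilrep F) r N :
  ev phi (hall_mul (hcls (split_cplx A r)) (hcls N)) =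
  ev (fun f => phi (fun k => f k + (r + r))%N)
     (hall_mul (hcls (stalk A)) (hcls N)).
Proof.
rewrite !ev_mul /=.
set n := rdim N; set a := rdim A; set J := Jmx F r; pose x := xact N; pose d := diff N.
pose T m := ('M[F]_(m, n) * 'M[F]_(m, n))%type.
pose h (pq : T a * T (r + r)%N) : T (a + (r + r))%N :=
  (col_mx pq.1.1 pq.2.1, col_mx pq.1.2 pq.2.2).
have hbij : bijective h.
  exists (fun p => ((usubmx p.1, usubmx p.2), (dsubmx p.1, dsubmx p.2))) => [] [].
    by move=> [a1 b1] [a2 b2]; rewrite /h /= !col_mxKu !col_mxKd.
  by move=> a1 b1; rewrite /h /= !vsubmxK.
rewrite (reindex h) /=; last exact: onW_bij.
pose S (p : T (r + r)%N) :=
  (p.1 *m d == p.2 *m x + J *m p.1) && (p.2 *m d + J *m p.2 == 0).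
have /andP[/eqP xd /eqP dd] := cplx_cx N.
have hE pq : @cocycle F (split_cplx A r) N (h pq) =
             @cocycle F (stalk A) N pq.1 && S pq.2.
  case: pq => [[a1 b1] [a2 b2]]; rewrite /cocycle /ext_x /ext_d /h /=.
  have cS : cx (block_mx (xact A) 0 0 0) (block_mx 0 0 0 J).
    exact: (cplx_cx (split_cplx A r)).
  rewrite [LHS]cx_block [cx (block_mx _ _ a1 _) _]cx_block cS (cplx_cx N).
  rewrite (cplx_cx (stalk A)) /=.
  rewrite !mul_block_col !(mul_col_mx a1) !(mul_col_mx b1).
  rewrite !(mul0mx, addr0, add0r) !add_col_mx.
  rewrite !(addr0, add0r) /S /=; apply/andP/andP.
    case=> /eqP/eq_col_mx[-> ->]; rewrite -col_mx0 => /eqP/eq_col_mx[-> ->].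
    by rewrite !eqxx.
  by case=> /andP[/eqP-> /eqP->] /andP[/eqP-> /eqP->]; rewrite col_mx0 !eqxx.
pose G (p : 'M[F]_(r, n) * 'M[F]_(r, n)) : T (r + r)%N :=
  (col_mx (p.1 *m d - p.2 *m x) p.1, col_mx (- (p.2 *m d)) p.2).
have Jcol (u v : 'M[F]_(r, n)) : J *m col_mx u v = col_mx 0 u.
  by rewrite mul_block_col !(mul0mx, mul1mx, addr0).
have SE p : S p = (p == G (dsubmx p.1, dsubmx p.2)).
  case: p => p1 p2; rewrite -[p1]vsubmxK -[p2]vsubmxK /S /G /= !col_mxKd.
  move: (usubmx p1) (dsubmx p1) (usubmx p2) (dsubmx p2) => a2 a3 b2 b3.
  rewrite !Jcol !(mul_col_mx a2) !(mul_col_mx b2) !add_col_mx !addr0 xpair_eqE -col_mx0.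
  apply/andP/andP=> [[/eqP/eq_col_mx[_ ->] /eqP/eq_col_mx[_ e]]|].
    by rewrite addrAC subrr add0r -(addrK (b3 *m d) b2) (addrC b2) e add0r !eqxx.
  case=> /eqP/eq_col_mx[-> _] /eqP/eq_col_mx[-> _].
  rewrite [b3 *m x + _]addrC subrK subrr mulmxBl !mulNmx -!(mulmxA b3).
  by rewrite -(mulmxA a3) dd !mulmx0 sub0r oppr0 -/x -/d xd !eqxx.
have cardS : #|[set p | S p]| = (#|F| ^ ((r + r) * n))%N.
  rewrite mulnDl expnD -!card_mx -cardX -cardsT.
  have Ginj : injective G by move=> [? ?] [? ?] [/eq_col_mx[_ ->] /eq_col_mx[_ ->]].
  rewrite -(card_imset _ Ginj); apply: eq_card => p; rewrite inE SE.
  apply/eqP/imsetP=> [e|[q _ ->]]; last by rewrite /G /= !col_mxKd; case: q.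
  by exists (dsubmx p.1, dsubmx p.2) => //; rewrite inE.
have val p q : @cocycle F (split_cplx A r) N (h (p, q)) ->
    rho (@ext_x F (split_cplx A r) N (h (p, q)).1)
        (@ext_d F (split_cplx A r) N (h (p, q)).2) =
    (fun k => rho (@ext_x F (stalk A) N p.1) (@ext_d F (stalk A) N p.2) k + (r + r))%N.
  case: p => a1 b1 cpq; apply/funext => k.
  have : S q by move: cpq; rewrite hE => /andP[].
  rewrite SE => /eqP qE; move: cpq; rewrite qE.
  move: (dsubmx q.1) (dsubmx q.2) => a2 b2 {qE}; rewrite /cocycle /ext_x /ext_d /h /=.
  (* The base change is [col_mx b2 0] and the homotopy [- col_mx a2 0], read off from the free lower
     halves. *)
  have -> : col_mx (a2 *m d - b2 *m x) a2 = - (col_mx b2 0 *m x +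
      J *m (- col_mx a2 0) + (- col_mx a2 0) *m d).
    rewrite opp_col_mx oppr0 Jcol (mul_col_mx b2) (mul_col_mx (- a2)) !add_col_mx opp_col_mx.
    by rewrite !(mul0mx, addr0, add0r) opprK mulNmx opprB.
  have -> : col_mx (- (b2 *m d)) b2 = J *m col_mx b2 0 - col_mx b2 0 *m d.
    by rewrite Jcol (mul_col_mx b2) opp_col_mx add_col_mx mul0mx subr0 sub0r.
  exact: rho_ext_split.
pose psi (p : T a) :=
  phi (fun k => rho (@ext_x F (stalk A) N p.1) (@ext_d F (stalk A) N p.2) k + (r + r))%N.
rewrite (eq_bigr (fun pq => psi pq.1)) => [|[p q] cpq]; last first.
  by rewrite /psi -(val _ _ cpq).
rewrite (eq_bigl _ _ hE) -(pair_big (@cocycle F (stalk A) N) S (fun p q => psi p)) /=.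
under eq_bigr => p cp.
  rewrite sumr_const (_ : #|S| = #|F| ^ ((r + r) * n))%N; last first.
    by rewrite -cardS; apply: eq_card => q; rewrite inE.
  over.
rewrite /= sumrMnl -scaler_nat scalerA; congr (_ *: _).
(* Each cocycle for [A] extends in [#|F| ^ ((r + r) * n)] ways, which is exactly the change of the
   normalizing power when the dimension grows from [a] to [a + (r + r)]. *)
rewrite (mulnDl a) expnD natrM invfM -mulrA mulVf ?mulr1 //.
by rewrite Num.Theory.pnatr_eq0 -lt0n expn_gt0 (cardD1 0).
Qed.

End Evaluation.

(** * Duality by transposition *)

Section Transpose.
Variable F : finFieldType.
Implicit Types M N L : cplx F.

Lemma cx_conj m n (x d : 'M[F]_m) (y c : 'M_n) (g : 'M_(m, n)) :
  row_free g -> row_full g -> x *m g = g *m y -> d *m g = g *m c ->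
  cx x d = cx y c.
Proof.
move=> fr fu xg dg; have [g' gK] := row_fullP fu.
have inj k (A B : 'M_(n, k)) : g *m A = g *m B -> A = B.
  by move=> AB; rewrite -[A]mul1mx -gK -mulmxA AB mulmxA gK mul1mx.
apply/andP/andP=> -[/eqP e1 /eqP e2]; split; apply/eqP.
- by apply: inj; rewrite !mulmxA -xg -dg -!mulmxA -xg -dg !mulmxA e1.
- by apply: inj; rewrite mulmxA -dg -mulmxA -dg mulmxA e2 mul0mx mulmx0.
- apply: (row_free_inj fr); rewrite /= -!mulmxA xg dg !mulmxA xg dg.
  by rewrite -!mulmxA e1.
apply: (row_free_inj fr); rewrite /= -mulmxA dg mulmxA dg.
by rewrite -mulmxA e2 mulmx0 mul0mx.
Qed.

Lemma cx_tr n (x d : 'M[F]_n) : cx x^T d^T = cx x d.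
Proof.
rewrite /cx -!trmx_mul -(trmx0 F n n) !(inj_eq trmx_inj).
by rewrite trmx0 eq_sym.
Qed.

Lemma tr_nil M : exists k, (xact M)^T ^+ k = 0.
Proof.
by have [k xk] := xact_nil M; exists k; rewrite -trmx_expr xk trmx0.
Qed.

Lemma tr_hom M : @is_rhom F (NilRep (tr_nil M)) (NilRep (tr_nil M)) (diff M)^T.
Proof. by rewrite /is_rhom /= -!trmx_mul (eqP (diff_hom M)). Qed.

Lemma tr_sq0 M : (diff M)^T *m (diff M)^T = 0.
Proof. by rewrite -trmx_mul diff_sq0 trmx0. Qed.

Definition tr_cplx M : cplx F := Cplx (tr_hom M) (tr_sq0 M).

Lemma prof_tr M : prof (tr_cplx M) = prof M.
Proof. by apply/funext; apply: rho_tr. Qed.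

Definition flip_mx m n : 'M[F]_(m + n, n + m) := block_mx 0 1%:M 1%:M 0.

Lemma flip_free m n : row_free (flip_mx m n).
Proof.
apply/row_freeP; exists (flip_mx n m); rewrite /flip_mx mulmx_block.
by rewrite !(mulmx0, mul0mx, mulmx1, addr0, add0r) -scalar_mx_block.
Qed.

Lemma flip_full m n : row_full (flip_mx m n).
Proof. by rewrite /row_full (eqP (flip_free m n)) addnC eqxx. Qed.

Lemma flip_block m n (x : 'M[F]_n) p (y : 'M_m) :
  block_mx y^T 0 p^T x^T *m flip_mx m n = flip_mx m n *m (block_mx x 0 p y)^T.
Proof.
rewrite /flip_mx tr_block_mx !mulmx_block.
by rewrite !(mulmx0, mul0mx, mulmx1, mul1mx, addr0, add0r) trmx0.
Qed.

(** Transposing a lower triangular block matrix makes it upper triangular; exchanging the two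
    summands by [flip_mx] restores the shape with sub and quotient interchanged, and the profile is
    unaffected. *)
Lemma ev_mul_tr (W : lmodType rat) (phi : (nat -> nat) -> W) M N :
  ev phi (hall_mul (hcls M) (hcls N)) =
  ev phi (hall_mul (hcls (tr_cplx N)) (hcls (tr_cplx M))).
Proof.
rewrite !ev_mul /= mulnC; congr (_ *: _).
pose h (p : 'M[F]_(rdim M, rdim N) * 'M[F]_(rdim M, rdim N)) := (p.1^T, p.2^T).
have hbij : bijective h.
  by exists (fun p => (p.1^T, p.2^T)) => -[a b]; rewrite /h /= !trmxK.
rewrite [RHS](reindex h) /=; last exact: onW_bij.
have fr := flip_free (rdim M) (rdim N); have fu := flip_full (rdim M) (rdim N).
apply: eq_big => [p|p cp]; rewrite /cocycle /ext_x /ext_d /=.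
  by rewrite -cx_tr (cx_conj fr fu (flip_block _ _ _) (flip_block _ _ _)).
congr phi; apply/funext => k.
by rewrite -rho_tr (rho_conj fr fu (flip_block _ _ _) (flip_block _ _ _)).
Qed.

End Transpose.

(** * Products depend on the factors through their profiles *)

Section Descent.
Variables (F : finFieldType) (W : lmodType rat).
Implicit Types (M N L : cplx F) (phi : (nat -> nat) -> W).
Local Notation hall := (hall F).

Lemma ev_mul_homology phi M N (r := \rank (diff M)) :
  ev phi (hall_mul (hcls M) (hcls N)) =
  ev (fun f => phi (fun k => f k + (r + r))%N)
     (hall_mul (hcls (stalk (homology M))) (hcls N)).
Proof.
have [g /andP[fr fu] [u [gd gx]]] := homology_split M.
(* The deformed action is conjugate to the action on homology extended by zero, hence nilpotent. *)
have nilMu : exists k, (xact M + htpy (diff M) u) ^+ k = 0.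
  have [k xk] := xact_nil (dsum (homology M) (trivial_rep F (r + r))).
  have [g' gK] := row_fullP fu; exists k.
  rewrite -[LHS]mul1mx -gK -mulmxA -(mulmx_expr k gx).
  by rewrite [X in _ *m (X *m _)]xk mul0mx mulmx0.
rewrite (ev_mul_htpy phi N nilMu) -ev_mul_split.
rewrite /hcls (_ : icls (htpy_cplx nilMu) = icls (split_cplx (homology M) r)) //.
apply/esym/iclsP/existsP; exists g.
by rewrite /is_iso /is_hom /is_rhom /= gx gd !eqxx fr.
Qed.

Lemma ev_mul_profl phi M M' N : prof M = prof M' ->
  ev phi (hall_mul (hcls M) (hcls N)) = ev phi (hall_mul (hcls M') (hcls N)).
Proof.
move/ihall_relP=> [/rep_isoP iM rM]; rewrite [LHS]ev_mul_homology [RHS]ev_mul_homology rM.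
by rewrite /hcls iM.
Qed.

(* M * N = N^T * M^T by transposition; descent (on the left factor only)
   removes a transposition on the left. *)
Lemma ev_mul_clsC phi M N :
  ev phi (hall_mul (hcls M) (hcls N)) = ev phi (hall_mul (hcls N) (hcls M)).
Proof.
rewrite ev_mul_tr (ev_mul_profl phi _ (prof_tr N)) ev_mul_tr.
by rewrite (ev_mul_profl phi _ (prof_tr (tr_cplx M))) -ev_mul_tr.
Qed.

End Descent.

(** * The iHall algebra *)

Section HallBilinear.
Variable F : finFieldType.
Implicit Types M N L : cplx F.
Local Notation hall := (hall F).

Lemma hall_basis (u : hall) : u = \sum_(c <- msupp u) u@_c *: hcls (repr c).
Proof.
rewrite {1}(monalgE u); apply: eq_bigr => c _.
rewrite /hcls icls_repr; apply/malgP=> c'; rewrite mcoeffZ !mcoeffU.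
by case: eqP; rewrite ?mulr1 ?mulr0.
Qed.

Lemma hall_ind (P : hall -> Prop) :
  P 0 -> (forall u v, P u -> P v -> P (u + v)) ->
  (forall c u, P u -> P (c *: u)) -> (forall M, P (hcls M)) -> forall u, P u.
Proof.
move=> P0 PD PZ Pc u; rewrite (hall_basis u).
by elim/big_ind: _ => // c _; apply: PZ.
Qed.

Section Eval.
Variables (W : lmodType rat).
Implicit Type phi : (nat -> nat) -> W.

Lemma evD phi (u v : hall) : ev phi (u + v) = ev phi u + ev phi v.
Proof. exact: raddfD. Qed.

Lemma evZ phi c (u : hall) : ev phi (c *: u) = c *: ev phi u.
Proof. exact: linearZZ. Qed.

Lemma ev0 phi : ev phi (0 : hall) = 0.
Proof. exact: raddf0. Qed.

Lemma evB phi (u v : hall) : ev phi (u - v) = ev phi u - ev phi v.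
Proof. exact: raddfB. Qed.

Definition lin_hall (f : hall -> W) : Prop :=
  (forall u v, f (u + v) = f u + f v) /\ (forall c u, f (c *: u) = c *: f u).

Lemma lin_hall_ext (f g : hall -> W) : lin_hall f -> lin_hall g ->
  (forall M, f (hcls M) = g (hcls M)) -> f =1 g.
Proof.
move=> [fD fZ] [gD gZ] fg; elim/hall_ind=> [|u v e1 e2|c u e|//].
- by rewrite -(scale0r (0 : hall)) fZ gZ !scale0r.
- by rewrite fD gD e1 e2.
by rewrite fZ gZ e.
Qed.

Lemma lin_ev phi : lin_hall (ev phi).
Proof. by split=> [u v|c u]; [apply: evD | apply: evZ]. Qed.

Lemma lin_ev_mull phi (v : hall) : lin_hall (fun u => ev phi (hall_mul u v)).
Proof.
split=> [u w|c u]; first by rewrite hall_mulDl; apply: evD.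
by rewrite hall_mulZl; apply: evZ.
Qed.

Lemma lin_ev_mulr phi (v : hall) : lin_hall (fun u => ev phi (hall_mul v u)).
Proof.
split=> [u w|c u]; first by rewrite hall_mulDr; apply: evD.
by rewrite hall_mulZr; apply: evZ.
Qed.

Lemma ev_mulC phi (u v : hall) : ev phi (hall_mul u v) = ev phi (hall_mul v u).
Proof.
apply: (lin_hall_ext (lin_ev_mull phi v) (lin_ev_mulr phi v)) u => M.
apply: (lin_hall_ext (lin_ev_mulr phi _) (lin_ev_mull phi _)) v => N.
exact: ev_mul_clsC.
Qed.

(* A complex with profile f; the zero complex if there is none. *)
Definition of_prof f : cplx F := xget (stalk (rep0 F)) [set M | prof M = f]%classic.

Lemma prof_of_prof M : prof (of_prof (prof M)) = prof M.
Proof. by rewrite /of_prof; case: xgetP => [N _ //|/(_ M)[]]. Qed.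

(** An evaluation composed with multiplication by [v] is again an evaluation. This makes the common
    kernel of all evaluations an ideal, which [ev_ideal] compares with the defining one. *)
Lemma ev_mul_factor phi (v : hall) :
  {psi : (nat -> nat) -> W | forall u, ev phi (hall_mul u v) = ev psi u}.
Proof.
exists (fun f => ev phi (hall_mul (hcls (of_prof f)) v)) => u.
apply: (lin_hall_ext (lin_ev_mull phi v) (lin_ev _)) u => M; rewrite ev_hcls.
apply: (lin_hall_ext (lin_ev_mulr phi _) (lin_ev_mulr phi _)) v => N.
by apply: ev_mul_profl; rewrite prof_of_prof.
Qed.

Lemma ev_ideal phi (u : hall) : ihall_ideal u -> ev phi u = 0.
Proof.
move=> iu; apply: (iu (fun u => forall phi, ev phi u = 0)) => [|M N h psi].
  split=> [psi|v w hv hw psi|c v hv psi|v w hv]; rewrite ?ev0 //.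
  - by rewrite evD hv hw addr0.
  - by rewrite evZ hv scaler0.
  split=> psi; last rewrite ev_mulC; have [psi' e] := ev_mul_factor psi w.
    by rewrite e hv.
  by rewrite e hv.
by rewrite evB !ev_hcls (iffLR (ihall_relP M N) h) subrr.
Qed.

Definition iev phi (x : ihall F) : W := ev phi (repr x).

Lemma iev_pi phi (u : hall) : iev phi (ihall_pi u) = ev phi u.
Proof.
by apply/eqP; rewrite -subr_eq0 -evB (ev_ideal _ (repr_ihall_pi u)).
Qed.

Lemma iev_is_linear phi : linear (iev phi).
Proof.
move=> c x y; rewrite -(ihall_piK x) -(ihall_piK y) -[_ *: _]ihall_piZ.
by rewrite -ihall_piD !iev_pi evD evZ.
Qed.

HB.instance Definition _ phi :=
  GRing.isLinear.Build rat (ihall F) W *:%R (iev phi) (iev_is_linear phi).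

Lemma iev_cls phi M : iev phi (ihall_cls M) = phi (prof M).
Proof. by rewrite iev_pi ev_hcls. Qed.

End Eval.

End HallBilinear.

(** * The commutative ring structure on the quotient *)

Section IHallRing.
Variable F : finFieldType.
Implicit Types (M N L : cplx F) (x y z : ihall F).
Local Notation hall := (hall F).

Lemma ihall_pi_is_linear : linear (@ihall_pi F).
Proof. by move=> c u v; rewrite ihall_piD ihall_piZ. Qed.

HB.instance Definition _ :=
  GRing.isLinear.Build rat hall (ihall F) *:%R (@ihall_pi F) ihall_pi_is_linear.

Lemma ihall_pi_scaler c (u : hall) : ihall_pi (c *: u) = c *: ihall_pi u.
Proof. exact: ihall_piZ. Qed.

Lemma ihall_pi0 : ihall_pi (0 : hall) = 0 :> ihall F.
Proof. exact: raddf0. Qed.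

Definition lab (f : nat -> nat) : ihall F := ihall_cls (of_prof F f).

Lemma ihall_cls_lab M : ihall_cls M = lab (prof M).
Proof.
apply/ihall_piP => I _ h; apply: h; apply/ihall_relP.
by rewrite prof_of_prof.
Qed.

(** The projection is itself an evaluation, so every identity proved for all [ev phi] holds in the
    quotient. *)
Lemma ihall_pi_ev (u : hall) : ihall_pi u = ev lab u.
Proof.
elim/hall_ind: u => [|u v e1 e2|c u e|M].
- by rewrite ihall_pi0 ev0.
- by rewrite ihall_piD evD e1 e2.
- by rewrite ihall_pi_scaler evZ e.
by rewrite ev_hcls -ihall_cls_lab.
Qed.

Lemma ihall_ind (P : ihall F -> Prop) :
  P 0 -> (forall x y, P x -> P y -> P (x + y)) ->
  (forall c x, P x -> P (c *: x)) -> (forall M, P (ihall_cls M)) -> forall x, P x.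
Proof.
move=> P0 PD PZ Pc x; rewrite -(ihall_piK x).
elim/hall_ind: (repr x) => [|u v e1 e2|c u e|M]; rewrite ?ihall_pi0 //.
- by rewrite ihall_piD; apply: PD.
- by rewrite ihall_pi_scaler; apply: PZ.
exact: Pc.
Qed.

Lemma ihall_mulC : commutative (@ihall_mul F).
Proof.
move=> x y; rewrite -(ihall_piK x) -(ihall_piK y) -!ihall_piM.
by rewrite !ihall_pi_ev ev_mulC.
Qed.

Lemma ihall_mulDl : left_distributive (@ihall_mul F) +%R.
Proof.
move=> x y z; rewrite -(ihall_piK x) -(ihall_piK y) -(ihall_piK z).
by rewrite -ihall_piD -!ihall_piM -ihall_piD hall_mulDl.
Qed.

Lemma ihall_mulDr : right_distributive (@ihall_mul F) +%R.
Proof. by move=> x y z; rewrite !(ihall_mulC x) ihall_mulDl. Qed.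

Lemma ihall_mulZl c x y : ihall_mul (c *: x) y = c *: ihall_mul x y.
Proof.
rewrite -(ihall_piK x) -(ihall_piK y) -ihall_pi_scaler -!ihall_piM hall_mulZl.
exact: ihall_pi_scaler.
Qed.

Lemma ihall_mulZr c x y : ihall_mul x (c *: y) = c *: ihall_mul x y.
Proof. by rewrite !(ihall_mulC x) ihall_mulZl. Qed.

Lemma ihall_mul0l x : ihall_mul 0 x = 0.
Proof. by rewrite -[X in ihall_mul X](scale0r (0 : ihall F)) ihall_mulZl scale0r. Qed.

Lemma ihall_mul_sumr (I : Type) (s : seq I) (P : pred I) f x :
  ihall_mul x (\sum_(i <- s | P i) f i) = \sum_(i <- s | P i) ihall_mul x (f i).
Proof.
apply: (big_morph (ihall_mul x)) => [y z|]; first exact: ihall_mulDr.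
by rewrite ihall_mulC ihall_mul0l.
Qed.

Lemma ihall_mul_suml (I : Type) (s : seq I) (P : pred I) f x :
  ihall_mul (\sum_(i <- s | P i) f i) x = \sum_(i <- s | P i) ihall_mul (f i) x.
Proof.
by rewrite ihall_mulC ihall_mul_sumr; apply: eq_bigr => i _; rewrite ihall_mulC.
Qed.

Lemma ihall_mul_ext M N : ihall_mul (ihall_cls M) (ihall_cls N) =
  (#|F| ^ (rdim M * rdim N))%:R^-1 *:
    \sum_(p | @cocycle F M N p) ihall_cls (ext_obj p).
Proof. by rewrite -ihall_piM hall_mulE ihall_pi_scaler raddf_sum. Qed.

Lemma ihall_mul_cls M N : ihall_mul (ihall_cls M) (ihall_cls N) =
  (#|F| ^ (rdim M * rdim N))%:R^-1 *:
    \sum_(p | @cocycle F M N p) lab (rho (ext_x p.1) (ext_d p.2)).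
Proof. by rewrite -ihall_piM ihall_pi_ev ev_mul. Qed.

Lemma ihall_mul1 : left_id (ihall_one F) (@ihall_mul F).
Proof.
move=> x; elim/ihall_ind: x => [|x y e1 e2|c x e|N].
- by rewrite ihall_mulC ihall_mul0l.
- by rewrite ihall_mulDr e1 e2.
- by rewrite ihall_mulZr e.
rewrite ihall_mul_cls /= mul0n expn0 invr1 scale1r (big_pred1 (0, 0)) => [|p].
  rewrite ihall_cls_lab; congr lab; apply/funext.
  pose g : 'M[F]_(rdim N + 0, rdim N) := col_mx 1%:M 0.
  have fr : row_free g.
    apply/row_freeP; exists (row_mx 1%:M 0); rewrite /g mul_col_row.
    rewrite !(mulmx0, mul0mx, mulmx1) [RHS]scalar_mx_block.
    by rewrite [X in _ = block_mx _ _ _ X]flatmx0.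
  have fu : row_full g by rewrite /row_full (eqP fr) addn0.
  by apply: (rho_conj fr fu); rewrite /ext_x /ext_d /= mul_block_col mul_col_mx;
    rewrite !(mulmx0, mul0mx, mulmx1, mul1mx, addr0).
rewrite /= (_ : p = (0, 0)) ?eqxx; last first.
  by case: p => a b; congr pair; apply: flatmx0.
rewrite /cocycle /ext_x /ext_d cx_block (cplx_cx N) (cplx_cx (stalk (rep0 F))) /=.
by rewrite !(mulmx0, mul0mx, addr0) !eqxx.
Qed.

End IHallRing.

Section Associativity.
Variable F : finFieldType.
Implicit Types (M N P L : cplx F).
Local Notation hall := (hall F).

(** The identity matrix, typed between the two bracketings of a sum of three dimensions; conjugation
    by it replaces casts. *)
Definition assoc_mx l n m : 'M[F]_(l + (n + m), l + n + m) :=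
  block_mx (row_mx 1%:M 0) 0 (col_mx (row_mx 0 1%:M) 0) (col_mx 0 1%:M).

Lemma assoc_free l n m : row_free (assoc_mx l n m).
Proof.
apply/row_freeP; exists (assoc_mx l n m)^T.
rewrite /assoc_mx tr_block_mx !tr_col_mx !tr_row_mx !trmx0 !trmx1 mulmx_block.
rewrite !(mul_col_mx (row_mx 0 1%:M)) !(mul_col_mx (0 : 'M_(n, m))).
rewrite !mul_mx_row !mul_row_col !(mulmx0, mul0mx, mulmx1, mul1mx, addr0, add0r).
rewrite !(row_mx0, col_mx0) !(addr0, add0r) add_col_mx.
rewrite !(addr0, add0r) [RHS]scalar_mx_block (scalar_mx_block n m).
by rewrite -block_mxEv.
Qed.

Lemma assoc_full l n m : row_full (assoc_mx l n m).
Proof. by rewrite /row_full (eqP (assoc_free l n m)) addnA eqxx. Qed.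

Lemma assoc_block l n m (xP : 'M[F]_l) (xN : 'M_n) (xM : 'M_m) s1 s2 p :
  block_mx xP 0 (col_mx s1 s2) (block_mx xN 0 p xM) *m assoc_mx l n m =
  assoc_mx l n m *m block_mx (block_mx xP 0 s1 xN) 0 (row_mx s2 p) xM.
Proof.
rewrite /assoc_mx !mulmx_block !mul_block_col (mul_col_mx s1).
rewrite !(mul_col_mx (row_mx 0 1%:M)) !(mul_col_mx (0 : 'M_(n, m))).
rewrite ![row_mx _ _ *m block_mx _ _ _ _]mul_row_block !mul_mx_row.
rewrite !(mulmx0, mul0mx, mulmx1, mul1mx, addr0, add0r).
by rewrite !add_col_mx !add_row_mx !(addr0, add0r).
Qed.

Lemma ihall_mulA_cls M N P :
  ihall_mul (ihall_cls M) (ihall_mul (ihall_cls N) (ihall_cls P)) =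
  ihall_mul (ihall_mul (ihall_cls M) (ihall_cls N)) (ihall_cls P).
Proof.
set m := rdim M; set n := rdim N; set l := rdim P.
pose T a b := ('M[F]_(a, b) * 'M[F]_(a, b))%type.
pose XR (p : T n l) (s : T m (l + n)%N) :=
  block_mx (block_mx (xact P) 0 p.1 (xact N)) 0 s.1 (xact M).
pose DR (p : T n l) (s : T m (l + n)%N) :=
  block_mx (block_mx (diff P) 0 p.2 (diff N)) 0 s.2 (diff M).
pose XL (p : T m n) (s : T (n + m)%N l) :=
  block_mx (xact P) 0 s.1 (block_mx (xact N) 0 p.1 (xact M)).
pose DL (p : T m n) (s : T (n + m)%N l) :=
  block_mx (diff P) 0 s.2 (block_mx (diff N) 0 p.2 (diff M)).
(* A triangular complex with three diagonal blocks restricts to a complex on the two blocks grouped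
   first, so the inner cocycle condition is implied and each double sum runs over all such
   complexes. *)
have cxR p s : cx (XR p s) (DR p s) -> @cocycle F N P p.
  by rewrite /XR /DR cx_block => /and4P[].
have cxL p s : cx (XL p s) (DL p s) -> @cocycle F M N p.
  by rewrite /XL /DL cx_block => /and4P[].
pose q := (#|F| ^ (n * l + m * (l + n)))%:R^-1 : rat.
transitivity (q *: \sum_(ps : T n l * T m (l + n)%N | cx (XR ps.1 ps.2) (DR ps.1 ps.2))
    lab F (rho (XR ps.1 ps.2) (DR ps.1 ps.2))).
  rewrite ihall_mul_ext ihall_mulZr ihall_mul_sumr.
  rewrite (eq_bigr (fun p => (#|F| ^ (m * (l + n)))%:R^-1 *:
    \sum_(s | cx (XR p s) (DR p s)) lab F (rho (XR p s) (DR p s)))); last first.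
    by move=> p cp; rewrite ihall_mul_cls /ext_obj insubT.
  rewrite -scaler_sumr scalerA -invfM -natrM -expnD.
  congr (_ *: _); rewrite (pair_big_dep (@cocycle F N P)
    (fun p s => cx (XR p s) (DR p s)) (fun p s => lab F (rho (XR p s) (DR p s)))) /=.
  apply: eq_bigl => ps; apply/andP/idP => [[]//|h]; split=> //.
  exact: cxR h.
transitivity (q *: \sum_(ps : T m n * T (n + m)%N l | cx (XL ps.1 ps.2) (DL ps.1 ps.2))
    lab F (rho (XL ps.1 ps.2) (DL ps.1 ps.2))); last first.
  rewrite ihall_mul_ext ihall_mulZl ihall_mul_suml.
  rewrite [in RHS](eq_bigr (fun p => (#|F| ^ ((n + m) * l))%:R^-1 *:
    \sum_(s | cx (XL p s) (DL p s)) lab F (rho (XL p s) (DL p s)))); last first.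
    by move=> p cp; rewrite ihall_mul_cls /ext_obj insubT.
  rewrite -scaler_sumr scalerA -invfM -natrM -expnD.
  have -> : (rdim M * rdim N + (n + m) * l = n * l + m * (l + n))%N.
    by rewrite -/m -/n; lia.
  congr (_ *: _); rewrite [RHS](pair_big_dep (@cocycle F M N)
    (fun p s => cx (XL p s) (DL p s)) (fun p s => lab F (rho (XL p s) (DL p s)))) /=.
  apply: eq_bigl => ps; apply/idP/andP => [h|[]//]; split=> //.
  exact: cxL h.
congr (_ *: _).
pose h (ps : T m n * T (n + m)%N l) : T n l * T m (l + n)%N :=
  ((usubmx ps.2.1, usubmx ps.2.2),
   (row_mx (dsubmx ps.2.1) ps.1.1, row_mx (dsubmx ps.2.2) ps.1.2)).
have hbij : bijective h.
  exists (fun ps => ((rsubmx ps.2.1, rsubmx ps.2.2),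
    (col_mx ps.1.1 (lsubmx ps.2.1), col_mx ps.1.2 (lsubmx ps.2.2)))).
    by case=> -[? ?] [? ?]; rewrite /h /= !row_mxKl !row_mxKr !vsubmxK.
  by case=> -[? ?] [? ?]; rewrite /h /= !col_mxKu !col_mxKd !hsubmxK.
rewrite (reindex h) /=; last exact: onW_bij.
have fr := assoc_free l n m; have fu := assoc_full l n m.
have eX ps : XL ps.1 ps.2 *m assoc_mx l n m = assoc_mx l n m *m XR (h ps).1 (h ps).2.
  by rewrite /XL /XR /h /= -assoc_block vsubmxK.
have eD ps : DL ps.1 ps.2 *m assoc_mx l n m = assoc_mx l n m *m DR (h ps).1 (h ps).2.
  by rewrite /DL /DR /h /= -assoc_block vsubmxK.
apply: eq_big => ps; first by rewrite (cx_conj fr fu (eX ps) (eD ps)).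
by move=> _; congr lab; apply/funext => k; rewrite (rho_conj fr fu (eX ps) (eD ps)).
Qed.

Lemma ihall_mulA : associative (@ihall_mul F).
Proof.
move=> x y z; elim/ihall_ind: x => [|x1 x2 e1 e2|c x e|M].
- by rewrite !ihall_mul0l.
- by rewrite !ihall_mulDl e1 e2.
- by rewrite !ihall_mulZl e.
elim/ihall_ind: y => [|y1 y2 e1 e2|c y e|N].
- by rewrite (ihall_mulC _ 0) !ihall_mul0l (ihall_mulC _ 0) ihall_mul0l.
- by rewrite !(ihall_mulDl, ihall_mulDr) e1 e2.
- by rewrite !(ihall_mulZl, ihall_mulZr) e.
elim/ihall_ind: z => [|z1 z2 e1 e2|c z e|P]; last exact: ihall_mulA_cls.
- by rewrite !(ihall_mulC _ 0) !ihall_mul0l ihall_mulC ihall_mul0l.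
- by rewrite !ihall_mulDr e1 e2.
by rewrite !ihall_mulZr e.
Qed.

Lemma ihall_one_neq0 : ihall_one F != 0.
Proof.
apply/eqP=> /(congr1 (iev (fun _ => 1 : rat^o))).
by rewrite /ihall_one iev_pi ev_hcls raddf0 => /eqP; rewrite oner_eq0.
Qed.

HB.instance Definition _ := GRing.Zmodule_isComNzRing.Build (ihall F)
  ihall_mulA (@ihall_mulC F) (@ihall_mul1 F) (@ihall_mulDl F) ihall_one_neq0.

HB.instance Definition _ := GRing.Lmodule_isLalgebra.Build rat (ihall F)
  (fun c x y => esym (ihall_mulZl c x y)).
HB.instance Definition _ := GRing.Lalgebra_isComAlgebra.Build rat (ihall F).

End Associativity.

(** * Triangularity *)

Section Monomials.
Variables (A : comAlgType rat) (g : nat -> A).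

Definition mon (m : {cmonom nat}) : A := \prod_(i <- finsupp m) g i ^+ m i.

Lemma monEw (d : {fset nat}) (m : {cmonom nat}) :
  (finsupp m `<=` d)%fset -> mon m = \prod_(i <- d) g i ^+ m i.
Proof.
move=> md; apply: big_fset_incl => // i _.
by rewrite -cmE_eq0 => /eqP->; rewrite expr0.
Qed.

Lemma mon_is_mmorphism : mmorphism mon.
Proof.
split=> [m1 m2|]; last by rewrite /mon mdom1 big_seq_fset0.
rewrite (monEw (d := finsupp m1 `|` finsupp m2)%fset) ?mdomD //.
rewrite (monEw (fsubsetUl _ (finsupp m2))) (monEw (fsubsetUr (finsupp m1) _)).
by rewrite -big_split /=; apply: eq_bigr => i _; rewrite cmM exprD.
Qed.

HB.instance Definition _ :=
  isMultiplicative.Build {cmonom nat} A mon mon_is_mmorphism.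

Definition polyev : polyQ -> A := mmap (in_alg A) mon.

Lemma polyevE p : polyev p = \sum_(m <- msupp p) p@_m *: mon m.
Proof. by apply: eq_bigr => m _; rewrite mulr_algl. Qed.

Lemma polyev_is_linear : linear polyev.
Proof.
move=> c p q; rewrite /polyev raddfD /= mmapZ.
by rewrite mulr_algl.
Qed.

HB.instance Definition _ :=
  GRing.isLinear.Build rat polyQ A *:%R polyev polyev_is_linear.

Lemma polyevB p q : polyev (p - q) = polyev p - polyev q.
Proof. exact: raddfB. Qed.

Lemma polyevD p q : polyev (p + q) = polyev p + polyev q.
Proof. exact: raddfD. Qed.

Lemma polyevZ c p : polyev (c *: p) = c *: polyev p.
Proof. exact: linearZZ. Qed.

Lemma polyev_var i : polyev (polyQ_var i) = g i.
Proof.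
by rewrite /polyev /polyQ_var mmapU /= mulr_algl scale1r /mon mdomU big_seq_fset1 cmUU.
Qed.

Lemma polyevM : {morph polyev : p q / p * q}.
Proof. exact: rmorphM. Qed.

Lemma polyev1 : polyev 1 = 1.
Proof. exact: rmorph1. Qed.

(** Monomials are turned into decreasing lists of indices, the form in which partitions label the
    basis. *)
Definition mseq (m : {cmonom nat}) : seq nat :=
  sort geq (flatten [seq nseq (m i) i | i <- finsupp m]).

Lemma mseq_sorted m : sorted geq (mseq m).
Proof. by apply: sort_sorted => i j /=; apply: leq_total. Qed.

Lemma count_mseq m i : count_mem i (mseq m) = m i.
Proof.
rewrite count_sort count_flatten -map_comp sumnE big_map.
under eq_bigr => j _ do rewrite /= count_nseq /=.
case: (mdomP m i) => im.
  rewrite (bigD1_seq i) ?fset_uniq //= eqxx mul1n big1 ?addn0 // => j /negPf.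
  by move=> ->; rewrite mul0n.
rewrite big_seq big1 // => j jm; case: eqP => [e|_]; rewrite ?mul0n //.
by rewrite -e jm in im.
Qed.

Lemma mseq_inj : injective mseq.
Proof.
by move=> m m' e; apply/eqP/cmP=> i; rewrite -!count_mseq e.
Qed.

Lemma mon_mseq m : mon m = \prod_(i <- mseq m) g i.
Proof.
rewrite (perm_big _ (permEl (perm_sort _ _))) big_flatten big_map.
by apply: eq_bigr => i _; rewrite big_nseq iter_mulr_1.
Qed.

End Monomials.

(** * Triangular families and bijectivity *)

Section Triangular.
Variables (A : comAlgType rat) (L : Type) (b : L -> A).

Inductive lspan (P : L -> Prop) : A -> Prop :=
| lspan0 : lspan P 0
| lspanDZ c f x : P f -> lspan P x -> lspan P (c *: b f + x).

Lemma lspan_b (P : L -> Prop) f : P f -> lspan P (b f).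
Proof.
by move=> Pf; rewrite -[b f]scale1r -[_ *: _]addr0; apply/lspanDZ/lspan0.
Qed.

Lemma lspanD P x y : lspan P x -> lspan P y -> lspan P (x + y).
Proof.
by elim=> [|c f z Pf _ IH] Py; rewrite ?add0r // -addrA; constructor => //; apply: IH.
Qed.

Lemma lspanZ P c x : lspan P x -> lspan P (c *: x).
Proof.
elim=> [|d f z Pf _ IH]; first by rewrite scaler0; constructor.
by rewrite scalerDr scalerA; constructor.
Qed.

Lemma lspan_sum P (I : Type) (s : seq I) (Q : pred I) (f : I -> A) :
  (forall i, Q i -> lspan P (f i)) -> lspan P (\sum_(i <- s | Q i) f i).
Proof.
move=> h; elim/big_ind: _ => //; first exact: lspan0.
exact: lspanD.
Qed.

Lemma lspan_sub (P Q : L -> Prop) x :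
  (forall f, P f -> Q f) -> lspan P x -> lspan Q x.
Proof. by move=> PQ; elim=> [|c f z /PQ]; constructor. Qed.

Lemma lspan_mul (P Q R : L -> Prop) x y :
  (forall f f', P f -> Q f' -> lspan R (b f * b f')) ->
  lspan P x -> lspan Q y -> lspan R (x * y).
Proof.
move=> PQR; elim=> [|c f z Pf _ IH] Qy; first by rewrite mul0r; constructor.
rewrite mulrDl -scalerAl; apply: lspanD (IH Qy); apply: lspanZ.
elim: Qy => [|d f' z' Qf' _ IH']; first by rewrite mulr0; constructor.
by rewrite mulrDr -scalerAr; apply: lspanD => //; apply/lspanZ/PQR.
Qed.

Definition leads (Q : L -> Prop) (g : L) (x : A) : Prop :=
  exists2 c, c != 0 & lspan Q (x - c *: b g).

Lemma leads_eq Q g x : x = b g -> leads Q g x.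
Proof. by move=> ->; exists 1; rewrite // scale1r subrr; apply: lspan0. Qed.

Lemma leads_span (P Q : L -> Prop) g x : leads (fun f => P f /\ f <> g) g x ->
  P g -> (forall f, P f -> Q f) -> lspan Q x.
Proof.
move=> [c _ Px] Pg PQ; rewrite -[x](subrK (c *: b g)); apply: lspanD.
  by apply: lspan_sub Px => f [/PQ].
by apply/lspanZ/lspan_b/PQ.
Qed.

(** All summands carry the same coefficient, so the occurrences of [b g] add up to [c] times a
    positive integer, which is nonzero over the rationals. *)
Lemma leads_sum (I : finType) (C : pred I) (v : I -> L) c (P : L -> Prop) g :
  c != 0 -> (forall i, C i -> P (v i)) -> (exists2 i, C i & v i = g) ->
  leads (fun f => P f /\ f <> g) g (c *: \sum_(i | C i) b (v i)).
Proof.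
move=> cN0 CP [i0 Ci0 vi0]; pose D := [pred i | C i && `[< v i = g >]].
exists (c * #|D|%:R).
  rewrite mulf_neq0 // Num.Theory.pnatr_eq0 -lt0n; apply/card_gt0P; exists i0.
  by rewrite inE Ci0; apply/asboolP.
rewrite (bigID (fun i => `[< v i = g >])) /= (eq_bigr (fun _ => b g)); last first.
  by move=> i /andP[_ /asboolP->].
rewrite sumr_const scalerDr -scaler_nat scalerA addrAC subrr add0r.
apply/lspanZ/lspan_sum => i /andP[Ci /asboolPn vi]; apply: lspan_b.
by split=> //; apply: CP.
Qed.

Lemma leads_mul (P P' Q : L -> Prop) g g' G x y :
  leads P g x -> leads P' g' y -> leads Q G (b g * b g') ->
  (forall f', P' f' -> lspan Q (b g * b f')) ->
  (forall f, P f -> lspan Q (b f * b g')) ->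
  (forall f f', P f -> P' f' -> lspan Q (b f * b f')) -> leads Q G (x * y).
Proof.
move=> [c cN0 Px] [c' c'N0 Py] [d dN0 Qd] h1 h2 h3.
exists (c * c' * d); first by rewrite !mulf_neq0.
rewrite -[x](subrK (c *: b g)) -[y](subrK (c' *: b g')).
move: (x - _) (y - _) Px Py => r r' Pr Pr'.
have -> : (r + c *: b g) * (r' + c' *: b g') - (c * c' * d) *: b G =
    r * r' + c' *: (r * b g') + c *: (b g * r') +
      (c * c') *: (b g * b g' - d *: b G).
  rewrite scalerBr scalerA mulrDl !mulrDr -!scalerAl -!scalerAr scalerA.
  by rewrite !addrA.
have gspan : lspan (eq g) (b g) by apply: lspan_b.
have g'span : lspan (eq g') (b g') by apply: lspan_b.
apply: lspanD; last exact: lspanZ.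
apply: lspanD; last by apply/lspanZ/(lspan_mul _ gspan Pr') => f f' <-; apply: h1.
apply: lspanD; first exact: lspan_mul h3 Pr Pr'.
by apply/lspanZ/(lspan_mul _ Pr g'span) => f f' Pf <-; apply: h2.
Qed.

Definition above (real : L -> Prop) (deg w : L -> nat) f f' : Prop :=
  [/\ real f', deg f' = deg f & (w f < w f')%N].

(* Triangularity of the images of the monomials with respect to b, ordered by
   the weight w in each degree. *)
Lemma triangular_bijective (g : nat -> A) (real : L -> Prop)
    (coef : L -> {linear A -> rat^o}) (deg w : L -> nat) (bound : nat -> nat)
    (ell : seq nat -> L) :
  (forall f, real f -> coef f (b f) = 1) ->
  (forall f f', real f' -> f' <> f -> coef f (b f') = 0) ->
  (forall x, lspan real x) ->
  {in sorted geq &, injective ell} ->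
  (forall f, real f -> exists2 s, sorted geq s & ell s = f) ->
  (forall f, real f -> (w f <= bound (deg f))%N) ->
  (forall s, sorted geq s -> real (ell s)) ->
  (forall s, sorted geq s ->
     leads (above real deg w (ell s)) (ell s) (\prod_(i <- s) g i)) ->
  bijective (polyev g).
Proof.
move=> coef1 coef0 spanned ell_inj ell_surj w_le ell_real tri.
have inj : injective (polyev g).
  suff ker0 p : polyev g p = 0 -> p = 0.
    move=> p q e; apply/eqP; rewrite -subr_eq0; apply/eqP/ker0.
    by rewrite polyevB e subrr.
  move=> p0; apply/eqP/negPn/negP=> pN0.
  pose W m := w (ell (mseq m)).
  have /fset0Pn[m0 m0p] : msupp p != fset0 by rewrite msupp_eq0.
  (* Take a monomial of [p] whose leading label has least weight. Every tail lies strictly above its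
     own leading label, so no other monomial contributes to this coordinate. *)
  have [m mp mmin] : exists2 m, m \in msupp p &
      forall m', m' \in msupp p -> (W m <= W m')%N.
    have ex : exists k, has (fun m => W m == k) (msupp p).
      by exists (W m0); apply/hasP; exists m0.
    case: (ex_minnP ex) => k /hasP[m mp /eqP <-] kmin; exists m => // m' m'p.
    by apply: kmin; apply/hasP; exists m'.
  have := congr1 (coef (ell (mseq m))) p0; rewrite polyevE linear0 linear_sum /=.
  have [c cN0 sp] := tri _ (mseq_sorted m).
  have zero f x : lspan (above real deg w f) x -> forall f', (w f' <= w f)%N ->
      coef f' x = 0.
    move=> h f' f'f; elim: h => [|d f2 z [rf2 _ ff2] _ IH]; first exact: linear0.
    rewrite linearD linearZ /= IH coef0 ?scaler0 ?addr0 // => e.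
    by move: ff2; rewrite e ltnNge f'f.
  rewrite (bigD1_seq m) ?fset_uniq //= [X in _ + X]big1_seq => [|m' /andP[m'm m'p]].
    rewrite addr0 linearZ /= mon_mseq -[X in coef _ X](subrK (c *: b (ell (mseq m)))).
    rewrite linearD (zero _ _ sp) // add0r linearZ /= coef1; last exact/ell_real/mseq_sorted.
    by move/eqP; rewrite !mulf_eq0 oner_eq0 (negPf cN0) mcoeff_eq0 mp.
  rewrite linearZ /= mon_mseq.
  have [c' _ sp'] := tri _ (mseq_sorted m').
  rewrite -[X in coef _ X](subrK (c' *: b (ell (mseq m')))) linearD.
  rewrite (zero _ _ sp') ?mmin // add0r linearZ /= coef0 ?mulr0 ?scaler0 //.
    exact/ell_real/mseq_sorted.
  move=> e; case/eqP: m'm; apply: mseq_inj.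
  by apply: ell_inj e; apply: mseq_sorted.
have surj y : exists p, polyev g p = y.
  elim: (spanned y) => [|c f x rf _ [p px]]; first by exists 0; rewrite raddf0.
  suff [q qf] : exists q, polyev g q = b f.
    by exists (c *: q + p); rewrite polyevD polyevZ qf px.
  (* The labels in a tail have the same degree and larger weight, and weights are bounded in each
     degree, so the induction on the gap terminates. *)
  have [k] := ubnP (bound (deg f) - w f); elim: k f rf => // k IHk f rf ltk.
  have [s ss sf] := ell_surj f rf; have [d dN0] := tri s ss; rewrite sf => sp.
  have [q1 q1E] : exists q, polyev g q = \prod_(i <- s) g i.
    elim: (s) => [|i t [q qE]]; first by exists 1; rewrite big_nil polyev1.
    by exists (polyQ_var i * q); rewrite polyevM polyev_var qE big_cons.
  have [q2 q2E] : exists q, polyev g q = \prod_(i <- s) g i - d *: b f.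
    elim: sp => [|e f' z [rf' df' ff'] _ [q qE]]; first by exists 0; rewrite raddf0.
    have [|q' q'E] := IHk f' rf'.
      have := w_le f' rf'; rewrite df'; move: ff' ltk.
      by move: (bound (deg f)) => B; lia.
    by exists (e *: q' + q); rewrite polyevD polyevZ q'E qE.
  exists (d^-1 *: (q1 - q2)); rewrite polyevZ polyevB q1E q2E.
  by rewrite opprB addrC subrK scalerA mulVf ?scale1r.
pose h y := xget 0 [set p | polyev g p = y]%classic.
have hK y : polyev g (h y) = y.
  by have [p py] := surj y; rewrite /h; case: xgetP => [q _ //|/(_ p)[]].
by exists h => // p; apply: inj; rewrite hK.
Qed.

End Triangular.

(** * Leading terms *)

Section LeadingTerms.
Variable F : finFieldType.
Implicit Types (M N : cplx F) (f g : nat -> nat).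
Local Notation lab := (lab F).
Local Notation lspan := (lspan lab).
Local Notation leads := (leads lab).

Definition real f : Prop := exists M, prof M = f.

Lemma real_prof M : real (prof M). Proof. by exists M. Qed.

Lemma prof0 M : prof M 0 = rdim M.
Proof. by rewrite /prof rho0 // diff_sq0. Qed.

Lemma rank_nil_expr (A : nilrep F) k :
  (rdim A <= k)%N -> \rank (xact A ^+ k) = 0%N.
Proof.
have [la [_ _ iA]] := jordan_form A.
have e0 : (\sum_(i <- la) (i - 0))%N = rdim A.
  by rewrite -(rank_Spart F) -(rep_iso_rank 0 iA) expr0 mxrank1.
rewrite (rep_iso_rank k iA) rank_Spart => lak; apply/eqP; rewrite -e0 in lak.
rewrite sum_nat_seq_eq0; apply/allP=> i ila /=; rewrite subn_eq0.
by apply: leq_trans lak; rewrite (big_rem i) //= subn0 leq_addr.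
Qed.

Lemma prof_stab M k : (rdim M <= k)%N ->
  prof M k = (\rank (diff M) + \rank (diff M))%N.
Proof.
move=> Mk; rewrite prof_hom rank_nil_expr //; apply: leq_trans Mk.
by rewrite [leqRHS]rank_homology leq_addr.
Qed.

Lemma real_stab f k : real f -> (f 0 <= k)%N -> f k = f (f 0).
Proof. by case=> M <-; rewrite prof0 => Mk; rewrite !prof_stab. Qed.

Lemma real_le f k : real f -> (f k <= f 0)%N.
Proof.
case=> M <-; rewrite prof0 prof_hom [leqRHS]rank_homology leq_add2r.
exact: rank_leq_row.
Qed.

Lemma ihall_spanned x : lspan real x.
Proof.
elim/ihall_ind: x => [|x y|c x|M].
- exact: lspan0.
- exact: lspanD.
- exact: lspanZ.
by rewrite ihall_cls_lab; apply: lspan_b; exists M.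
Qed.

Definition lab_coef f : {linear ihall F -> rat^o} :=
  iev (fun f' => (`[< f' = f >])%:R : rat^o).

Lemma lab_coefE f f' : real f' -> lab_coef f (lab f') = (`[< f' = f >])%:R.
Proof. by case=> M <-; rewrite -ihall_cls_lab /lab_coef /= iev_cls. Qed.

Lemma lab_mul M N : lab (prof M) * lab (prof N) =
  (#|F| ^ (rdim M * rdim N))%:R^-1 *:
    \sum_(p | @cocycle F M N p) lab (rho (ext_x p.1) (ext_d p.2)).
Proof. by rewrite -!ihall_cls_lab; apply: ihall_mul_cls. Qed.

Lemma card_pow_neq0 k : (#|F| ^ k)%:R^-1 != 0 :> rat.
Proof.
by rewrite invr_eq0 Num.Theory.pnatr_eq0 -lt0n expn_gt0 (cardD1 0).
Qed.

Lemma rho_ext0 M N p : @cocycle F M N p ->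
  rho (ext_x p.1) (ext_d p.2) 0 = (prof M 0 + prof N 0)%N.
Proof.
case/andP=> _ /eqP dd; rewrite rho0 // !prof0 addnC.
by [].
Qed.

Definition row_above g f : Prop :=
  [/\ real f, f 0 = g 0 & forall k, (g k <= f k)%N].

Definition addf f g k := (f k + g k)%N.

Lemma cocycle0 M N : @cocycle F M N (0, 0).
Proof.
rewrite /cocycle /ext_x /ext_d cx_block !(cplx_cx M) !(cplx_cx N) /=.
by rewrite !(mulmx0, mul0mx, addr0) !eqxx.
Qed.

Lemma rho_ext_dsum M N : rho (@ext_x F M N 0) (ext_d 0) = addf (prof M) (prof N).
Proof. by apply/funext => k; rewrite rho_dsum addnC. Qed.

Lemma real_add f f' : real f -> real f' -> real (addf f f').
Proof.
move=> [M <-] [N <-]; exists (@ext_obj F M N (0, 0)).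
by rewrite (prof_ext_obj (cocycle0 M N)) rho_ext_dsum.
Qed.

Lemma lab_mul_row f f' : real f -> real f' ->
  leads (fun h => row_above (addf f f') h /\ h <> addf f f') (addf f f')
    (lab f * lab f').
Proof.
move=> [M <-] [N <-]; rewrite lab_mul.
apply: leads_sum (card_pow_neq0 _) _ _ => [p cp|].
  split; first by exists (ext_obj p); rewrite prof_ext_obj.
    exact: rho_ext0.
  by move=> k; rewrite /addf addnC rho_ext_ge.
by exists (0, 0); [apply: cocycle0 | apply: rho_ext_dsum].
Qed.

Lemma lab_mul_row_span g g' f f' : row_above g f -> row_above g' f' ->
  f <> g \/ f' <> g' ->
  lspan (fun h => row_above (addf g g') h /\ h <> addf g g') (lab f * lab f').
Proof.
move=> [rf f0 gf] [rf' f'0 gf'] ne; apply: (leads_span (lab_mul_row rf rf')).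
  by split=> //; apply: real_add.
move=> h [rh h0 fh]; split=> [|hg].
  split=> // [|k]; first by rewrite h0 /addf f0 f'0.
  by apply: leq_trans (fh k); apply: leq_add.
have e k : f k = g k /\ f' k = g' k.
  have := fh k; have := gf k; have := gf' k; rewrite hg /addf.
  by move: (f k) (g k) (f' k) (g' k); lia.
by case: ne; case; apply/funext => k; case: (e k).
Qed.

(** Profiles of the row generators. Index 0 is [[K_S]], with zero homology and differential of rank
    1, whence the constant 2. *)
Definition row_prof i k : nat := if i is 0 then 2 else (i - k)%N.

Definition row_ell (s : seq nat) : nat -> nat :=
  foldr (fun i => addf (row_prof i)) (fun _ => 0) s.

Lemma gens_row_lab i : gens_row F i = lab (row_prof i) /\ real (row_prof i).
Proof.
suff [M eM <-] : exists2 M, gens_row F i = ihall_cls M & prof M = row_prof i.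
  by split; [rewrite eM ihall_cls_lab | exists M].
case: i => [|i]; last first.
  exists (stalk (Sn F i.+1)) => //.
  by apply/funext => k; rewrite /prof rho_stalk rank_jordan.
exists (Kcplx (Sn F 1)) => //; apply/funext => k.
have j0 : jordan_mx F 1 = 0.
  by apply/matrixP=> a c; rewrite !mxE !ord1.
by rewrite /prof /= j0 block_mx0; apply: rho_Jmx.
Qed.

Lemma row_ell_real s : real (row_ell s).
Proof.
elim: s => [|i s IHs] /=; last exact: real_add (gens_row_lab i).2 IHs.
exists (stalk (rep0 F)); apply/funext => k; apply/eqP.
by rewrite -leqn0 /prof rho_stalk rank_leq_row.
Qed.

Lemma ihall1_lab : 1 = lab (fun _ => 0).
Proof.
rewrite -[LHS]/(ihall_cls (stalk (rep0 F))) ihall_cls_lab; congr lab.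
by apply/funext => k; apply/eqP; rewrite -leqn0 /prof rho_stalk rank_leq_row.
Qed.

Lemma row_leads s :
  leads (fun h => row_above (row_ell s) h /\ h <> row_ell s) (row_ell s)
    (\prod_(i <- s) gens_row F i).
Proof.
elim: s => [|i s IHs]; first by rewrite big_nil; apply/leads_eq/ihall1_lab.
have [gE ri] := gens_row_lab i; have rs := row_ell_real s.
have abi : row_above (row_prof i) (row_prof i) by [].
have abs : row_above (row_ell s) (row_ell s) by [].
rewrite big_cons gE; apply: (leads_mul (leads_eq (fun _ => False) erefl) IHs).
- exact: lab_mul_row.
- by move=> f' [f'a f's]; apply: lab_mul_row_span => //; right.
- by [].
by [].
Qed.

(* For large k, f k is 2 dim Im d: either the image of d grows, or it keeps its
   dimension and the ranks of the powers of x on homology drop. *)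
Definition col_above g f : Prop :=
  [/\ real f, f 0 = g 0 & (forall k, (g 0 <= k)%N -> (g k < f k)%N) \/
    (forall k, (g 0 <= k)%N -> f k = g k) /\ (forall k, (f k <= g k)%N)].

(** For positive [i], the effect on a profile of putting a column of length [i] in front of the
    Young diagram of the homology: the dimension grows by [i] and the ranks move by one index. For
    [i = 0] a factor [[K_S]] adds 2 everywhere. *)
Definition col_shift i f k : nat :=
  if i is 0 then (f k + 2)%N else if k is k'.+1 then f k' else (f 0 + i)%N.

Definition col_prof i := col_shift i (fun _ => 0%N).

Definition col_ell (s : seq nat) : nat -> nat := foldr col_shift (fun _ => 0%N) s.

Lemma prof_split (A : nilrep F) r :
  prof (split_cplx A r) = (fun k => \rank (xact A ^+ k) + (r + r))%N.
Proof.
by apply/funext => k; rewrite /prof rho_dsum rho_stalk rho_Jmx.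
Qed.

Lemma prof_const r : prof (split_cplx (rep0 F) r) = (fun _ => r + r)%N.
Proof.
rewrite prof_split; apply/funext => k.
suff -> : \rank (xact (rep0 F) ^+ k) = 0%N by [].
by apply/eqP; rewrite -leqn0 rank_leq_row.
Qed.

Lemma prof_trivial_rep i :
  prof (stalk (trivial_rep F i)) = (fun k => if k is 0 then i else 0%N).
Proof.
apply/funext => -[|k]; first by rewrite prof0.
by rewrite /prof rho_stalk exprS mul0r mxrank0.
Qed.

Lemma col_profS i : col_prof i.+1 = prof (stalk (trivial_rep F i.+1)).
Proof. by rewrite prof_trivial_rep; apply/funext => -[]. Qed.

Lemma gens_col_lab i : gens_col F i = lab (col_prof i).
Proof.
case: i => [|i]; first exact: (gens_row_lab 0).1.
rewrite /gens_col ihall_cls_lab; congr lab; apply/funext => k.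
rewrite /prof rho_stalk rank_Spart big_nseq iter_addn_0.
by case: k => [|k]; rewrite /= ?mul1n // subSS sub0n mul0n.
Qed.

Lemma col_prof_real i : real (col_prof i).
Proof.
case: i => [|i]; first exact: (gens_row_lab 0).2.
by rewrite col_profS; apply: real_prof.
Qed.

Lemma lab_mul_homology M N (r := \rank (diff M)) : lab (prof M) * lab (prof N) =
  (#|F| ^ (rdim (homology M) * rdim N))%:R^-1 *:
    \sum_(p | @cocycle F (stalk (homology M)) N p)
       lab (fun k => rho (ext_x p.1) (ext_d p.2) k + (r + r))%N.
Proof.
rewrite -!ihall_cls_lab -[LHS]/(ihall_mul _ _) -ihall_piM ihall_pi_ev.
by rewrite ev_mul_homology ev_mul.
Qed.

Lemma lab_mul_col0 f : real f -> lab (col_prof 0) * lab f = lab (col_shift 0 f).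
Proof.
move=> [N <-]; have -> : col_prof 0 = prof (split_cplx (rep0 F) 1).
  by rewrite prof_const.
rewrite -!ihall_cls_lab -[LHS]/(ihall_mul _ _) -ihall_piM ihall_pi_ev ev_mul_split -iev_pi ihall_piM.
by rewrite ihall_mul1 iev_cls.
Qed.

Lemma rho_ge_rank n (x d : 'M[F]_n) k : (\rank d <= rho x d k)%N.
Proof.
have <- : \rank (row_mx 0 1%:M *m block_mx (x ^+ k) d d 0) = \rank d.
  by rewrite mul_row_block !(mul0mx, mul1mx, add0r) rank_row_mx0.
exact: mxrankM_maxr.
Qed.

(** In an extension by a module with zero action, the power [k.+1] factors through [x ^+ k]. This is
    the source of the index shift: the rank is at most that of [x ^+ k], with equality when
    [row_mx a x] has independent rows. *)
Lemma ext_trivial_expr m n (x : 'M[F]_m) (a : 'M_(m, n)) k :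
  block_mx 0 0 a x ^+ k.+1 = col_mx 0 (x ^+ k) *m row_mx a x.
Proof.
elim: k => [|k IHk].
  by rewrite expr1 expr0 mul_col_mx mul0mx mul1mx -(row_mx0 _ _ n).
rewrite exprS IHk -mulmxE mulmxA mul_block_col !mul0mx mulmx0 !add0r.
by rewrite mulmxE -exprS.
Qed.

(** It suffices that [a] be injective on the kernel of [x], whose dimension is at most [n] by
    hypothesis. *)
Lemma row_free_ext m n (x : 'M[F]_m) : (m <= \rank x + n)%N ->
  exists a : 'M_(m, n), row_free (row_mx a x).
Proof.
move=> mn; pose K := row_base (kermx x); set s := \rank (kermx x) in K.
have sn : (s <= n)%N.
  by rewrite /s mxrank_ker; move: (\rank x) mn => r; lia.
exists (pinvmx K *m pid_mx s); apply: inj_row_free => v.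
have Ka : K *m (pinvmx K *m pid_mx s) = pid_mx s :> 'M_(s, n).
  by rewrite mulmxA mulmxVp ?row_base_free // mul1mx.
move: (pinvmx K *m pid_mx s) Ka => a Ka.
rewrite mul_mx_row -(row_mx0 _ _ n) => /eq_row_mx[va vx].
have /submxP[w vw] : (v <= K)%MS by rewrite eq_row_base; apply/sub_kermxP.
have pf : row_free (pid_mx s : 'M[F]_(s, n)) by rewrite /row_free rank_pid_mx.
rewrite vw; suff -> : w = 0 by rewrite mul0mx.
by apply: (row_free_inj pf); rewrite /= mul0mx -Ka mulmxA -vw.
Qed.

(** The difference [f 0 - f 1] is the number of Jordan blocks of the homology, that is, the length
    of its first column. If the new column is at least as long, a single corner [a] attains all the
    rank bounds at once. The first conclusion serves for the lower terms of a longer product, whose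
    labels may violate this bound. *)
Lemma lab_mul_col f i (g := col_shift i.+1 f) : real f ->
  lspan (col_above g) (lab f * lab (col_prof i.+1)) /\
  ((f 0 <= f 1 + i.+1)%N -> real g /\
     leads (fun h => col_above g h /\ h <> g) g (lab f * lab (col_prof i.+1))).
Proof.
move=> [M fM]; rewrite -fM col_profS lab_mul_homology.
set H := stalk (homology M); set N := stalk _; set r := \rank _.
pose v (p : 'M[F]_(rdim H, rdim N) * 'M[F]_(rdim H, rdim N)) k :=
  (rho (ext_x p.1) (ext_d p.2) k + (r + r))%N.
have f0 : f 0 = (rdim H + (r + r))%N by rewrite -fM prof0 rank_homology.
have fE k : f k = (\rank (xact (homology M) ^+ k) + (r + r))%N by rewrite -fM prof_hom.
have v_above p : @cocycle F H N p -> col_above g (v p).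
  case: p => a b cp; split.
  - rewrite (_ : v _ = addf (prof (ext_obj (a, b))) (fun _ => r + r)%N); last first.
      by apply/funext => k; rewrite /v /addf (prof_ext_obj cp).
    by apply: real_add; [apply: real_prof | rewrite -prof_const; apply: real_prof].
  - by rewrite /v (rho_ext0 cp) !prof0 /g /= f0 addnAC.
  have g_stab k : (g 0 <= k)%N -> g k = (r + r)%N.
    case: k => [|k]; rewrite /g /= ?addnS // => lek; rewrite -fM prof_stab //.
    by rewrite -prof0 fM; move: lek; lia.
  (* The middle differential has [b] as its only nonzero block, so a nonzero [b] raises the stable
     value of the profile; for [b = 0] the profile is made of ranks bounded through
     [ext_trivial_expr]. *)
  case: (eqVneq b 0) => [b0|bN0]; [right | left=> k /g_stab ->]; last first.
    rewrite /v -[X in (X < _)%N]add0n ltn_add2r; apply: leq_trans (rho_ge_rank _ _ _).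
    rewrite lt0n mxrank_eq0; apply: contra bN0 => /eqP.
    by rewrite /ext_d /= -(block_mx0 F _ _ _ _) => /eq_block_mx[_ _ -> _].
  have vE k : v (a, b) k.+1 = (\rank (ext_x a ^+ k.+1) + (r + r))%N.
    by rewrite /v b0 /ext_d /= block_mx0 rho_stalk.
  have v_le k : (v (a, b) k <= g k)%N.
    case: k => [|k]; first by rewrite /v (rho_ext0 cp) !prof0 /g /= f0 addnAC.
    rewrite vE /g /= fE leq_add2r /ext_x /= ext_trivial_expr.
    by apply: leq_trans (mxrankM_maxl _ _) _; rewrite rank_col_0mx.
  split=> // k gk; apply/eqP; rewrite eqn_leq v_le (g_stab _ gk).
  by rewrite /v leq_addl.
split=> [|f01].
  by apply/lspanZ/lspan_sum => p /v_above; apply: lspan_b.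
have [a afree] : exists a : 'M_(rdim H, rdim N), row_free (row_mx a (xact (homology M))).
  apply: row_free_ext; move: f01; rewrite fM f0 fE expr1.
  by rewrite addnAC leq_add2r.
have c0 : @cocycle F H N (a, 0).
  rewrite /cocycle /ext_x /ext_d cx_block !(cplx_cx H) !(cplx_cx N) /=.
  by rewrite !(mulmx0, mul0mx, addr0) !eqxx.
have v0 : v (a, 0) = g.
  apply/funext => -[|k]; first by rewrite /v (rho_ext0 c0) !prof0 /g /= f0 addnAC.
  rewrite /v /ext_d /= block_mx0 rho_stalk /ext_x ext_trivial_expr.
  by rewrite (mxrankMfree _ afree) rank_col_0mx /g /= fE.
split; first by rewrite -v0; case: (v_above _ c0).
by apply: leads_sum (card_pow_neq0 _) v_above _; exists (a, 0).
Qed.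

End LeadingTerms.

(** * Partitions *)

Section SequenceLabels.

Lemma row_ellE s k : row_ell s k = (\sum_(i <- s) row_prof i k)%N.
Proof. by elim: s => [|i s IHs]; rewrite ?big_nil // big_cons -IHs. Qed.

Lemma row_ell_count s k :
  (row_ell s k + row_ell s k.+2 =
     row_ell s k.+1 + row_ell s k.+1 + count_mem k.+1 s)%N.
Proof.
elim: s => [|i s IHs] //=; rewrite /addf.
have e : (row_prof i k + row_prof i k.+2 =
    row_prof i k.+1 + row_prof i k.+1 + (i == k.+1))%N.
  by case: i => [|i]; rewrite /row_prof; lia.
move: IHs e; move: (row_ell s k) (row_ell s k.+1) (row_ell s k.+2).
move: (row_prof i k) (row_prof i k.+1) (row_prof i k.+2) => a b c a' b' c'.
by move: (count_mem k.+1 s) (i == k.+1) => d d'; lia.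
Qed.

Lemma row_ell_large s k : {in s, forall i, i <= k}%N ->
  row_ell s k = (count_mem 0 s * 2)%N.
Proof.
elim: s => [|i s IHs] //= sk; rewrite /addf IHs => [|j js]; last first.
  by apply: sk; rewrite inE js orbT.
have := sk i (mem_head _ _); case: i {sk} => [|i] ik; rewrite mulnDl //.
by congr addn; apply/eqP; rewrite subn_eq0.
Qed.

(** Second differences recover the multiplicities of the positive parts; the multiplicity of 0, that
    is of [[K_S]], is half the stable value. *)
Lemma row_ell_inj : {in sorted geq &, injective row_ell}.
Proof.
move=> s t ss st e; apply: sorted_geq_count => // -[|k]; last first.
  by have := row_ell_count s k; rewrite e row_ell_count => /addnI/esym.
have le u v j : j \in u -> (j <= sumn (u ++ v))%N.
  move=> ju; rewrite sumn_cat; apply: leq_trans (leq_addr _ _).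
  by rewrite sumnE (big_rem j) //= leq_addr.
have := @row_ell_large s (sumn (s ++ t)) (le s t).
rewrite e row_ell_large => [/eqP|j jt]; first by rewrite eqn_pmul2r // => /eqP.
by rewrite sumn_cat addnC -sumn_cat; apply: le.
Qed.

Lemma path_geq_cat_nseq0 x s r : path geq x s -> path geq x (s ++ nseq r 0%N).
Proof.
elim: s x => [|y s IHs] x /=; last by case/andP=> -> /IHs.
by elim: r x => //= r IHr x _; rewrite IHr.
Qed.

Lemma sorted_geq_cat_nseq0 s r : sorted geq s -> sorted geq (s ++ nseq r 0%N).
Proof.
case: s => [|x s] /=; last exact: path_geq_cat_nseq0.
by case: r => //= r _; apply: (@path_geq_cat_nseq0 0 [::]).
Qed.

Lemma sorted_geq0 s : sorted geq s -> head 0%N s = 0%N -> s = nseq (size s) 0%N.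
Proof.
case: s => [|x s] //= + x0; rewrite x0 => ps; congr cons.
elim: s ps => [|y s IHs] //= /andP[]; rewrite leqn0 => /eqP-> ps.
by rewrite -IHs.
Qed.

Lemma sorted_cons_head i s :
  sorted geq (i :: s) = sorted geq s && (head 0%N s <= i)%N.
Proof. by case: s => [|j s] //=; rewrite andbC. Qed.

Lemma col_ell_nseq0 n k : col_ell (nseq n 0%N) k = (n * 2)%N.
Proof. by elim: n => //= n ->; rewrite mulSn addnC. Qed.

Lemma col_ell_head s : sorted geq s ->
  col_ell s 0 = (col_ell s 1 + head 0 s)%N.
Proof.
move=> ss; case E: (head 0%N s) => [|i].
  by rewrite (sorted_geq0 ss E) !col_ell_nseq0 addn0.
by case: s E {ss} => //= j s ->.
Qed.

(** The head of the list is the drop from index 0 to index 1, and a positive head is removed by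
    shifting the function back. A head 0 leaves only zeros, counted by the constant value. *)
Lemma col_ell_inj : {in sorted geq &, injective col_ell}.
Proof.
move=> s t ss st e; elim: s t ss st e => [|i s IHs] t ss st e.
all: have eh : head 0%N t = head 0%N _ := addnI (etrans (esym (col_ell_head st))
    (etrans (congr1 (fun f => f 0%N) (esym e)) (etrans (col_ell_head ss)
    (congr1 (addn^~ _) (congr1 (fun f => f 1%N) e))))).
  have := congr1 (fun f => f 0%N) e; rewrite (sorted_geq0 st eh) col_ell_nseq0.
  by case: (size t).
case: i => [|i] in ss e eh *.
  rewrite (sorted_geq0 ss erefl) (sorted_geq0 st eh) in e *.
  have := congr1 (fun f => f 0%N) e; rewrite !col_ell_nseq0 => /eqP.
  by rewrite eqn_pmul2r // => /eqP->.
case: t => [|j t] //= in st e eh *; rewrite eh in st e *.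
have /andP[s's _] : sorted geq s && (head 0 s <= i.+1)%N.
  by rewrite -sorted_cons_head.
have /andP[t't _] : sorted geq t && (head 0 t <= i.+1)%N.
  by rewrite -sorted_cons_head.
congr cons; apply: IHs => //; apply/funext => k.
exact: (congr1 (fun f => f k.+1) e).
Qed.

Lemma sum_sub1_count (s : seq nat) k :
  (\sum_(i <- s) (i - k) = \sum_(i <- s) (i - k.+1) + count (fun i => k < i) s)%N.
Proof.
elim: s => [|i s IHs]; rewrite ?big_nil // !big_cons IHs /= addnACA.
by congr addn; lia.
Qed.

(* s lists the columns of the Young diagram with rows la, followed by r zeros. *)
Lemma col_ell_surj (la : seq nat) r :
  exists2 s, sorted geq s & forall k, col_ell s k = (\sum_(i <- la) (i - k) + r * 2)%N.
Proof.
suff [n hn] : exists n, {in la, forall i, i <= n}%N.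
  (* [H] treats the columns from number [j] on, counted from 0: column [j] has as length the number
     of parts above [j], and [m] bounds how many nonzero columns remain. *)
  suff H m j : {in la, forall i, i <= j + m}%N -> exists s, [/\ sorted geq s,
      (head 0 s <= count (fun i => j < i) la)%N
      & forall k, col_ell s k = (\sum_(i <- la) (i - (j + k)) + r * 2)%N].
    by have [s [ss _ sE]] := H n 0%N hn; exists s.
  have zero i : count (fun l => i < l)%N la = 0%N -> exists s, [/\ sorted geq s,
      (head 0 s <= 0)%N
    & forall k, col_ell s k = (\sum_(l <- la) (l - (i + k)) + r * 2)%N].
    move=> E; exists (nseq r 0%N); split=> [||k].
    - exact: (@sorted_geq_cat_nseq0 [::]).
    - by case: (r).
    rewrite col_ell_nseq0 big_seq big1 // => l lla.
    have : ~~ has (fun l => i < l)%N la by rewrite has_count E.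
    move/hasPn/(_ l lla); rewrite -leqNgt => li.
    by apply/eqP; rewrite subn_eq0 (leq_trans li) ?leq_addr.
  elim: m j => [|m IHm] j hj; case E: (count (fun i => j < i)%N la) => [|c].
  - exact: zero.
  - have : has (fun i => j < i)%N la by rewrite has_count E.
    by case/hasP=> i /hj; rewrite addn0 ltnNge => ->.
  - exact: zero.
  have [|s [ss hs sE]] := IHm j.+1; first by move=> i /hj; rewrite addSnnS.
  exists (c.+1 :: s); split=> [||[|k]] //; last 2 first.
  - by rewrite /= sE !addn0 addnAC -E -sum_sub1_count.
  - by rewrite /= sE addSnnS.
  rewrite sorted_cons_head ss (leq_trans hs) // -E; apply: sub_count => i /=.
  exact: ltnW.
exists (sumn la) => i ila; rewrite sumnE (big_rem i) //=.
exact: leq_addr.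
Qed.

End SequenceLabels.

(** * The two families of generators *)

Section Generation.
Variable F : finFieldType.
Implicit Types (f g h : nat -> nat).
Local Notation lab := (lab F).
Local Notation real := (real F).
Local Notation row_above := (row_above F).
Local Notation col_above := (col_above F).

Lemma row_prof_seq (la : seq nat) r : 0 \notin la -> forall k,
  row_ell (la ++ nseq r 0%N) k = (\sum_(i <- la) (i - k) + r * 2)%N.
Proof.
move=> la0 k; rewrite row_ellE big_cat /= big_nseq iter_addn_0 mulnC.
rewrite [in LHS]big_seq [in RHS]big_seq; congr addn; apply: eq_bigr => i.
by case: i => // i0; rewrite i0 in la0.
Qed.

Lemma real_parts f : real f -> exists la r, [/\ sorted geq la, 0 \notin la
  & forall k, f k = (\sum_(i <- la) (i - k) + r * 2)%N].
Proof.
case=> M <-; have [la [sla la0 iso]] := jordan_form (homology M).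
exists la, (\rank (diff M)); split=> // k.
by rewrite prof_hom (rep_iso_rank k iso) rank_Spart muln2 -addnn.
Qed.

(** Prefixing a column keeps lower terms strictly lower: in the stable range the shift only
    reindexes or adds 2, so a larger stable value persists, and the termwise comparison is monotone;
    strictness survives because [col_shift i] is injective. *)
Lemma col_shift_above g f h i : col_above g f /\ f <> g ->
  col_above (col_shift i f) h ->
  col_above (col_shift i g) h /\ h <> col_shift i g.
Proof.
move=> [[rf f0 fg] ne] [rh h0 hf].
have s0 : col_shift i f 0 = col_shift i g 0 by case: (i) => [|j]; rewrite /= f0.
have sk k : (col_shift i g 0 <= k)%N ->
    exists2 l, (g 0 <= l)%N & forall e, col_shift i e k = (if i is 0 then (e l + 2)%N else e l).
  case: (i) => [|j] /=; first by exists k; rewrite // (leq_trans _ H) ?leq_addr.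
  by case: k => [|k]; rewrite addnS // ltnS => jk; exists k; rewrite // (leq_trans _ jk) ?leq_addr.
have mono e e' k : (forall l, (e l <= e' l)%N) -> (col_shift i e k <= col_shift i e' k)%N.
  move=> ee; case: (i) => [|j] /=; first by rewrite leq_add2r.
  by case: k => [|k]; rewrite ?leq_add2r.
have shift_inj : col_shift i f = col_shift i g -> f = g.
  move=> e; apply/funext => k; move: e; case: (i) => [|j] e.
    by have /= := congr1 (fun f => f k) e => /addIn.
  exact: (congr1 (fun f => f k.+1) e).
case: fg => [fg|[fg gf]].
  have big k : (col_shift i g 0 <= k)%N -> (col_shift i g k < h k)%N.
    move=> gk; have [l gl sE] := sk k gk.
    have lt : (col_shift i g k < col_shift i f k)%N.
      by rewrite !sE; case: (i) => [|j]; rewrite ?ltn_add2r fg.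
    apply: leq_trans lt _; case: hf => [hf|[hf _]]; first by rewrite ltnW // hf // s0.
    by rewrite hf // s0.
  split; first by split; rewrite ?h0 //; left.
  by move=> e; have := big _ (leqnn _); rewrite e ltnn.
case: hf => [hf|[hf hle]].
  have big k : (col_shift i g 0 <= k)%N -> (col_shift i g k < h k)%N.
    move=> gk; have [l gl sE] := sk k gk.
    by rewrite sE -fg // -sE hf // s0.
  split; first by split; rewrite ?h0 //; left.
  by move=> e; have := big _ (leqnn _); rewrite e ltnn.
split.
  split; rewrite ?h0 //; right; split=> [k gk|k].
    by have [l gl sE] := sk k gk; rewrite hf ?s0 // !sE fg.
  by apply: leq_trans (hle k) (mono _ _ _ gf).
move=> e; apply/ne/shift_inj/funext => k; apply/eqP.
by rewrite eqn_leq mono //= -[X in (X <= _)%N]/(col_shift i g k) -e hle.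
Qed.

Lemma col_above_refl f : real f -> col_above f f.
Proof. by move=> rf; split=> //; right. Qed.

Lemma col_leads s : sorted geq s -> real (col_ell s) /\
  leads lab (fun h => col_above (col_ell s) h /\ h <> col_ell s) (col_ell s)
    (\prod_(i <- s) gens_col F i).
Proof.
elim: s => [_|i s IHs].
  by rewrite big_nil; split; [apply: (row_ell_real F [::]) | apply/leads_eq/ihall1_lab].
rewrite sorted_cons_head => /andP[ss hs]; have {IHs} [rs Ls] := IHs ss.
have gE := gens_col_lab F i; rewrite big_cons gE /=.
case: i => [|i] in hs gE *.
  have r0 f : real f -> real (col_shift 0 f).
    by move=> rf; apply: real_add rf (col_prof_real F 0).
  split; first exact: r0.
  apply: (leads_mul (leads_eq (fun _ => False) erefl) Ls).
  - by apply: leads_eq; apply: lab_mul_col0.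
  - move=> f' [f'a f'n]; have rf' : real f' by case: f'a.
    rewrite (lab_mul_col0 rf'); apply: lspan_b.
    by apply: (@col_shift_above _ f') => //; apply/col_above_refl/r0.
  - by [].
  by [].
(* Sortedness enters here: the new column is at least as long as the head of [s], which is the first
   column built so far. *)
have [_ [|rS LS]] := lab_mul_col i rs; first by rewrite col_ell_head // leq_add2l.
split=> //; rewrite mulrC.
apply: (leads_mul Ls (leads_eq (fun _ => False) erefl)) => //.
move=> f fab; have rf : real f by case: fab => [[]].
apply: lspan_sub (lab_mul_col i rf).1 => h.
exact: col_shift_above.
Qed.

(** A profile is constant from index [f 0] on ([real_stab]), so the finite sum detects any
    difference between comparable profiles. *)
Definition row_weight f : nat := (\sum_(k < (f 0).+1) f k)%N.

(* Lexicographic: first dim Im d, then the ranks in reverse order; the sum is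
   smaller than (f 0 + 1)^2. *)
Definition col_weight f : nat :=
  (f (f 0) * (f 0).+1 ^ 2 + \sum_(k < (f 0).+1) (f 0 - f k))%N.

Lemma ltn_sum n f g : (forall k, f k <= g k)%N ->
  (exists2 k, k < n & f k < g k)%N -> (\sum_(k < n) f k < \sum_(k < n) g k)%N.
Proof.
move=> fg [k kn fgk]; rewrite (bigD1 (Ordinal kn)) //= [ltnRHS](bigD1 (Ordinal kn)) //=.
by rewrite -addSn leq_add // leq_sum.
Qed.

Lemma row_weight_lt g f : real g -> row_above g f -> f <> g ->
  (row_weight g < row_weight f)%N.
Proof.
move=> rg [rf f0 gf] ne; rewrite /row_weight f0; apply: ltn_sum => //.
have [k fk] : exists k, f k <> g k.
  by apply: contra_notP ne => /forallNP h; apply/funext => k; apply: contrapT.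
have lt j : f j <> g j -> (g j < f j)%N.
  by move=> /eqP ne'; rewrite ltn_neqAle eq_sym ne' gf.
case: (leqP k (g 0)) => kn; first by exists k; rewrite ?ltnS ?lt.
exists (g 0); rewrite // lt // => e; apply: fk.
by rewrite (real_stab rg (ltnW kn)) (real_stab rf) ?f0 // ltnW.
Qed.

Lemma col_weight_lt g f : real g -> col_above g f -> f <> g ->
  (col_weight g < col_weight f)%N.
Proof.
move=> rg [rf f0 [lt|[eq le]]] ne; rewrite /col_weight f0.
  have := lt _ (leqnn _); set n := g 0 => ltn.
  have : (\sum_(k < n.+1) (n - g k) <= n.+1 * n)%N.
    rewrite -[X in (_ <= X * _)%N]card_ord -sum_nat_const leq_sum // => k _.
    exact: leq_subr.
  move: (\sum_(k < n.+1) (n - g k))%N (\sum_(k < n.+1) (n - f k))%N => a b an.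
  rewrite -mulnn; nia.
rewrite eq // ltn_add2l.
apply: (@ltn_sum _ (fun k => g 0 - g k)%N (fun k => g 0 - f k)%N) => [k|].
  by rewrite leq_sub2l.
have [k fk] : exists k, f k <> g k.
  by apply: contra_notP ne => /forallNP h; apply/funext => k; apply: contrapT.
have lt : (f k < g k)%N by rewrite ltn_neqAle le andbT; apply/eqP.
exists k; last by rewrite ltn_sub2l // (leq_trans lt) // (real_le _ rg).
by rewrite ltnS leqNgt; apply/negP=> nk; apply: fk; rewrite eq // ltnW.
Qed.

Lemma polynomial_on_bij (g : nat -> ihall F) :
  bijective (polyev (A := ihall F) g) -> polynomial_on g.
Proof.
move=> bij; exists (polyev (A := ihall F) g : {linear polyQ -> ihall F}); split=> //.
- exact: polyev1.
- exact: polyevM.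
exact: polyev_var.
Qed.

(** The degree is the dimension [f 0], common to all terms of a product of basis vectors; [P] is the
    domination order suited to the family. *)
Lemma ihall_triangular (g : nat -> ihall F) (P : (nat -> nat) -> (nat -> nat) -> Prop)
    (w : (nat -> nat) -> nat) (bound : nat -> nat) ell :
  (forall f h, P f h -> real h /\ h 0 = f 0) ->
  {in sorted geq &, injective ell} ->
  (forall f, real f -> exists2 s, sorted geq s & ell s = f) ->
  (forall f, real f -> (w f <= bound (f 0))%N) ->
  (forall f h, real f -> P f h -> h <> f -> (w f < w h)%N) ->
  (forall s, sorted geq s -> real (ell s) /\
     leads lab (fun h => P (ell s) h /\ h <> ell s) (ell s) (\prod_(i <- s) g i)) ->
  polynomial_on g.
Proof.
move=> PR inj surj wle wlt lead; apply: polynomial_on_bij.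
apply: (@triangular_bijective _ _ lab g real (@lab_coef F) (fun f => f 0) w bound ell) => //.
- move=> f rf; rewrite lab_coefE //; case: asboolP => // []; by [].
- by move=> f f' rf' ne; rewrite lab_coefE //; case: asboolP.
- exact: ihall_spanned.
- by move=> s /lead[].
move=> s /lead[rs [c cN0 sp]]; exists c => //; apply: lspan_sub sp => h [Ph ne].
by have [rh h0] := PR _ _ Ph; split=> //; apply: wlt.
Qed.

End Generation.

Theorem proposition4p4 (F : finFieldType) :
  polynomial_on (gens_col F) /\ polynomial_on (gens_row F).
Proof.
split.
  (* All values of a profile are at most [n = f 0]: the stable value contributes at most [n] times
     the square, and each of the [n.+1] terms of the sum is at most [n]. *)
  apply: (@ihall_triangular F _ (col_above F) col_weight
    (fun n => n * n.+1 ^ 2 + n.+1 * n)%N col_ell) => //.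
  - by move=> f h [].
  - exact: col_ell_inj.
  - move=> f /real_parts[la [r [_ _ fE]]]; have [s ss sE] := col_ell_surj la r.
    by exists s => //; apply/funext => k; rewrite sE fE.
  - move=> f rf; rewrite /col_weight leq_add ?leq_mul2r ?(real_le _ rf) ?orbT //.
    rewrite -[X in (_ <= X * _)%N]card_ord -sum_nat_const leq_sum // => k _.
    exact: leq_subr.
  - by move=> f h rf; apply: col_weight_lt.
  exact: col_leads.
apply: (@ihall_triangular F _ (row_above F) row_weight (fun n => n.+1 * n)%N row_ell) => //.
- by move=> f h [].
- exact: row_ell_inj.
- move=> f /real_parts[la [r [sla la0 fE]]]; exists (la ++ nseq r 0%N).
    exact: sorted_geq_cat_nseq0.
  by apply/funext => k; rewrite row_prof_seq // fE.
- move=> f rf; rewrite /row_weight.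
  rewrite -[X in (_ <= X * _)%N]card_ord -sum_nat_const leq_sum // => k _.
  exact: real_le rf.
- by move=> f h rf; apply: row_weight_lt.
by move=> s _; split; [apply: row_ell_real | apply: row_leads].
Qed.
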